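(* Let $n\ge 3$. (1) Suppose that $\phi: M^n\to\mathbb{H}^{n+1}$ is a properly immersed, complete, uniformly horospherically convex hypersurface with injective Gauss map. In addition, assume that the boundary at infinity $\partial_\infty\phi(M^n)$ is a disjoint union of smooth compact submanifolds with no boundary in $\mathbb{S}^n$. Then $\phi$ can eventually be unfolded into an embedded hypersurface along its normal flow; that is, there is $t_0>0$ such that the leaf $\phi_t$ of the normal flow of $\phi$ is embedded for all $t\ge t_0$. (2) Equivalently, suppose that $e^{2\rho}g_{\mathbb{S}^n}$ is a complete conformal metric on a domain $\Omega$ in $\mathbb{S}^n$ with bounded curvature. In addition, assume that the boundary $\partial\Omega$ is a disjoint union of smooth compact submanifolds with no boundary in $\mathbb{S}^n$. Then the hypersurface $$\phi_t=\frac{e^{\rho+t}}{2}\left(1+e^{-2\rho-2t}\left(1+|\nabla\rho|^2\right)\right)(1,x)+e^{-\rho-t}(0,-x+\nabla\rho):\Omega\to\mathbb{H}^{n+1}$$ is embedded when $t$ is large enough.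
   Context: $\mathbb{R}^{1,n+1}$ is $\mathbb{R}^{n+2}$ with $\langle\bar x,\bar x\rangle=-x_0^2+\sum_{i=1}^{n+1}x_i^2$, and $\mathbb{H}^{n+1}=\{\bar x:\langle\bar x,\bar x\rangle=-1,\ x_0>0\}$. The ideal boundary of $\mathbb{H}^{n+1}$ is the unit sphere $\mathbb{S}^n\subset\mathbb{R}^{n+1}$ with round metric $g_{\mathbb{S}^n}$, where $x\in\mathbb{S}^n$ corresponds to the null ray through $(1,x)$. An immersed hypersurface $\phi:M^n\to\mathbb{H}^{n+1}$ is oriented by a unit normal field $\eta$, viewed as a map into $\{\bar x:\langle\bar x,\bar x\rangle=1\}$; its principal curvatures $\kappa_i$ are defined by $d\eta(e_i)=-\kappa_i\,d\phi(e_i)$ in an orthonormal basis of principal directions. ''Complete'' means that the induced metric on $M^n$ is complete. $\phi$ is uniformly horospherically convex if there is a number $\kappa_0<1$ such that all principal curvatures at all points of $M^n$ are $\le\kappa_0$. The Gauss map $G:M^n\to\mathbb{S}^n$ sends $p$ to the point at infinity of the unique horosphere through $\phi(p)$ whose inner unit normal at $\phi(p)$ is $\eta(p)$; equivalently $\phi+\eta=e^{\tilde\rho}(1,G)$ for a function $\tilde\rho$ on $M^n$. The boundary at infinity $\partial_\infty\phi(M^n)\subset\mathbb{S}^n$ is the set of $x\in\mathbb{S}^n$ that are limits, in the Euclidean topology of $\overline{\mathbb{B}^{n+1}}$, of sequences of points of the hypersurface in the Poincaré ball model $\mathbb{B}^{n+1}$. The normal flow of $\phi$ is $\phi_t(p)=\exp_{\phi(p)}(t\,\eta(p))=\cosh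 t\,\phi(p)+\sinh t\,\eta(p)$. In (2), $\rho$ is a smooth function on $\Omega$, $\nabla\rho$ and $|\nabla\rho|$ are taken with respect to $g_{\mathbb{S}^n}$, and $\nabla\rho(x)\in T_x\mathbb{S}^n$ is regarded as a vector of $\mathbb{R}^{n+1}$. A conformal metric has bounded curvature if its curvature (equivalently, since it is locally conformally flat, its Schouten tensor $\frac{1}{n-2}(\mathrm{Ric}_g-\frac{S_g}{2(n-1)}g)$, with $S_g$ the scalar curvature) is bounded with respect to the metric itself. *)

(* Defs.v *)
From HB Require Import structures.
From mathcomp Require Import all_boot all_order all_algebra.
From mathcomp Require Import all_classical all_reals all_analysis.

Set Implicit Arguments.
Unset Strict Implicit.
Unset Printing Implicit Defensive.

Import Order.TTheory GRing.Theory Num.Theory.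
Import numFieldNormedType.Exports.

Local Open Scope classical_set_scope.
Local Open Scope ring_scope.

(* C^k on an open set U of a finite-dimensional space: all iterated directional
   derivatives of order at most k exist and are continuous at the points of U.
   Only used for open U. *)
Fixpoint Ck (R : realType) (V W : normedModType R) (k : nat) (U : set V)
    (f : V -> W) : Prop :=
  (forall x, U x -> {for x, continuous f}) /\
  (if k is k'.+1 then
     forall v, (forall x, U x -> derivable f x v) /\ Ck k' U ('D_v f)
   else True).

Definition smooth (R : realType) (V W : normedModType R) (U : set V)
    (f : V -> W) : Prop := forall k, Ck k U f.

(* A chart is given by its inverse, the parametrization cmap; values of cmap
   outside cdom are junk. *)
Record chart (R : realType) (n : nat) (T : Type) := Chart {
  cdom : set 'rV[R]_n ;
  cmap :> 'rV[R]_n -> T }.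

Definition cimage (R : realType) n (T : Type) (c : chart R n T) : set T :=
  c @` cdom c.

Definition ccoord (R : realType) n (T : Type) (c : chart R n T) : T -> 'rV[R]_n :=
  'pinv_(fun=> 0) (cdom c) c.

Definition smooth_atlas (R : realType) n (M : topologicalType)
    (A : set (chart R n M)) : Prop :=
  [/\ (forall c, A c ->
         [/\ open (cdom c), {in cdom c &, injective c},
             (forall u, cdom c u -> {for u, continuous c}) &
             (forall W, open W -> W `<=` cdom c -> open (c @` W))]),
      (forall p : M, exists2 c, A c & cimage c p) &
      (forall c c', A c -> A c' ->
         smooth (cdom c `&` c @^-1` cimage c') (ccoord c' \o c))].

Definition smooth_manifold (R : realType) n (M : topologicalType)
    (A : set (chart R n M)) : Prop :=
  [/\ hausdorff_space M, @second_countable M, connected [set: M] &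
      smooth_atlas A].

Definition smooth_map (R : realType) n (T : Type) (A : set (chart R n T))
    (W : normedModType R) (f : T -> W) : Prop :=
  forall c, A c -> smooth (cdom c) (f \o c).

Definition immersion (R : realType) n (T : Type) (A : set (chart R n T))
    (W : normedModType R) (f : T -> W) : Prop :=
  smooth_map A f /\
  (forall c u v, A c -> cdom c u -> 'D_v (f \o c) u = 0 -> v = 0).

(* The manifold is the subspace D of T, with charts A; the last clause says that
   the inverse of f on f @` D is continuous. *)
Definition embedding (R : realType) n (T : topologicalType) (D : set T)
    (A : set (chart R n T)) (W : normedModType R) (f : T -> W) : Prop :=
  [/\ immersion A f, {in D &, injective f} &
      forall x B, D x -> nbhs x B ->
        exists2 C, nbhs (f x) C & forall y, D y -> C (f y) -> B y].

Definition C1_curve (R : realType) n (M : topologicalType)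
    (A : set (chart R n M)) (g : R -> M) : Prop :=
  continuous g /\
  (forall c, A c -> Ck (V := R^o) 1 (g @^-1` cimage c) (ccoord c \o g)).

(* Distance and completeness for a Riemannian metric given by the class of
   admissible C^1 curves and their speed.  Curves are C^1 on the whole line and
   only their restriction to [0, 1] matters: piecewise C^1 curves on [0, 1] can
   be reparametrized, without changing their length, to be of this form. *)
Definition curve_dist (R : realType) (T : Type) (curves : set (R -> T))
    (speed : (R -> T) -> R -> R) (p q : T) : \bar R :=
  ereal_inf [set (\int[lebesgue_measure]_(t in `[0%R, 1%R]) (speed g t)%:E)%E
            | g in [set g | [/\ curves g, g 0 = p & g 1 = q]]].

Definition complete_dist (R : realType) (T : topologicalType) (D : set T)
    (dist : T -> T -> \bar R) : Prop :=
  forall p : nat -> T, (forall k, D (p k)) ->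
    (forall e : R, 0 < e -> exists N, forall k l,
       (N <= k)%N -> (N <= l)%N -> (dist (p k) (p l) < e%:E)%E) ->
    exists2 q, D q & p @ \oo --> q.

Definition dot (R : realType) N (x y : 'rV[R]_N) : R :=
  \sum_i x 0 i * y 0 i.

Definition sphere (R : realType) n : set 'rV[R]_n.+1 := [set x | dot x x = 1].

(* R^{1,N} is 'rV_(1 + N), the time coordinate x_0 being the first one. *)
Definition vec (R : realType) N (a : R) (x : 'rV[R]_N) : 'rV[R]_(1 + N) :=
  row_mx a%:M x.

Definition time (R : realType) N (y : 'rV[R]_(1 + N)) : R := y 0 0.

Definition space (R : realType) N (y : 'rV[R]_(1 + N)) : 'rV[R]_N := rsubmx y.

Definition lorentz (R : realType) N (y z : 'rV[R]_(1 + N)) : R :=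
  - (time y * time z) + dot (space y) (space z).

Definition hyperboloid (R : realType) N : set 'rV[R]_(1 + N) :=
  [set y | lorentz y y = -1 /\ 0 < time y].

Section Hypersurface.
Variables (R : realType) (n : nat) (M : topologicalType) (A : set (chart R n M)).
Implicit Types phi eta : M -> 'rV[R]_(1 + n.+1).

Definition immersed_hypersurface phi : Prop :=
  immersion A phi /\ forall p, hyperboloid (phi p).

(* The condition lorentz (phi p) (eta p) = 0 is tangency to H^{n+1}. *)
Definition unit_normal phi eta : Prop :=
  [/\ smooth_map A eta,
      (forall p, lorentz (eta p) (eta p) = 1),
      (forall p, lorentz (phi p) (eta p) = 0) &
      (forall c u v, A c -> cdom c u ->
         lorentz ('D_v (phi \o c) u) (eta (c u)) = 0)].

Definition proper_map phi : Prop :=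
  forall K, K `<=` @hyperboloid R n.+1 -> compact K -> compact (phi @^-1` K).

Definition induced_speed phi (g : R -> M) (t : R) : R :=
  let w := derive1 (phi \o g) t in Num.sqrt (lorentz w w).

Definition complete_hypersurface phi : Prop :=
  complete_dist [set: M] (curve_dist (C1_curve A) (induced_speed phi)).

(* ka lists the principal curvatures at c u; the principal directions e are
   expressed in the chart c. *)
Definition principal_curvatures phi eta (c : chart R n M) (u : 'rV[R]_n)
    (ka : 'I_n -> R) : Prop :=
  exists e : 'I_n -> 'rV[R]_n,
    (forall i j, lorentz ('D_(e i) (phi \o c) u) ('D_(e j) (phi \o c) u)
                 = (i == j)%:R) /\
    (forall i, 'D_(e i) (eta \o c) u = - ka i *: 'D_(e i) (phi \o c) u).

Definition uniformly_horospherically_convex phi eta : Prop :=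
  exists2 k0 : R, k0 < 1 & forall c u ka, A c -> cdom c u ->
    principal_curvatures phi eta c u ka -> forall i, ka i <= k0.

Definition gauss_map phi eta (G : M -> 'rV[R]_n.+1) : Prop :=
  exists rho : M -> R, forall p,
    sphere (G p) /\ phi p + eta p = expR (rho p) *: vec 1 (G p).

(* Stereographic projection from (-1, 0) onto the Poincare ball. *)
Definition to_ball (y : 'rV[R]_(1 + n.+1)) : 'rV[R]_n.+1 :=
  (1 + time y)^-1 *: space y.

Definition boundary_at_infinity phi : set 'rV[R]_n.+1 :=
  [set x | sphere x /\
     exists p : nat -> M, (fun k => to_ball (phi (p k))) @ \oo --> x].

Definition normal_flow phi eta (t : R) (p : M) : 'rV[R]_(1 + n.+1) :=
  ((expR t + expR (- t)) / 2) *: phi p + ((expR t - expR (- t)) / 2) *: eta p.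

End Hypersurface.

(* Embedded k-dimensional submanifold of R^N without boundary, by slice charts.
   A subset of the sphere is a submanifold of the sphere iff it is one of the
   ambient space. *)
Definition smooth_submanifold (R : realType) N (k : nat) (S : set 'rV[R]_N) : Prop :=
  forall x, S x -> exists (U : set 'rV[R]_N) (F F' : 'rV[R]_N -> 'rV[R]_N),
    [/\ open U /\ U x, open (F @` U), smooth U F /\ smooth (F @` U) F',
        (forall y, U y -> F' (F y) = y) &
        (forall y, U y -> (S y <-> forall i : 'I_N, (k <= i)%N -> F y 0 i = 0))].

(* The pieces may have different dimensions; the empty union is allowed.  The
   union is finite: every set is an arbitrary disjoint union of points. *)
Definition union_of_closed_submanifolds (R : realType) n (E : set 'rV[R]_n.+1) : Prop :=
  exists (m : nat) (S : 'I_m -> set 'rV[R]_n.+1),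
    [/\ E = \bigcup_i S i, trivIset setT S &
        forall i, [/\ S i `<=` @sphere R n, compact (S i) &
                      exists k, smooth_submanifold k (S i)]].

Section Curvature.
Variables (R : realType) (n : nat) (g : 'rV[R]_n -> 'M[R]_n).

Definition partial (i : 'I_n) (f : 'rV[R]_n -> R) (u : 'rV[R]_n) : R :=
  'D_(delta_mx 0 i) f u.

(* Gamma^k_{ij} *)
Definition christoffel (k i j : 'I_n) (u : 'rV[R]_n) : R :=
  2^-1 * \sum_l invmx (g u) k l *
    (partial i (fun w => g w j l) u + partial j (fun w => g w i l) u
     - partial l (fun w => g w i j) u).

(* R_{ijkl} = <R(d_i, d_j) d_k, d_l> *)
Definition riemann (i j k l : 'I_n) (u : 'rV[R]_n) : R :=
  \sum_m g u l m *
    (partial i (christoffel m j k) u - partial j (christoffel m i k) u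
     + \sum_p (christoffel m i p u * christoffel p j k u
               - christoffel m j p u * christoffel p i k u)).

Definition gnorm (u a : 'rV[R]_n) : R :=
  Num.sqrt (\sum_i \sum_j g u i j * a 0 i * a 0 j).

Definition riemann_form (u a b c d : 'rV[R]_n) : R :=
  \sum_i \sum_j \sum_k \sum_l
    riemann i j k l u * a 0 i * b 0 j * c 0 k * d 0 l.

End Curvature.

Section SphericalDomain.
Variables (R : realType) (n : nat) (Omega : set 'rV[R]_n.+1).
Implicit Types rho : 'rV[R]_n.+1 -> R.

Definition spherical_domain : Prop :=
  [/\ exists2 U, open U & Omega = U `&` @sphere R n,
      connected Omega & Omega !=set0].

Definition sphere_charts : set (chart R n 'rV[R]_n.+1) :=
  [set c | [/\ open (cdom c), {in cdom c &, injective c}, smooth (cdom c) c,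
               (forall u v, cdom c u -> 'D_v c u = 0 -> v = 0) &
               cimage c `<=` Omega `&` @sphere R n]].

Definition conformal_metric rho (c : chart R n 'rV[R]_n.+1) (u : 'rV[R]_n) :
    'M[R]_n :=
  \matrix_(i, j) (expR (2 * rho (c u)) *
                  dot ('D_(delta_mx 0 i) c u) ('D_(delta_mx 0 j) c u)).

Definition bounded_curvature rho : Prop :=
  exists C : R, forall c u, sphere_charts c -> cdom c u ->
    let N := gnorm (conformal_metric rho c) u in
    forall a b d e, `|riemann_form (conformal_metric rho c) u a b d e|
                    <= C * (N a * N b * N d * N e).

Definition domain_curve (g : R -> 'rV[R]_n.+1) : Prop :=
  Ck (V := R^o) 1 setT g /\ forall t, Omega (g t).

Definition conformal_speed rho (g : R -> 'rV[R]_n.+1) (t : R) : R :=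
  let w := derive1 g t in expR (rho (g t)) * Num.sqrt (dot w w).

Definition complete_conformal rho : Prop :=
  complete_dist Omega (curve_dist domain_curve (conformal_speed rho)).

(* The tangent vector at x representing d rho_x with respect to the round metric. *)
Definition sphere_gradient rho (x : 'rV[R]_n.+1) : 'rV[R]_n.+1 :=
  xget 0 [set w | dot w x = 0 /\
    forall c u v, sphere_charts c -> cdom c u -> c u = x ->
      dot w ('D_v c u) = 'D_v (rho \o c : 'rV[R]_n -> R^o) u].

Definition horospherical_hypersurface rho (t : R) (x : 'rV[R]_n.+1) :
    'rV[R]_(1 + n.+1) :=
  let dr := sphere_gradient rho x in
  (expR (rho x + t) / 2 *
     (1 + expR (- 2 * rho x - 2 * t) * (1 + dot dr dr))) *: vec 1 x
  + expR (- rho x - t) *: vec 0 (- x + dr).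

End SphericalDomain.

(* Main.v *)
Require Import Defs.
From HB Require Import structures.
From mathcomp Require Import all_boot all_order all_algebra.
From mathcomp Require Import all_classical all_reals all_analysis.
From mathcomp Require Import ring lra.
Import Order.TTheory GRing.Theory Num.Theory.
Import numFieldNormedType.Exports.
Local Open Scope classical_set_scope.
Local Open Scope ring_scope.
Set Implicit Arguments.
Unset Strict Implicit.
Unset Printing Implicit Defensive.
Local Notation space := Defs.space.

(** The Gauss image may have any shape, so a path in it joining two given points could be long and
    an estimate along it useless. Null conics are used because nothing blows up along them: when
    P(p) = l N(s), the scale l is fixed by <P, Q> = -2, while <N(s), Q(p1)> = -2 on the whole conic;
    so l <= 2 as long as Q has moved little. The bound |dQ| <= C |dP| then shows that Q has moved
    even less, and bounds on P and Q are what properness or completeness needs for the lift to go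
    on. The common target of p1 and p2 serves to compare Q(p1) with Q(p2) before P(p1) and P(p2) are
    known to be close. As P + Q is twice the point of the leaf, closeness of P follows, and the
    second conic makes the estimate linear in d. Origin of C: in a principal direction dP = (1 - k)
    dphi and dQ = (1 + k) dphi, and the ratio is bounded for k <= k0 < 1. For a conformal metric,
    the curvature controls the Schouten tensor because n >= 3. All norms are taken with respect to
    one observer, the point q1 of the leaf, so that the constants do not depend on it. *)

(* Put P = phi + eta and Q = phi - eta: these are null fields with <P, Q> = -2,
   P points to the Gauss map, and the curvature hypothesis gives |dQ| <= C |dP|
   (in (2), P = e^rho (1, x) and this is a bound on the Schouten tensor of the
   conformal metric).  Along the normal flow P and Q become e^t P and e^-t Q, so
   C is replaced by eps = C e^(-2t), which is small for large t.

   For W orthogonal to P(p) and Q(p), the null conic P(p) + s W + s^2 |W|^2/4 Q(p)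
   then lifts: there are points p(s) with P(p(s)) on the ray of its value at s, and
   Q(p(s)) stays eps-close to Q(p).  Such lifts extend by local inversion of the
   Gauss map, and have limits by properness in (1), by completeness in (2).

   If two points phi_t(p1), phi_t(p2) are at distance d, then, as n + 2 >= 5, some
   unit vector is orthogonal to P and Q at both p1 and p2; it defines a point of
   the light cone that is reached from both, so Q(p1) and Q(p2) are close.  Hence
   p2 is reached from p1 along a short conic, which gives |P(p2) - P(p1)| <= 10 d.
   The case d = 0 is injectivity, and d -> 0 is continuity of the inverse. *)

(** * Maps of class C^k *)

Section CkTheory.
Context {R : realType}.
Implicit Types (V W : normedModType R).

Lemma Ck_continuous V W k (U : set V) (f : V -> W) x :
  Ck k U f -> U x -> {for x, continuous f}.
Proof. by case: k => [|k] /= [h _] /h. Qed.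

Lemma Ck_derivable V W k (U : set V) (f : V -> W) x v :
  Ck k.+1 U f -> U x -> derivable f x v.
Proof. by move=> [_ /(_ v)[h _]] /h. Qed.

Arguments Ck_derivable {V W k U f x} v.

Lemma Ck_derive V W k (U : set V) (f : V -> W) v :
  Ck k.+1 U f -> Ck k U ('D_v f).
Proof. by move=> [_ /(_ v)[]]. Qed.

Lemma CkS V W k (U : set V) (f : V -> W) :
  (forall x, U x -> {for x, continuous f}) ->
  (forall v x, U x -> derivable f x v) -> (forall v, Ck k U ('D_v f)) ->
  Ck k.+1 U f.
Proof. by move=> h1 h2 h3; split=> // v; split=> // x; exact: h2. Qed.

Lemma CkW V W k (U : set V) (f : V -> W) : Ck k.+1 U f -> Ck k U f.
Proof.
elim: k f => [|k ih] f hf; first by split=> // x; exact: Ck_continuous hf.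
apply: CkS => [x|v x|v]; [exact: Ck_continuous hf|exact: Ck_derivable hf|].
exact/ih/Ck_derive.
Qed.

Lemma open_near_eq V (T : Type) (U : set V) (f g : V -> T) x :
  open U -> (forall x, U x -> f x = g x) -> U x -> \near x, f x = g x.
Proof.
by move=> oU fg Ux; apply: filterS (open_nbhs_nbhs (conj oU Ux)) => y /fg.
Qed.

Lemma near_continuous V W (f g : V -> W) x : (\near x, f x = g x) ->
  {for x, continuous f} -> {for x, continuous g}.
Proof.
move=> fg; rewrite /prop_for /continuous_at -(nbhs_singleton fg).
by apply: cvg_trans; apply: near_eq_cvg; apply: filterS fg => y.
Qed.

Lemma Ck_ext V W k (U : set V) (f g : V -> W) : open U ->
  (forall x, U x -> f x = g x) -> Ck k U f -> Ck k U g.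
Proof.
elim: k f g => [|k ih] f g oU fg hf.
  split=> // x Ux; apply: near_continuous (Ck_continuous hf Ux).
  exact: open_near_eq Ux.
apply: CkS => [x Ux|v x Ux|v].
- apply: near_continuous (Ck_continuous hf Ux).
  exact: open_near_eq Ux.
- apply: (@near_eq_derivable _ _ _ f g); last exact: Ck_derivable hf Ux.
  exact: open_near_eq Ux.
- apply: (ih _ _ oU _ (Ck_derive v hf)) => x Ux.
  exact: (near_eq_derive v (open_near_eq oU fg Ux)).
Qed.

Lemma Ck_subset V W k (U U' : set V) (f : V -> W) :
  U' `<=` U -> Ck k U f -> Ck k U' f.
Proof.
move=> s; elim: k f => [|k ih] f hf.
  by split=> // x /s; exact: Ck_continuous hf.
apply: CkS => [x /s|v x /s|v].
- exact: Ck_continuous hf.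
- exact: Ck_derivable hf.
- exact/ih/Ck_derive.
Qed.

Lemma Ck_cst V W k (U : set V) (w : W) : Ck k U (fun=> w : W).
Proof.
elim: k w => [|k ih] w; first by split=> // x _; exact: cvg_cst.
apply: CkS => [x _|v x _|v]; [exact: cvg_cst|exact: derivable_cst|].
rewrite (_ : 'D_v _ = fun=> 0)//; apply/funext => x; exact: derive_cst.
Qed.

Lemma Ck_add V W k (U : set V) (f g : V -> W) : open U ->
  Ck k U f -> Ck k U g -> Ck k U (fun x => f x + g x).
Proof.
move=> oU; elim: k f g => [|k ih] f g hf hg.
  split=> // x Ux; apply: cvgD; [exact: (Ck_continuous hf Ux)|exact: (Ck_continuous hg Ux)].
apply: CkS => [x Ux|v x Ux|v].
- by apply: cvgD; [exact: (Ck_continuous hf Ux)|exact: (Ck_continuous hg Ux)].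
- by apply: (@derivableD _ _ _ f g); [exact: (Ck_derivable v hf Ux)|exact: (Ck_derivable v hg Ux)].
- apply: (Ck_ext oU _ (ih _ _ (Ck_derive v hf) (Ck_derive v hg))) => x Ux.
  by rewrite (@deriveD _ _ _ f g)//; [exact: (Ck_derivable v hf Ux)|exact: (Ck_derivable v hg Ux)].
Qed.

Lemma Ck_scale V W k (U : set V) (a : R) (f : V -> W) : open U ->
  Ck k U f -> Ck k U (fun x => a *: f x).
Proof.
move=> oU; elim: k f => [|k ih] f hf.
  split=> // x Ux; apply: cvgZr; exact: (Ck_continuous hf Ux).
apply: CkS => [x Ux|v x Ux|v].
- by apply: cvgZr; exact: (Ck_continuous hf Ux).
- by apply: (@derivableZ _ _ _ f); exact: (Ck_derivable v hf Ux).
- apply: Ck_ext oU _ (ih _ (Ck_derive v hf)) => x Ux.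
  by rewrite (@deriveZ _ _ _ f)//; exact: (Ck_derivable v hf Ux).
Qed.

Lemma Ck_mul V k (U : set V) (f g : V -> R) : open U ->
  Ck k U f -> Ck k U g -> Ck k U (fun x => f x * g x).
Proof.
move=> oU; elim: k f g => [|k ih] f g hf hg.
  split=> // x Ux; apply: cvgM; [exact: (Ck_continuous hf Ux)|exact: (Ck_continuous hg Ux)].
apply: CkS => [x Ux|v x Ux|v].
- by apply: cvgM; [exact: (Ck_continuous hf Ux)|exact: (Ck_continuous hg Ux)].
- by apply: (@derivableM _ _ f g); [exact: (Ck_derivable v hf Ux)|exact: (Ck_derivable v hg Ux)].
- apply: Ck_ext oU _ (Ck_add oU (ih _ _ (CkW hf) (Ck_derive v hg))
    (ih _ _ (CkW hg) (Ck_derive v hf))) => x Ux.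
  by rewrite (@deriveM _ _ f g)//; [exact: (Ck_derivable v hf Ux)|exact: (Ck_derivable v hg Ux)].
Qed.

Lemma Ck_inv V k (U : set V) (f : V -> R) : open U ->
  (forall x, U x -> f x != 0) -> Ck k U f -> Ck k U (fun x => (f x)^-1).
Proof.
move=> oU f0; elim: k => [|k ih] hf.
  by split=> // x Ux; apply: cvgV; [exact: f0|exact: (Ck_continuous hf Ux)].
apply: CkS => [x Ux|v x Ux|v].
- by apply: cvgV; [exact: f0|exact: (Ck_continuous hf Ux)].
- by apply: (@derivableV _ _ f); [exact: f0|exact: (Ck_derivable v hf Ux)].
- have h := Ck_mul oU (ih (CkW hf)) (ih (CkW hf)).
  have := Ck_scale (-1) oU (Ck_mul oU h (Ck_derive v hf)).
  apply: Ck_ext oU _ => x Ux.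
  rewrite (@deriveV _ _ f)//; [|exact: f0|exact: (Ck_derivable v hf Ux)].
  by rewrite /GRing.scale/= mulN1r mulNr expr2 invfM.
Qed.

(** [g] is only derivable along [v], so the chain rule is applied on the line [h *: v + x]: for a
    function of one real variable, derivable and differentiable agree. *)
Lemma is_derive_comp V V' W (f : V' -> W) (g : V -> V') x v :
  differentiable f (g x) -> derivable g x v ->
  is_derive x v (f \o g) ('d f (g x) ('D_v g x)).
Proof.
move=> df dg; have /derivable1_diffP dg1 := (derivable1P g x v).1 dg.
set g1 := fun h : R => g (h *: v + x).
have g10 : g1 0 = g x by rewrite /g1 scale0r add0r.
have df1 : differentiable f (g1 0) by rewrite g10.
have dfg : differentiable (f \o g1) 0 by apply: (@differentiable_comp _ _ _ _ g1 f).
have E W' (h : V -> W') : 'D_v h x = 'D_1 (fun a : R => h (a *: v + x)) 0.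
  apply: (congr1 (fun k : R -> W' => lim (k @ 0^'))); apply/funext => a /=.
  by rewrite addr0 scale0r add0r [_%:A]mulr1.
split; first by apply/derivable1P/derivable1_diffP.
have h1 : 'D_1 (f \o g1) 0 = 'd f (g1 0) ('D_1 g1 0).
  by rewrite (deriveE _ dfg) (deriveE _ dg1) (@diff_comp _ _ _ _ g1 f _ dg1 df1).
by rewrite (E _ (f \o g)) (E _ g) -g10; exact: h1.
Qed.

Lemma Ck_expR V k (U : set V) (f : V -> R) : open U ->
  Ck k U f -> Ck k U (fun x => expR (f x)).
Proof.
move=> oU.
have D x v : derivable f x v -> is_derive x v (expR \o f) (expR (f x) * 'D_v f x).
  move=> df.
  have de : differentiable (@expR R) (f x) by exact/derivable1_diffP/derivable_expR.
  have [h1 h2] := is_derive_comp de df; split=> //.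
  rewrite h2 -[X in 'd _ _ X = _]mulr1 [LHS]linearZ /= -deriveE//.
  by rewrite derive_val mulrC.
elim: k => [|k ih] hf.
  split=> // x Ux; apply: continuous_comp; first exact: (Ck_continuous hf Ux).
  exact: continuous_expR.
apply: CkS => [x Ux|v x Ux|v].
- apply: continuous_comp; first exact: (Ck_continuous hf Ux).
  exact: continuous_expR.
- by have [] := D x v (Ck_derivable v hf Ux).
- apply: Ck_ext oU _ (Ck_mul oU (ih (CkW hf)) (Ck_derive v hf)) => x Ux.
  by have [_ ->] := D x v (Ck_derivable v hf Ux).
Qed.

Lemma coord_le_norm m (h : 'rV[R]_m) i : `|h 0 i| <= `|h|.
Proof.
rewrite [leRHS]/Num.Def.normr/= mx_normrE.
exact: (le_bigmax _ (fun i : 'I_1 * 'I_m => `|h i.1 i.2|) (0, i)).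
Qed.

Lemma norm_rowP m (h : 'rV[R]_m) e : 0 <= e ->
  (forall i, `|h 0 i| <= e) -> `|h| <= e.
Proof.
move=> e0 he; rewrite [leLHS]/Num.Def.normr/= mx_normrE.
by apply: bigmax_le => // -[i j] _ /=; rewrite ord1.
Qed.

Lemma derive_segment m (f : 'rV[R]_m -> R) (y v : 'rV[R]_m) (s : R) :
  (forall a : R, `|a| <= `|s| -> derivable f (y + a *: v) v) ->
  exists2 a, `|a| <= `|s| & f (y + s *: v) - f y = s * 'D_v f (y + a *: v).
Proof.
move=> df.
have D (a : R) : `|a| <= `|s| ->
    is_derive a 1 (fun a : R => f (y + a *: v)) ('D_v f (y + a *: v)).
  move=> /df h1; have /cvg_ex [l hl] := h1.
  apply: DeriveDef.
    apply/cvg_ex; exists l; apply: cvg_trans hl; apply: near_eq_cvg.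
    near=> b; rewrite /= [b%:A]mulr1.
    by rewrite scalerDl addrCA.
  apply: (congr1 (fun k : R -> R => lim (k @ 0^'))).
  apply/funext => b /=; rewrite [b%:A]mulr1.
  by rewrite scalerDl addrCA.
have Dw (b c : R) : (forall a, a \in `[b, c]%R -> `|a| <= `|s|) -> b < c ->
    exists2 a, a \in `]b, c[%R &
      f (y + c *: v) - f (y + b *: v) = 'D_v f (y + a *: v) * (c - b).
  move=> h bc.
  apply: (@MVT R (fun a => f (y + a *: v)) (fun a => 'D_v f (y + a *: v)) b c bc).
    by move=> a abc; apply: D; apply: h; exact: subset_itv_oo_cc abc.
  apply: derivable_within_continuous => a abc.
  by apply: ex_derive; apply: D; apply: h.
case: (ltrgt0P s) => s0.
- have [a|a] := Dw 0 s _ s0.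
    by rewrite in_itv/= => /andP[a0 a1]; rewrite !ger0_norm// ltW.
  rewrite in_itv/= => /andP[a0 a1]; rewrite scale0r addr0 subr0 => ->.
  by exists a; rewrite 1?mulrC// !gtr0_norm// ltW.
- have [a|a] := Dw s 0 _ s0.
    by rewrite in_itv/= => /andP[a0 a1]; rewrite !ler0_norm ?lerN2// ltW.
  rewrite in_itv/= => /andP[a0 a1]; rewrite scale0r addr0 sub0r => e.
  exists a; first by rewrite !ltr0_norm// lerN2 ltW.
  by rewrite -opprB e mulrN opprK mulrC.
- exists 0; first by rewrite normr0.
  by rewrite s0 scale0r addr0 subrr mul0r.
Unshelve. all: by end_near. Qed.

Lemma differentiable_linear_approx V W (f : V -> W) (L : {linear V -> W}) x :
  continuous L ->
  (forall e, 0 < e -> \forall h \near 0, `|f (h + x) - f x - L h| <= e * `|h|) ->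
  differentiable f x.
Proof.
move=> Lc h.
have E : f \o shift x = cst (f x) + L +o_ 0 id.
  apply/eqaddoP => e /h; apply: filterS => y.
  by rewrite /= !fctE opprD addrA.
by apply/diff_locallyP; rewrite (diff_unique Lc E).
Qed.

(** The increment from [x] to [x + h] is telescoped over the coordinates: [tr k h] keeps the first k
    of them, and each one-coordinate step is a mean value theorem with a partial derivative close to
    its value at [x]. *)
Lemma C1_differentiable m (U : set 'rV[R]_m) (f : 'rV[R]_m -> R) x :
  open U -> U x -> Ck 1 U f -> differentiable f x.
Proof.
move=> oU Ux hf.
pose D i := 'D_(delta_mx 0 i) f : 'rV[R]_m -> R.
pose tr k (h : 'rV[R]_m) : 'rV[R]_m := \row_j (if (j < k)%N then h 0 j else 0).
have trm h : tr m h = h by apply/rowP => j; rewrite mxE ltn_ord.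
have tr0 h : tr 0%N h = 0 by apply/rowP => j; rewrite !mxE.
have trS (k : 'I_m) h : tr k.+1 h = tr k h + h 0 k *: delta_mx 0 k.
  apply/rowP => j; rewrite !mxE eqxx /= ltnS leq_eqVlt.
  case: eqVneq => [/val_inj ->|jk]; rewrite ?ltnn ?add0r ?eqxx ?mulr1//=.
  rewrite (_ : (j == k) = false) ?mulr0 ?addr0//.
  by apply/eqP => e; rewrite e eqxx in jk.
have trn k h : `|tr k h| <= `|h|.
  by apply: norm_rowP => // j; rewrite mxE; case: ifP => _; rewrite ?coord_le_norm ?normr0.
pose L (h : 'rV[R]_m) : R := \sum_i h 0 i * D i x.
have Llin : linear L.
  move=> a u v; rewrite /L /GRing.scale/= mulr_sumr -big_split/=.
  by apply: eq_bigr => i _; rewrite !mxE; ring.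
pose LM := GRing.isLinear.Build _ _ _ _ _ Llin.
pose LL : {linear 'rV[R]_m -> R} := HB.pack L LM.
have Lc : continuous L.
  move=> h; apply: differentiable_continuous.
  rewrite (_ : L = \sum_i (fun h : 'rV[R]_m => h 0 i * D i x)); last first.
    by apply/funext => k; rewrite fct_sumE.
  apply: (@differentiable_sum _ _ _ m (fun i (h : 'rV[R]_m) => h 0 i * D i x : R)) => i.
  apply: (@differentiableM _ _ (fun h : 'rV[R]_m => h 0 i) (fun=> D i x)).
    exact: differentiable_coord.
  exact: differentiable_cst.
apply: (differentiable_linear_approx (L := LL) Lc) => e e0.
(* Each of the m coordinates gets a share of [e]; the successor covers m = 0. *)
have e1 : 0 < e / m.+1%:R by rewrite divr_gt0.
have N : \forall y \near x, U y /\ forall i, `|D i y - D i x| <= e / m.+1%:R.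
  near=> y; split; first by near: y; exact: open_nbhs_nbhs.
  near: y; apply: filter_forall => i.
  have := Ck_continuous (Ck_derive (delta_mx 0 i) hf) Ux.
  move=> /cvgrPdist_le /(_ _ e1); apply: filterS => y.
  by rewrite distrC.
move: N => /nbhs_ballP [r /= r0 hr].
have {}hr y : `|y - x| < r -> U y /\ forall i, `|D i y - D i x| <= e / m.+1%:R.
  by move=> yr; apply: hr; rewrite -ball_normE /= distrC.
near=> h.
have hrn : `|h| < r.
  near: h; apply/nbhs_ballP; exists r => // h.
  by rewrite -ball_normE /= sub0r normrN.
have key (k : nat) : (k <= m)%N ->
    `|f (x + tr k h) - f x - \sum_(i < m | (i < k)%N) h 0 i * D i x|
      <= k%:R * (e / m.+1%:R * `|h|).
  elim: k => [|k ih] km.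
    by rewrite tr0 addr0 subrr big_pred0// subrr normr0 mul0r.
  pose k' := Ordinal km.
  have tk : tr k.+1 h = tr k h + h 0 k' *: delta_mx 0 k' by exact: (trS k').
  have in_r (a : R) : `|a| <= `|h 0 k'| -> `|x + tr k h + a *: delta_mx 0 k' - x| < r.
    move=> ha; apply: le_lt_trans hrn; rewrite addrAC [x + _]addrC addrK.
    apply: norm_rowP => // j; rewrite !mxE eqxx /=.
    case: ltnP => [jk|kj].
      rewrite (_ : (j == k') = false) ?mulr0 ?addr0 ?coord_le_norm//.
      by apply/eqP => ej; rewrite ej ltnn in jk.
    rewrite add0r; case: eqP => _; rewrite ?mulr0 ?normr0 ?mulr1//.
    by rewrite (le_trans ha)// coord_le_norm.
  have [a ha fa] : exists2 a, `|a| <= `|h 0 k'| &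
      f (x + tr k h + h 0 k' *: delta_mx 0 k') - f (x + tr k h)
        = h 0 k' * D k' (x + tr k h + a *: delta_mx 0 k').
    apply: derive_segment => a /in_r /hr [Uy _].
    exact: Ck_derivable hf Uy.
  have [_ /(_ k') hD] := hr _ (in_r _ ha).
  rewrite (bigD1 k') ?ltnSn//= (eq_bigl (fun i : 'I_m => (i < k)%N)); last first.
    move=> i; rewrite ltnS leq_eqVlt -(inj_eq val_inj) /=.
    by case: ltngtP.
  rewrite tk addrA.
  rewrite (_ : _ - _ = (f (x + tr k h) - f x - \sum_(i < m | (i < k)%N) h 0 i * D i x)
      + h 0 k' * (D k' (x + tr k h + a *: delta_mx 0 k') - D k' x)); last first.
    by rewrite mulrBr -fa; ring.
  apply: (le_trans (ler_normD _ _)); rewrite -natr1 mulrDl mul1r.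
  apply: lerD; first exact/ih/ltnW.
  rewrite normrM mulrC; apply: ler_pM => //; exact: coord_le_norm.
have := key m (leqnn m); rewrite trm (eq_bigl predT); last first.
  by move=> i; rewrite ltn_ord.
move=> /le_trans; rewrite [h + x]addrC; apply.
rewrite mulrA; apply: ler_wpM2r => //.
rewrite mulrCA ler_piMr ?(ltW e0)// ler_pdivrMr// mul1r ler_nat.
exact: leqnSn.
Unshelve. all: by end_near. Qed.

End CkTheory.
Arguments Ck_derivable {R V W k U f x} v.

Section CkTheory2.
Context {R : realType}.
Implicit Types (V W : normedModType R).

Lemma Ck_sum V W k (U : set V) n (f : 'I_n -> V -> W) : open U ->
  (forall i, Ck k U (f i)) -> Ck k U (fun x => \sum_i f i x).
Proof.
move=> oU hf; elim: (index_enum _) => [|i r ih].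
  by apply: Ck_ext oU _ (Ck_cst k U 0) => x _; rewrite big_nil.
by apply: Ck_ext oU _ (Ck_add oU (hf i) ih) => x _; rewrite big_cons.
Qed.

Lemma row_continuous (T : topologicalType) n (f : T -> 'rV[R]_n) x :
  (forall j, {for x, continuous (fun y => f y 0 j)}) -> {for x, continuous f}.
Proof.
move=> hf; apply/cvgrPdist_le => e e0; near=> y.
apply: norm_rowP; first exact: ltW.
move=> i; rewrite !mxE; move: i; near: y; apply: filter_forall => i.
exact: ((cvgrPdist_le _ _).1 (hf i)).
Unshelve. all: by end_near. Qed.

Lemma coord_continuous_at (T : topologicalType) n (f : T -> 'rV[R]_n) x j :
  {for x, continuous f} -> {for x, continuous (fun y => f y 0 j)}.
Proof.
move=> hf; apply: (@continuous_comp _ _ _ f (fun M : 'rV[R]_n => M 0 j)) => //.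
exact: coord_continuous.
Qed.

Lemma derive_coord V n (f : V -> 'rV[R]_n) x v j : derivable f x v ->
  ('D_v f x) 0 j = 'D_v (fun y => f y 0 j) x.
Proof. by move=> df; rewrite derive_mx// mxE. Qed.

Lemma Ck_coord V k (U : set V) n (f : V -> 'rV[R]_n) j : open U ->
  Ck k U f -> Ck k U (fun x => f x 0 j).
Proof.
move=> oU; elim: k f => [|k ih] f hf.
  by split=> // x Ux; exact: (coord_continuous_at (Ck_continuous hf Ux)).
apply: CkS => [x Ux|v x Ux|v].
- exact: (coord_continuous_at (Ck_continuous hf Ux)).
- exact: ((derivable_mxP f x v).1 (Ck_derivable v hf Ux) 0 j).
- apply: (Ck_ext oU _ (ih _ (Ck_derive v hf))) => x Ux.
  exact: derive_coord (Ck_derivable v hf Ux).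
Qed.

Lemma Ck_row V k (U : set V) n (f : V -> 'rV[R]_n) : open U ->
  (forall j, Ck k U (fun x => f x 0 j)) -> Ck k U f.
Proof.
move=> oU; elim: k f => [|k ih] f hf.
  split=> // x Ux; apply: row_continuous => j.
  exact: (Ck_continuous (hf j) Ux).
have df v x : U x -> derivable f x v.
  move=> Ux; apply/derivable_mxP => i j; rewrite ord1.
  exact: (Ck_derivable v (hf j) Ux).
apply: CkS => [x Ux|v x Ux|v].
- by apply: row_continuous => j; exact: (Ck_continuous (hf j) Ux).
- exact: df.
- apply: ih => j; apply: (Ck_ext oU _ (Ck_derive v (hf j))) => x Ux.
  by rewrite derive_coord//; exact: df.
Qed.

Lemma linear_rowE m (L : {linear 'rV[R]_m -> R}) h :
  L h = \sum_i h 0 i * L (delta_mx 0 i).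
Proof.
by rewrite {1}(row_sum_delta h) linear_sum; apply: eq_bigr => i _; rewrite linearZ.
Qed.

Lemma derive_comp_row V m (f : 'rV[R]_m -> R) (g : V -> 'rV[R]_m) x v :
  differentiable f (g x) -> derivable g x v ->
  is_derive x v (f \o g)
    (\sum_i ('D_v g x) 0 i * 'D_(delta_mx 0 i) f (g x)).
Proof.
move=> df dg; have [h1 h2] := is_derive_comp df dg; split=> //.
rewrite h2 linear_rowE; apply: eq_bigr => i _.
by rewrite (deriveE _ df).
Qed.

Lemma Ck_comp V k (U : set V) m (U' : set 'rV[R]_m) (f : 'rV[R]_m -> R)
    (g : V -> 'rV[R]_m) : open U -> open U' -> (forall x, U x -> U' (g x)) ->
  Ck k U' f -> Ck k U g -> Ck k U (f \o g).
Proof.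
move=> oU oU' UU'; elim: k f => [|k ih] f hf hg.
  split=> // x Ux; apply: continuous_comp; first exact: (Ck_continuous hg Ux).
  exact: (Ck_continuous hf (UU' _ Ux)).
have D v x : U x -> is_derive x v (f \o g)
    (\sum_i ('D_v g x) 0 i * 'D_(delta_mx 0 i) f (g x)).
  move=> Ux; apply: derive_comp_row; last exact: (Ck_derivable v hg Ux).
  apply: C1_differentiable oU' (UU' _ Ux) _.
  clear -hf; elim: k hf => // k ih /CkW; exact: ih.
apply: CkS => [x Ux|v x Ux|v].
- apply: continuous_comp; first exact: (Ck_continuous hg Ux).
  exact: (Ck_continuous hf (UU' _ Ux)).
- by have [] := D v x Ux.
- pose F i x := ('D_v g x) 0 i * 'D_(delta_mx 0 i) f (g x).
  have hF i : Ck k U (F i).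
    apply: (Ck_mul oU _ _); first exact: (Ck_coord i oU (Ck_derive v hg)).
    exact: (ih _ (Ck_derive _ hf) (CkW hg)).
  apply: (Ck_ext oU _ (Ck_sum oU hF)) => x Ux.
  by have [_ ->] := D v x Ux.
Qed.

Lemma is_derive_translate V W (f : V -> W) a x v : derivable f (x + a) v ->
  is_derive x v (fun y => f (y + a)) ('D_v f (x + a)).
Proof.
move=> df.
have E : (fun h : R => h^-1 *: (f (h *: v + x + a) - f (x + a))) =
    (fun h : R => h^-1 *: (f (h *: v + (x + a)) - f (x + a))).
  by apply/funext => h; rewrite addrA.
split; rewrite /derivable /derive /=; first by rewrite E.
by rewrite E.
Qed.

(** Two mean value theorems: along [v] for the difference [g] of [f] in direction [w], then along
    [w] for the derivative of [f] along [v]. The second difference is symmetric in [v] and [w],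
    whence the equality of mixed derivatives. *)
Lemma second_difference m (U : set 'rV[R]_m) (f : 'rV[R]_m -> R) x v w :
  open U -> U x -> Ck 2 U f -> forall e, 0 < e ->
  \forall s \near (0 : R)^',
    `|(s * s)^-1 * (f (x + s *: v + s *: w) - f (x + s *: v) - (f (x + s *: w) - f x))
     - 'D_w ('D_v f) x| <= e.
Proof.
move=> oU Ux hf e e0.
have hf1 := Ck_derive v hf.
have df y (Uy : U y) := Ck_derivable v hf Uy.
(* the derivatives are made opaque to keep unification from unfolding them *)
have [D1 D1E] : exists D1, 'D_v f = D1 by exists ('D_v f).
rewrite D1E in hf1 *.
have dD1 y (Uy : U y) := Ck_derivable w hf1 Uy.
have C := Ck_continuous (Ck_derive w hf1) Ux.
have [D2 D2E] : exists D2, 'D_w D1 = D2 by exists ('D_w D1).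
rewrite D2E in C *.
have N : \forall y \near x, U y /\ `|D2 y - D2 x| <= e.
  near=> y; split; first by near: y; exact: open_nbhs_nbhs.
  near: y; move: C => /cvgrPdist_le /(_ _ e0); apply: filterS => y.
  by rewrite distrC.
move: N => /nbhs_ballP [r /= r0 hr].
have {}hr y : `|y - x| < r -> U y /\ `|D2 y - D2 x| <= e.
  by move=> yr; apply: hr; rewrite -ball_normE /= distrC.
pose K := `|v| + `|w| + 1.
have K0 : 0 < K by rewrite ltr_wpDl// addr_ge0.
near=> s.
have s0 : s != 0 by near: s; exact: nbhs_dnbhs_neq.
have sr : `|s| * K < r.
  rewrite -ltr_pdivlMr//; near: s; apply: dnbhs0_lt; exact: divr_gt0.
have in_r a b : `|a| <= `|s| -> `|b| <= `|s| -> `|x + a *: v + b *: w - x| < r.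
  move=> ha hb; apply: le_lt_trans sr.
  rewrite addrAC [x + _]addrC addrK; apply: (le_trans (ler_normD _ _)).
  rewrite !normrZ /K !mulrDr mulr1 -addrA lerD ?ler_wpM2r//.
  by rewrite ler_wpDr// ler_wpM2r.
pose g y := f (y + s *: w) - f y.
have Dg a : `|a| <= `|s| -> is_derive (x + a *: v) v g
    (D1 (x + a *: v + s *: w) - D1 (x + a *: v)).
  move=> ha; have [U1 _] := hr _ (in_r a s ha (lexx _)).
  have z0 : `|0 : R| <= `|s| by rewrite normr0.
  have := hr _ (in_r a 0 ha z0); rewrite scale0r addr0 => -[U2 _].
  have d2 := derivableP (df _ U2); have d1 := is_derive_translate (df _ U1).
  by rewrite -D1E; apply: (is_deriveB d1 d2).
have [a ha ga] : exists2 a, `|a| <= `|s| & g (x + s *: v) - g x = s * 'D_v g (x + a *: v).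
  by apply: derive_segment => a ha; have [] := Dg a ha.
have [_ gE] := Dg a ha.
have [b hb fb] : exists2 b, `|b| <= `|s| &
   D1 (x + a *: v + s *: w) - D1 (x + a *: v) =
     s * D2 (x + a *: v + b *: w).
  rewrite -D2E; apply: derive_segment => b hb.
  by have [U1 _] := hr _ (in_r a b ha hb); exact: dD1 U1.
have -> : f (x + s *: v + s *: w) - f (x + s *: v) - (f (x + s *: w) - f x)
  = g (x + s *: v) - g x by [].
rewrite ga gE fb (mulrA s) mulKf ?mulf_neq0//.
have -> : 'D_w D1 x = D2 x by rewrite -D2E.
by have [] := hr _ (in_r a b ha hb).
Unshelve. all: by end_near. Qed.

Lemma derive_schwarz m (U : set 'rV[R]_m) (f : 'rV[R]_m -> R) x v w :
  open U -> U x -> Ck 2 U f -> 'D_w ('D_v f) x = 'D_v ('D_w f) x.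
Proof.
move=> oU Ux hf; apply/eqP; rewrite -subr_eq0 -normr_le0; apply/ler_addgt0Pl => e e0; rewrite addr0.
have e2 : 0 < e / 2 by rewrite divr_gt0.
have H1 := second_difference v w oU Ux hf e2.
have H2 := second_difference w v oU Ux hf e2.
move: H1 H2; move: ('D_w ('D_v f) x) ('D_v ('D_w f) x) => A B H1 H2.
near (0 : R)^' => s.
have h1 : `|(s * s)^-1 * (f (x + s *: v + s *: w) - f (x + s *: v) - (f (x + s *: w) - f x))
     - A| <= e / 2 by near: s.
have h2 : `|(s * s)^-1 * (f (x + s *: w + s *: v) - f (x + s *: w) - (f (x + s *: v) - f x))
     - B| <= e / 2 by near: s.
rewrite (addrAC x (s *: w)) in h2.
move: h1 h2.
set p := f _; set q := f (_ + s *: v); set r := f (_ + s *: w); set t := f x.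
rewrite (_ : p - r - (q - t) = p - q - (r - t)); last by ring.
set z := _ * _ => h1 h2; rewrite (splitr e) (_ : A - B = (z - B) - (z - A)); last by ring.
by rewrite (le_trans (ler_normB _ _))// lerD.
Unshelve. all: by end_near. Qed.

End CkTheory2.

(** * Minkowski space *)

Section Lorentz.
Context {R : realType} {N : nat}.
Implicit Types (x y z : 'rV[R]_N) (a b v w p q : 'rV[R]_(1 + N)).

Lemma lorentzE v w : lorentz v w =
  - (v 0 0 * w 0 0) + \sum_i v 0 (rshift 1 i) * w 0 (rshift 1 i).
Proof. by rewrite /lorentz /time /dot /space; congr (_ + _); apply: eq_bigr => i _; rewrite !mxE. Qed.

Lemma dotC x y : dot x y = dot y x.
Proof. by apply: eq_bigr => i _; rewrite mulrC. Qed.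

Lemma dotDl x y z : dot (x + y) z = dot x z + dot y z.
Proof. by rewrite -big_split; apply: eq_bigr => i _; rewrite mxE mulrDl. Qed.

Lemma dotZl (k : R) x y : dot (k *: x) y = k * dot x y.
Proof. by rewrite /dot mulr_sumr; apply: eq_bigr => i _; rewrite mxE mulrA. Qed.

Lemma dotDr x y z : dot z (x + y) = dot z x + dot z y.
Proof. by rewrite dotC dotDl !(dotC z). Qed.

Lemma dotZr (k : R) x y : dot y (k *: x) = k * dot y x.
Proof. by rewrite dotC dotZl (dotC y). Qed.

Lemma dot_ge0 x : 0 <= dot x x.
Proof. by apply: sumr_ge0 => i _; rewrite -expr2 sqr_ge0. Qed.

Lemma dot_eq0 x : dot x x = 0 -> x = 0.
Proof.
move=> /eqP; rewrite psumr_eq0; last by move=> i _; rewrite -expr2 sqr_ge0.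
move=> /allP h; apply/rowP => i; rewrite mxE.
by have := h i (mem_index_enum _); rewrite mulf_eq0 orbb => /eqP.
Qed.

Lemma lorentzC v w : lorentz v w = lorentz w v.
Proof. by rewrite /lorentz mulrC dotC. Qed.

Lemma timeD v w : time (v + w) = time v + time w.
Proof. by rewrite /time mxE. Qed.

Lemma timeZ (k : R) v : time (k *: v) = k * time v.
Proof. by rewrite /time mxE. Qed.

Lemma spaceD v w : space (v + w) = space v + space w.
Proof. exact: raddfD. Qed.

Lemma spaceZ (k : R) v : space (k *: v) = k *: space v.
Proof. exact: linearZ. Qed.

Lemma lorentzDl v w a : lorentz (v + w) a = lorentz v a + lorentz w a.
Proof. by rewrite /lorentz timeD spaceD dotDl; ring. Qed.

Lemma lorentzZl (k : R) v w : lorentz (k *: v) w = k * lorentz v w.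
Proof. by rewrite /lorentz timeZ spaceZ dotZl; ring. Qed.

Lemma lorentzDr v w a : lorentz a (v + w) = lorentz a v + lorentz a w.
Proof. by rewrite !(lorentzC a) lorentzDl. Qed.

Lemma lorentzZr (k : R) v w : lorentz w (k *: v) = k * lorentz w v.
Proof. by rewrite !(lorentzC w) lorentzZl. Qed.

Lemma lorentzNl v w : lorentz (- v) w = - lorentz v w.
Proof. by rewrite -scaleN1r lorentzZl mulN1r. Qed.

Lemma lorentzNr v w : lorentz w (- v) = - lorentz w v.
Proof. by rewrite -scaleN1r lorentzZr mulN1r. Qed.

Lemma lorentz0l w : lorentz 0 w = 0.
Proof. by rewrite -(scale0r (0 : 'rV[R]_(1 + N))) lorentzZl mul0r. Qed.

Lemma lorentz_suml n (f : 'I_n -> 'rV[R]_(1 + N)) w :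
  lorentz (\sum_i f i) w = \sum_i lorentz (f i) w.
Proof.
elim: (index_enum _) => [|i r ih]; first by rewrite !big_nil lorentz0l.
by rewrite !big_cons lorentzDl ih.
Qed.

Lemma lorentz_sumr n (f : 'I_n -> 'rV[R]_(1 + N)) w :
  lorentz w (\sum_i f i) = \sum_i lorentz w (f i).
Proof. by rewrite lorentzC lorentz_suml; apply: eq_bigr => i _; rewrite lorentzC. Qed.

Definition lorentz_bilin :=
  (lorentzDl, lorentzDr, lorentzNl, lorentzNr, lorentzZl, lorentzZr).

Lemma vecP v w : time v = time w -> space v = space w -> v = w.
Proof.
move=> tE sE; apply/rowP => i; case: (split_ordP i) => j ->.
  by rewrite (_ : lshift N j = 0)//; apply/val_inj; rewrite /= ord1.
by have := congr1 (fun M : 'rV_N => M 0 j) sE; rewrite !mxE.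
Qed.

Lemma time_vec (k : R) x : time (vec k x) = k.
Proof.
by rewrite /time /vec (_ : 0 = lshift N 0 :> 'I_(1 + N)) ?row_mxEl ?mxE//; apply/val_inj.
Qed.

Lemma space_vec (k : R) x : space (vec k x) = x.
Proof. exact: row_mxKr. Qed.

Lemma lorentz_vec (k l : R) x y : lorentz (vec k x) (vec l y) = - (k * l) + dot x y.
Proof. by rewrite /lorentz !time_vec !space_vec. Qed.

Lemma discriminant_le0 (A B C : R) :
  (forall s t : R, 0 <= s ^+ 2 * A + 2 * s * t * B + t ^+ 2 * C) -> B ^+ 2 <= A * C.
Proof.
move=> h; have C0 : 0 <= C by have := h 0 1; lra.
have [Cp|] := ltP 0 C.
  (* This choice needs C > 0. When C = 0 and B is nonzero, the vector chosen below gives the value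
     -1. *)
  have := h C (- B); rewrite (_ : _ + _ = C * (A * C - B ^+ 2)); last by ring.
  by rewrite pmulr_rge0// subr_ge0.
move=> C1; have {C0 C1} E : C = 0 by apply/eqP; rewrite eq_le C0 C1.
rewrite E in h *.
have [->|B0] := eqVneq B 0; first by rewrite mulr0 expr0n.
have := h 1 (- (A + 1) / (2 * B)).
rewrite (_ : _ + _ = - 1); first lra.
by field.
Qed.

Lemma dot_CS x y : dot x y ^+ 2 <= dot x x * dot y y.
Proof.
apply: discriminant_le0 => s t; have := dot_ge0 (s *: x + t *: y).
rewrite dotDl !dotDr !dotZl !dotZr (dotC y x); congr (_ <= _); ring.
Qed.

(** Quantitative form of the fact that the orthogonal complement of a timelike vector is spacelike:
    Cauchy-Schwarz for the space parts, whose product is time w * time q, with |space q|^2 = (time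
    q)^2 - 1. *)
Lemma space_orthogonal q w : hyperboloid q -> lorentz w q = 0 ->
  dot (space w) (space w) <= time q ^+ 2 * lorentz w w.
Proof.
move=> [q1 q0] wq; have CS := dot_CS (space w) (space q).
move: q1 wq; rewrite /lorentz => q1 wq.
have -> : dot (space w) (space w) =
   time q ^+ 2 * dot (space w) (space w) - dot (space w) (space w) * dot (space q) (space q).
  by rewrite (_ : dot (space q) (space q) = time q ^+ 2 - 1); [ring|lra].
have E : dot (space w) (space q) = time w * time q by lra.
move: CS; rewrite E; nra.
Qed.

Lemma lorentz_orthogonal_ge0 q w : hyperboloid q -> lorentz w q = 0 -> 0 <= lorentz w w.
Proof.
move=> qH wq; have := le_trans (dot_ge0 _) (space_orthogonal qH wq).
by rewrite pmulr_rge0// exprn_gt0; case: qH.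
Qed.

Lemma lorentz_orthogonal_eq0 q w : hyperboloid q -> lorentz w q = 0 ->
  lorentz w w = 0 -> w = 0.
Proof.
move=> qH wq ww; have := space_orthogonal qH wq; rewrite ww mulr0 => sw.
have {}sw : space w = 0 by apply: dot_eq0; apply/eqP; rewrite eq_le sw dot_ge0.
apply: vecP; rewrite ?sw /space ?raddf0// /time mxE -/(time w).
have := ww; rewrite /lorentz sw (_ : dot 0 0 = 0).
  by rewrite addr0 => /eqP; rewrite oppr_eq0 mulf_eq0 orbb => /eqP.
by rewrite /dot big1// => i _; rewrite mxE mul0r.
Qed.

Lemma lorentz_orthogonal_CS p v w : hyperboloid p -> lorentz v p = 0 ->
  lorentz w p = 0 -> lorentz v w ^+ 2 <= lorentz v v * lorentz w w.
Proof.
move=> pH vp wp; apply: discriminant_le0 => s t.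
have : 0 <= lorentz (s *: v + t *: w) (s *: v + t *: w).
  by apply: lorentz_orthogonal_ge0 pH _; rewrite !lorentz_bilin vp wp; ring.
rewrite !lorentz_bilin (lorentzC w v); congr (_ <= _); ring.
Qed.

Lemma null_time a : lorentz a a = 0 -> dot (space a) (space a) = time a ^+ 2.
Proof. by rewrite /lorentz => h; lra. Qed.

(** Null vectors in opposite half cones have a nonnegative product, by Cauchy-Schwarz for their
    space parts. *)
Lemma null_future a b : lorentz a a = 0 -> lorentz b b = 0 -> 0 < time b ->
  lorentz a b < 0 -> 0 < time a.
Proof.
move=> /null_time aa /null_time bb b0 ab; rewrite ltNge; apply/negP => a0.
have := dot_CS (space a) (space b); rewrite aa bb -exprMn.
rewrite -[X in X <= _](real_normK (num_real _)) -[X in _ <= X](real_normK (num_real _)) ler_sqr ?nnegrE//.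
have h0 : time a * time b <= 0 by rewrite mulr_le0_ge0// ltW.
rewrite (ler0_norm h0).
by rewrite ler_norml => /andP[h _]; move: ab; rewrite /lorentz; lra.
Qed.

(* [qform q] is the Euclidean form of the splitting of Minkowski space by the
   observer q; the estimates are uniform because they are made in its norm. *)
Definition qform q v w : R := lorentz v w + 2 * lorentz v q * lorentz w q.
Definition qnorm q v : R := Num.sqrt (qform q v v).

Section Frame.
Variable q : 'rV[R]_(1 + N).
Hypothesis qH : hyperboloid q.

(** The component of [v] along [q] has its sign reversed and the rest is orthogonal to [q], hence
    spacelike; this is why the form is positive definite. *)
Lemma qformE v : qform q v v =
  lorentz v q ^+ 2 + lorentz (v + lorentz v q *: q) (v + lorentz v q *: q).
Proof.
case: qH => q1 _; rewrite /qform !lorentz_bilin q1 (lorentzC q v); ring.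
Qed.

Lemma qform_rest v : lorentz (v + lorentz v q *: q) q = 0.
Proof. by case: qH => q1 _; rewrite !lorentz_bilin q1; ring. Qed.

Lemma qform_ge0 v : 0 <= qform q v v.
Proof.
rewrite qformE addr_ge0 ?sqr_ge0//.
exact: lorentz_orthogonal_ge0 qH (qform_rest v).
Qed.

Lemma qform_eq0 v : qform q v v = 0 -> v = 0.
Proof.
rewrite qformE => h.
have g0 := lorentz_orthogonal_ge0 qH (qform_rest v).
have s0 := sqr_ge0 (lorentz v q).
have l0 : lorentz v q = 0 by apply/eqP; rewrite -sqrf_eq0; apply/eqP; lra.
have r0 := lorentz_orthogonal_eq0 qH (qform_rest v) _.
by move: r0; rewrite l0 scale0r addr0; apply; rewrite l0 scale0r addr0 in h g0; lra.
Qed.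

Lemma qform_CS v w : qform q v w ^+ 2 <= qform q v v * qform q w w.
Proof.
apply: discriminant_le0 => s t; have := qform_ge0 (s *: v + t *: w).
rewrite /qform !lorentz_bilin (lorentzC w v); congr (_ <= _); ring.
Qed.

Lemma qnorm_ge0 v : 0 <= qnorm q v. Proof. exact: sqrtr_ge0. Qed.

Lemma qnorm_sqr v : qnorm q v ^+ 2 = qform q v v.
Proof. by rewrite sqr_sqrtr// qform_ge0. Qed.

Lemma qform_le v w : `|qform q v w| <= qnorm q v * qnorm q w.
Proof.
rewrite -ler_sqr ?nnegrE ?mulr_ge0 ?qnorm_ge0//.
by rewrite (real_normK (num_real _)) exprMn !qnorm_sqr qform_CS.
Qed.

Lemma lorentz_le v w : `|lorentz v w| <= qnorm q v * qnorm q w.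
Proof.
(* [J] is the image of [v] under the reflection that sends [q] to [- q] and fixes its orthogonal
   complement: it turns one form into the other and preserves the norm. *)
pose J := v + 2 * lorentz v q *: q; case: (qH) => q1 _.
have -> : lorentz v w = qform q J w.
  by rewrite /qform /J !lorentz_bilin q1 (lorentzC q w); ring.
have -> : qnorm q v = qnorm q J.
  congr Num.sqrt; rewrite /qform /J !lorentz_bilin q1 (lorentzC q v); ring.
exact: qform_le.
Qed.

Lemma qnormZ k v : qnorm q (k *: v) = `|k| * qnorm q v.
Proof.
rewrite /qnorm (_ : qform q _ _ = k ^+ 2 * qform q v v).
  by rewrite sqrtrM ?sqr_ge0// sqrtr_sqr.
rewrite /qform !lorentz_bilin; ring.
Qed.

Lemma qnormN v : qnorm q (- v) = qnorm q v.
Proof. by rewrite -scaleN1r qnormZ normrN1 mul1r. Qed.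

Lemma qnormD v w : qnorm q (v + w) <= qnorm q v + qnorm q w.
Proof.
rewrite -ler_sqr ?nnegrE ?addr_ge0 ?qnorm_ge0// sqrrD !qnorm_sqr.
have := le_trans (ler_norm _) (qform_le v w).
rewrite (_ : qform q (v + w) _ = qform q v v + 2 * qform q v w + qform q w w); first lra.
rewrite /qform !lorentz_bilin (lorentzC w v); ring.
Qed.

Lemma qnormB v w : qnorm q (v - w) <= qnorm q v + qnorm q w.
Proof. by rewrite -(qnormN w) qnormD. Qed.

Lemma qnorm0 : qnorm q 0 = 0.
Proof. by rewrite -(scale0r (0 : 'rV[R]_(1 + N))) qnormZ normr0 mul0r. Qed.

Lemma qnorm_self : qnorm q q = 1.
Proof.
by case: qH => q1 _; rewrite /qnorm /qform q1 (_ : _ + _ = 1) ?sqrtr1//; ring.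
Qed.

Lemma qnorm_null v : lorentz v v = 0 -> qnorm q v = Num.sqrt 2 * `|lorentz v q|.
Proof.
move=> v0; rewrite /qnorm /qform v0 add0r -mulrA -expr2 sqrtrM//.
by rewrite sqrtr_sqr.
Qed.

Lemma qnorm_orth v : lorentz v q = 0 -> qnorm q v ^+ 2 = lorentz v v.
Proof. by move=> vq; rewrite qnorm_sqr /qform vq; ring. Qed.

(** Change of observer on a vector tangent at [p]. The product of [w] with [q] only sees the
    component [r] of [q] orthogonal to [p], and <r, r> = <p, q>^2 - 1; so the factor is at most 1 +
    2 (<p, q>^2 - 1). *)
Lemma qnorm_tangent p w : hyperboloid p -> lorentz w p = 0 ->
  qnorm q w ^+ 2 <= 2 * lorentz p q ^+ 2 * lorentz w w.
Proof.
move=> pH wp; case: (pH) => p1 _; case: (qH) => q1 _.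
pose r := q + lorentz p q *: p.
have rp : lorentz r p = 0 by rewrite /r !lorentz_bilin p1 (lorentzC q p); ring.
have := lorentz_orthogonal_CS pH wp rp.
have -> : lorentz w r = lorentz w q by rewrite /r !lorentz_bilin wp; ring.
have -> : lorentz r r = lorentz p q ^+ 2 - 1.
  by rewrite /r !lorentz_bilin p1 q1 (lorentzC q p); ring.
have := lorentz_orthogonal_ge0 pH wp.
by rewrite qnorm_sqr /qform; nra.
Qed.

(** Passage from the norm of [q] back to coordinates: it gives the bounds on [time] required by
    [lift_closed] and, later, Euclidean neighbourhoods. *)
Lemma space_le_qnorm v : dot (space v) (space v) + time v ^+ 2 <=
  4 * time q ^+ 2 * qnorm q v ^+ 2.
Proof.
rewrite qnorm_sqr qformE; set l := lorentz v q; set w := v + l *: q.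
have sw : dot (space w) (space w) <= time q ^+ 2 * lorentz w w.
  exact: space_orthogonal (qform_rest v).
have ww : 0 <= lorentz w w by exact: lorentz_orthogonal_ge0 qH (qform_rest v).
have -> : v = w + (- l) *: q by rewrite /w scaleNr addrK.
rewrite timeD spaceD timeZ spaceZ.
have := dot_ge0 (space w + l *: space q).
case: (qH) => q1 _; move: q1 sw ww; rewrite /lorentz.
rewrite !dotDl !dotDr !dotZl !dotZr (dotC (space q) (space w)).
set a := dot _ _; set b := dot _ _; set c := dot _ _.
set T := time w; set t := time q.
move=> q1 sw ww.
have aE : a = t ^+ 2 - 1 by lra.
rewrite aE => h; have := sqr_ge0 (T + l * t); have := sqr_ge0 l; nra.
Qed.

End Frame.

End Lorentz.

Section LorentzCalculus.
Context {R : realType} {N : nat}.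

Lemma is_derive_bigsum (V : normedModType R) n (f : 'I_n -> V -> R) u v (df : 'I_n -> R) :
  (forall i, is_derive u v (f i) (df i)) ->
  is_derive u v (fun y => \sum_i f i y) (\sum_i df i).
Proof.
move=> h; elim: (index_enum _) => [|i r ih].
  rewrite big_nil (_ : (fun _ => _) = cst 0); first exact: is_derive_cst.
  by apply/funext => y; rewrite big_nil.
rewrite big_cons (_ : (fun _ => _) = f i + (fun y => \sum_(j <- r) f j y)).
  exact: is_deriveD.
by apply/funext => y; rewrite big_cons.
Qed.

Lemma is_derive_prod (V : normedModType R) (f g : V -> R) u v (df dg : R) :
  is_derive u v f df -> is_derive u v g dg ->
  is_derive u v (fun y => f y * g y) (df * g u + f u * dg).
Proof.
move=> hf hg; have := is_deriveM hf hg; rewrite /GRing.scale /= => h.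
by apply: is_derive_eq h _; rewrite addrC mulrC.
Qed.

Lemma is_derive_coord (V : normedModType R) n (f : V -> 'rV[R]_n) u v df j :
  is_derive u v f df -> is_derive u v (fun y => f y 0 j) (df 0 j).
Proof.
move=> [h1 h2]; split; first exact: ((derivable_mxP f u v).1 h1 0 j).
by rewrite -h2 derive_mx// mxE.
Qed.

Lemma is_derive_row (V : normedModType R) n (f : V -> 'rV[R]_n) u v (df : 'rV[R]_n) :
  (forall j, is_derive u v (fun y => f y 0 j) (df 0 j)) -> is_derive u v f df.
Proof.
move=> h; have d : derivable f u v.
  apply/derivable_mxP => i j; rewrite (ord1 i).
  by have [hj _] := h j; exact: hj.
split; first exact: d.
rewrite (derive_mx d); apply/rowP => j; rewrite mxE.
by have [_ hj] := h j; rewrite -hj.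
Qed.

Lemma is_derive_lorentz (V : normedModType R) (f g : V -> 'rV[R]_(1 + N)) u v df dg :
  is_derive u v f df -> is_derive u v g dg ->
  is_derive u v (fun y => lorentz (f y) (g y))
    (lorentz df (g u) + lorentz (f u) dg).
Proof.
move=> hf hg.
rewrite (_ : (fun y => _) = - (fun y => f y 0 0 * g y 0 0) +
   (fun y => \sum_i f y 0 (rshift 1 i) * g y 0 (rshift 1 i))); last first.
  by apply/funext => y; rewrite lorentzE.
pose di i := df 0 (rshift 1 i) * g u 0 (rshift 1 i) + f u 0 (rshift 1 i) * dg 0 (rshift 1 i).
have -> : lorentz df (g u) + lorentz (f u) dg =
    - (df 0 0 * g u 0 0 + f u 0 0 * dg 0 0) + \sum_i di i.
  by rewrite !lorentzE big_split /=; ring.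
have D j := is_derive_prod (is_derive_coord j hf) (is_derive_coord j hg).
exact: is_deriveD (is_deriveN (D 0)) (is_derive_bigsum (fun i => D (rshift 1 i))).
Qed.

Lemma continuous_bigsum (T : topologicalType) n (f : 'I_n -> T -> R) u :
  (forall i, {for u, continuous (f i)}) ->
  {for u, continuous (fun y => \sum_i f i y)}.
Proof.
move=> h; elim: (index_enum _) => [|i r ih].
  rewrite (_ : (fun _ => _) = cst 0); first exact: cvg_cst.
  by apply/funext => y; rewrite big_nil.
rewrite (_ : (fun _ => _) = f i \+ (fun y => \sum_(j <- r) f j y)).
  by apply: continuousD; [exact: h|exact: ih].
by apply/funext => y; rewrite big_cons.
Qed.

Lemma dot_continuous (T : topologicalType) n (f g : T -> 'rV[R]_n) u :
  {for u, continuous f} -> {for u, continuous g} ->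
  {for u, continuous (fun y => dot (f y) (g y))}.
Proof.
move=> hf hg; apply: continuous_bigsum => i.
by apply: continuousM; exact: coord_continuous_at.
Qed.

Lemma time_continuous (T : topologicalType) (f : T -> 'rV[R]_(1 + N)) u :
  {for u, continuous f} -> {for u, continuous (fun y => time (f y))}.
Proof. exact: coord_continuous_at. Qed.

Lemma space_continuous (T : topologicalType) (f : T -> 'rV[R]_(1 + N)) u :
  {for u, continuous f} -> {for u, continuous (fun y => space (f y))}.
Proof.
move=> hf; apply: row_continuous => j.
rewrite (_ : (fun y => _) = (fun y => f y 0 (rshift 1 j))).
  exact: coord_continuous_at.
by apply/funext => y; rewrite mxE.
Qed.

Lemma lorentz_continuous (T : topologicalType) (f g : T -> 'rV[R]_(1 + N)) u :
  {for u, continuous f} -> {for u, continuous g} ->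
  {for u, continuous (fun y => lorentz (f y) (g y))}.
Proof.
move=> hf hg; apply: continuousD.
  by apply: continuousN; apply: continuousM; exact: time_continuous.
by apply: dot_continuous; exact: space_continuous.
Qed.

End LorentzCalculus.

(** * Lifting null conics *)

Section Core.
Context {R : realType}.

(** The continuity method on [0, 1]. Both steps may assume [A] at all smaller parameters, because
    the drift of Q is estimated from 0 onwards. *)
Lemma real_induction (A : R -> Prop) : A 0 ->
  (forall s : R, 0 <= s < 1 -> (forall s' : R, 0 <= s' <= s -> A s') ->
     \forall s' \near s, A s') ->
  (forall s : R, 0 < s <= 1 -> (forall s' : R, 0 <= s' < s -> A s') -> A s) ->
  forall s : R, 0 <= s <= 1 -> A s.
Proof.
move=> A0 Aopen Aclosed.
pose S := [set s : R | 0 <= s <= 1 /\ forall s', 0 <= s' <= s -> A s'].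
have S0 : S 0.
  split; first by rewrite lexx ler01.
  by move=> s' /andP[h1 h2]; rewrite (_ : s' = 0)//; apply/eqP; rewrite eq_le h1 h2.
have Sub : ubound S 1 by move=> s [/andP[]].
have hs : has_sup S by split; [exists 0|exists 1].
pose c := sup S.
have c0 : 0 <= c by apply: ub_le_sup => //; exists 1.
have c1 : c <= 1 by apply: ge_sup => //; exists 0.
have Alt s' : 0 <= s' < c -> A s'.
  move=> /andP[h1 h2].
  have [s [_ hs1] hs2] := @sup_adherent _ S (c - s') (ltac:(by rewrite subr_gt0)) hs.
  by apply: hs1; rewrite h1 ltW//; move: hs2; rewrite subKr.
have Ac : A c.
  have [->//|cn0] := eqVneq c 0.
  by apply: Aclosed => //; rewrite c1 lt_def cn0 c0.
have Ale s' : 0 <= s' <= c -> A s'.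
  move=> /andP[h1]; rewrite le_eqVlt => /orP[/eqP->//|h2].
  by apply: Alt; rewrite h1 h2.
suff c1' : c = 1 by move=> s; rewrite -c1'; exact: Ale.
apply/eqP; rewrite eq_le c1 leNgt; apply/negP => clt1.
have /nbhs_ballP [r /= r0 hr] := Aopen c (ltac:(by rewrite c0 clt1)) Ale.
pose s := Num.min (c + r / 2) 1.
have cs : c < s by rewrite lt_min clt1 ltrDl divr_gt0.
have : s <= c.
  apply: ub_le_sup; first by exists 1.
  split; first by rewrite (le_trans c0 (ltW cs)) /s ge_min lexx orbT.
  move=> s' /andP[h1 h2]; have [h3|h3] := leP s' c; first by apply: Ale; rewrite h1 h3.
  apply: hr; rewrite -ball_normE /= ltr0_norm ?subr_lt0// opprB ltrBlDr.
  apply: (le_lt_trans h2); rewrite /s gt_min addrC ltrD2r.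
  by rewrite ltr_pdivrMr// ltr_pMr// ltr1n.
by rewrite leNgt cs.
Qed.

Lemma left_kernel_neq0 m k (A : 'M[R]_(m, k)) : (k < m)%N ->
  exists2 v : 'rV[R]_m, v != 0 & v *m A = 0.
Proof.
move=> km; have : kermx A != 0.
  rewrite kermx_eq0 /row_free; apply/eqP => h.
  by have := rank_leq_col A; rewrite h leqNgt km.
move=> /rowV0Pn [v /sub_kermxP vA v0]; by exists v.
Qed.

Lemma lorentz_orthogonal_exists N k (a : 'I_k -> 'rV[R]_(1 + N)) : (k < 1 + N)%N ->
  exists2 v : 'rV[R]_(1 + N), v != 0 & forall j, lorentz v (a j) = 0.
Proof.
move=> kN.
pose A : 'M[R]_(1 + N, k) := \matrix_(i, j) lorentz (delta_mx 0 i) (a j).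
have [v v0 vA] := left_kernel_neq0 A kN; exists v => // j.
have := congr1 (fun B : 'rV_k => B 0 j) vA; rewrite !mxE => <-.
rewrite {1}(row_sum_delta v) lorentz_suml; apply: eq_bigr => i _.
by rewrite lorentzZl !mxE.
Qed.

Context {n : nat}.
Local Notation V := 'rV[R]_(1 + n.+1).

Definition conic (A W E : V) (s : R) : V := A + s *: W + s ^+ 2 *: E.

Lemma is_derive_conic A W E (s : R) :
  is_derive s 1 (conic A W E) (W + (2 * s) *: E).
Proof.
apply: is_derive_row => j.
rewrite (_ : (fun _ => _) = (fun y : R => A 0 j + y * W 0 j) \+ (fun y => y * y * E 0 j)).
  have h := is_derive_prod (is_derive_id s 1) (is_derive_cst (W 0 j) s 1).
  have h2 := is_derive_prod (is_derive_id s 1) (is_derive_id s 1).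
  have h3 := is_derive_prod h2 (is_derive_cst (E 0 j) s 1).
  apply: is_derive_eq (is_deriveD (is_deriveD (is_derive_cst (A 0 j) s 1) h) h3) _.
  by rewrite !mxE /=; ring.
by apply/funext => y; rewrite !mxE /= expr2.
Qed.

Section Family.
Context {M : choiceType}.
Variables (D : set M) (P Q : M -> V) (C : R).

Definition covered (N : R -> V) (s : R) p (l : R) := [/\ D p, 0 < l & P p = l *: N s].

Definition null_frame := forall p, D p ->
  [/\ lorentz (P p) (P p) = 0, lorentz (Q p) (Q p) = 0,
      lorentz (P p) (Q p) = -2 & 0 < time (P p)].

Definition direction_injective := forall p p' (l : R), D p -> D p' -> 0 < l ->
  P p = l *: P p' -> p = p'.

(** Local inversion of the Gauss map together with |dQ| <= C |dP|, stated without charts so that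
    hypersurfaces and conformal metrics share the argument. The number [l ^+ 2 * lorentz N' N'] is
    the squared speed of P along the lift. *)
Definition lift_open := forall (N : R -> V) (N' : V) (s : R) p l, is_derive s 1 N N' ->
  (forall s : R, lorentz (N s) (N s) = 0) -> covered N s p l ->
  exists (pp : R -> M) (ll : R -> R) Q',
    [/\ \forall s' \near s, covered N s' (pp s') (ll s'),
        is_derive s 1 (Q \o pp) Q', lorentz Q' (P p) = 0 &
        lorentz Q' Q' <= C ^+ 2 * (l ^+ 2 * lorentz N' N')].

(** Both bounds are there because properness uses that P + Q = 2 phi stays bounded, and completeness
    that the conformal factor, the time of P, does. *)
Definition lift_closed := forall A W E (s0 b : R), 0 < s0 <= 1 ->
  (forall s : R, lorentz (conic A W E s) (conic A W E s) = 0) ->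
  (forall s : R, 0 <= s <= 1 -> 0 < time (conic A W E s)) ->
  (forall s : R, 0 <= s < s0 -> exists p l, [/\ covered (conic A W E) s p l,
     time (P p) <= b & time (Q p) <= b]) ->
  exists p l, covered (conic A W E) s0 p l.

Hypotheses (nf : null_frame) (dinj : direction_injective) (lo : lift_open)
  (lc : lift_closed) (C0 : 0 <= C).

Lemma covered_unique N s p l p' l' : covered N s p l -> covered N s p' l' -> p = p'.
Proof.
move=> [Dp l0 Pp] [Dp' l0' Pp']; apply: (@dinj _ _ (l / l')) => //.
  exact: divr_gt0.
by rewrite Pp' scalerA divfK ?gt_eqF.
Qed.

Lemma frame_point p : D p -> hyperboloid (2^-1 *: (P p + Q p)).
Proof.
move=> Dp; have [PP QQ PQ tP] := nf Dp.
have tQ : 0 < time (Q p).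
  by apply: (null_future QQ PP tP); rewrite lorentzC PQ; lra.
split; last by rewrite timeZ timeD mulr_gt0 ?invr_gt0// addr_gt0.
by rewrite !lorentz_bilin PP QQ (lorentzC (Q p)) PQ; field.
Qed.

(* The curve is the null conic that leaves [P p1] with velocity [W]; in the
   model case of a horosphere centred at [Q p1] the field Q is constant along
   it, and here Q moves at speed of order C. *)
Section Reach.
Variables (q0 : V) (p1 : M) (W : V) (w : R).
Hypotheses (q0H : hyperboloid q0) (Dp1 : D p1)
  (WP : lorentz W (P p1) = 0) (WQ : lorentz W (Q p1) = 0)
  (w0 : 0 <= w) (w3 : w <= 3) (WW : lorentz W W = w ^+ 2)
  (nP : qnorm q0 (P p1) <= 2) (nQ : qnorm q0 (Q p1) <= 2)
  (nW : qnorm q0 W <= 3 * w) (Csmall : 100 * (100 * C) <= 1).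

(** The coefficient makes N null: <P, Q> = -2 gives <N, N> = s^2 w^2 - 4 s^2 w^2 / 4. *)
Let N := conic (P p1) W ((w ^+ 2 / 4) *: Q p1).

Let N_null (s : R) : lorentz (N s) (N s) = 0.
Proof.
have [PP QQ PQ tP] := nf Dp1.
rewrite /N /conic !lorentz_bilin PP QQ PQ WW (lorentzC _ W) WP WQ (lorentzC _ W) WQ.
by rewrite (lorentzC _ (P p1)) PQ; field.
Qed.

Let NQ (s : R) : lorentz (N s) (Q p1) = -2.
Proof.
have [PP QQ PQ tP] := nf Dp1.
by rewrite /N /conic !lorentz_bilin QQ PQ WQ; ring.
Qed.

Let N_time (s : R) : 0 < time (N s).
Proof.
have [PP QQ PQ tP] := nf Dp1.
have tQ : 0 < time (Q p1).
  by apply: (null_future QQ PP tP); rewrite lorentzC PQ; lra.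
by apply: (null_future (N_null s) QQ tQ); rewrite NQ; lra.
Qed.

Let dN (s : R) : is_derive s 1 N (W + (2 * s) *: ((w ^+ 2 / 4) *: Q p1)).
Proof. exact: is_derive_conic. Qed.

Let dN_norm (s : R) : lorentz (W + (2 * s) *: ((w ^+ 2 / 4) *: Q p1))
  (W + (2 * s) *: ((w ^+ 2 / 4) *: Q p1)) = w ^+ 2.
Proof.
have [PP QQ PQ tP] := nf Dp1.
by rewrite !lorentz_bilin QQ WW (lorentzC _ W) WQ; ring.
Qed.

(** The three terms contribute at most 2, 9 and 9/2. *)
Let nN (s : R) : 0 <= s <= 1 -> qnorm q0 (N s) <= 16.
Proof.
move=> /andP[s0 s1]; rewrite /N /conic.
apply: (le_trans (qnormD q0H _ _)).
have h1 := qnormD q0H (P p1) (s *: W).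
have h2 : qnorm q0 (s *: W) <= 9.
  rewrite qnormZ// ger0_norm//.
  have nW9 : qnorm q0 W <= 9 by move: nW w3; lra.
  exact: le_trans (ler_piMl (qnorm_ge0 q0 W) s1) nW9.
have h3 : qnorm q0 (s ^+ 2 *: ((w ^+ 2 / 4) *: Q p1)) <= 9 / 4 * 2.
  rewrite !qnormZ// !ger0_norm ?sqr_ge0 ?divr_ge0 ?sqr_ge0//.
  rewrite mulrA; apply: ler_pM => //.
  - by rewrite mulr_ge0 ?divr_ge0 ?sqr_ge0.
  - exact: qnorm_ge0.
  - have s2 : s ^+ 2 <= 1 by nra.
    have w9 : w ^+ 2 / 4 <= 9 / 4 by move: w0 w3; nra.
    apply: (le_trans (ler_piMl _ s2)) => //.
    by rewrite divr_ge0 ?sqr_ge0.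
by move: nP h1 h2 h3; lra.
Qed.

(** The scale cannot grow: <N, Q p> differs from <N, Q p1> = -2 by at most 16 / 16 = 1, and [l]
    times it equals -2. Hence l <= 2, and P has norm at most 2 * 16. *)
Let near_model (s : R) p l : 0 <= s <= 1 -> covered N s p l ->
  qnorm q0 (Q p - Q p1) <= 16^-1 ->
  [/\ l <= 2, qnorm q0 (P p) <= 32 & qnorm q0 (Q p) <= 3].
Proof.
move=> s01 [Dp l0 Pp] hD; have [PP QQ PQ tP] := nf Dp.
have hN := nN s01; have N0 := qnorm_ge0 q0 (N s).
have h1 : `|lorentz (N s) (Q p - Q p1)| <= 1.
  apply: (le_trans (lorentz_le q0H _ _)).
  by have := qnorm_ge0 q0 (Q p - Q p1); move: hN N0 hD; nra.
have l2 : l <= 2.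
  move: PQ; rewrite Pp -[X in lorentz _ X](subrK (Q p1)) lorentzZl lorentzDr NQ.
  move: h1; rewrite ler_norml => /andP[]; set x := lorentz _ _; nra.
split => //.
  by rewrite Pp qnormZ// gtr0_norm//; move: hN N0 l0 l2; nra.
rewrite -[Q p](subrK (Q p1)); apply: (le_trans (qnormD q0H _ _)); move: hD nQ; lra.
Qed.

(** The lift as a function of the parameter. By [covered_unique] the chosen point is the only one;
    [p1] is a default where there is none. *)
Let pf (s : R) := xget p1 [set p | exists l, covered N s p l].

Let pfP (s : R) p l : covered N s p l -> exists l, covered N s (pf s) l.
Proof. by move=> h; rewrite /pf; case: xgetP => [y -> //|/(_ p)[]]; exists l. Qed.

Let pf0 : pf 0 = p1.
Proof.
have [PP QQ PQ tP] := nf Dp1.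
have h : covered N 0 p1 1.
  by split=> //; rewrite /N /conic scale0r expr0n /= scale0r !addr0 scale1r.
by have [l' /covered_unique] := pfP h; apply; exact: h.
Qed.

(** The local lift of [lift_open] agrees with [pf] by uniqueness, so the derivative passes to
    [Q \o pf]; orthogonality to Q comes from differentiating <Q, Q> = 0. *)
Let drift (s : R) p l : covered N s p l -> exists Q',
  [/\ is_derive s 1 (Q \o pf) Q', \forall s' \near s, exists p l, covered N s' p l,
    lorentz Q' (P p) = 0, lorentz Q' (Q p) = 0 &
    lorentz Q' Q' <= C ^+ 2 * (l ^+ 2 * w ^+ 2)].
Proof.
move=> h; have [pp [ll [Q' [h1 h2 h3 h4]]]] := lo (dN s) N_null h.
rewrite dN_norm in h4.
have E : \near s, (Q \o pp) s = (Q \o pf) s.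
  apply: filterS h1 => s' c; rewrite /=; congr Q.
  by have [l' /(covered_unique c)] := pfP c.
have h2' : is_derive s 1 (Q \o pf) Q' by apply: near_eq_is_derive E h2.
exists Q'; split => //; first by apply: filterS h1 => s' c; exists (pp s'), (ll s').
have Ep : pf s = p by have [l' /covered_unique] := pfP h; apply; exact: h.
have Z : \near s, cst 0 s = lorentz ((Q \o pf) s) ((Q \o pf) s).
  apply: filterS h1 => s' c /=.
  have [l' [Dp _ _]] := pfP c; by have [_ -> _ _] := nf Dp.
have := is_derive_lorentz h2' h2'; rewrite /= Ep => -[_ e].
have [_ e0] := near_eq_is_derive Z (is_derive_cst (0 : R) s 1).
by move: e; rewrite e0 (lorentzC (Q p)) => /eqP; rewrite eq_sym -mulr2n mulrn_eq0 => /eqP.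
Qed.

(** The bootstrap hypothesis: 1/16 is what [near_model] needs, and [improve] returns at most 1/60,
    which leaves room to go on. *)
Let good (s : R) := (exists p l, covered N s p l) /\ qnorm q0 (Q (pf s) - Q p1) <= 16^-1.

(** The derivative of Q is tangent at (P + Q)/2, whose product with [q0] is at most (32 + 3)/2. By
    [qnorm_tangent] and l <= 2 its squared norm is at most 2 (35/2)^2 * 4 C^2 w^2 = 2450 C^2 w^2 <=
    (50 C w)^2. *)
Let speed (s : R) : 0 <= s <= 1 -> good s -> exists2 Q',
   is_derive s 1 (Q \o pf) Q' & qnorm q0 Q' <= 50 * C * w.
Proof.
move=> s01 [[p [l c]]] hD; have [l' c'] := pfP c.
have [Q' [h1 _ h3 h4 h5]] := drift c'; exists Q' => //.
have [l2 nPp nQp] := near_model s01 c' hD.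
have [Dp l0 _] := c'.
have QH := frame_point Dp.
have QT : lorentz Q' (2^-1 *: (P (pf s) + Q (pf s))) = 0.
  by rewrite !lorentz_bilin h3 h4; ring.
have := qnorm_tangent q0H QH QT.
have tau : `|lorentz (2^-1 *: (P (pf s) + Q (pf s))) q0| <= 35 / 2.
  apply: (le_trans (lorentz_le q0H _ _)); rewrite qnorm_self// mulr1 qnormZ//.
  rewrite ger0_norm//; have := qnormD q0H (P (pf s)) (Q (pf s)); lra.
have t2 : lorentz (2^-1 *: (P (pf s) + Q (pf s))) q0 ^+ 2 <= (35 / 2) ^+ 2.
  by rewrite -(real_normK (num_real (lorentz _ _))) ler_sqr ?nnegrE//; lra.
move=> h6; rewrite -ler_sqr ?nnegrE ?qnorm_ge0 ?mulr_ge0//.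
have QQ0 := lorentz_orthogonal_ge0 QH QT.
have l4 : C ^+ 2 * (l' ^+ 2 * w ^+ 2) <= C ^+ 2 * (4 * w ^+ 2).
  apply: ler_wpM2l; rewrite ?sqr_ge0//; apply: ler_wpM2r; rewrite ?sqr_ge0//; nra.
apply: (le_trans h6); apply: (@le_trans _ _ (2 * (35 / 2) ^+ 2 * (C ^+ 2 * (4 * w ^+ 2)))).
  apply: ler_pM => //; first by rewrite mulr_ge0// sqr_ge0.
    by rewrite ler_pM2l.
  by lra.
rewrite !exprMn; have := mulr_ge0 (sqr_ge0 C) (sqr_ge0 w); nra.
Qed.

(** A mean value inequality for the vector-valued Q: pairing with the total drift [a] gives a real
    function [f] whose increment is the squared norm of [a], and its derivative is at most 50 C w
    times the norm of [a]. *)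
Let improve (s : R) : 0 <= s <= 1 -> (forall s' : R, 0 <= s' < s -> good s') ->
  (exists p l, covered N s p l) -> qnorm q0 (Q (pf s) - Q p1) <= 50 * C * w * s.
Proof.
move=> /andP[s0 s1] hg [p [l c]].
have [s00|sn0] := eqVneq s 0.
  by rewrite s00 pf0 subrr qnorm0// mulr0.
have {sn0}sp : 0 < s by rewrite lt_def sn0.
pose a := Q (pf s) - Q p1.
pose f s' := qform q0 (Q (pf s')) a.
have df (s' : R) Q' : is_derive s' 1 (Q \o pf) Q' -> is_derive s' 1 f (qform q0 Q' a).
  move=> h; pose a' := a + 2 * lorentz a q0 *: q0.
  have E v : qform q0 v a = lorentz v a'.
    by rewrite /qform /a' !lorentz_bilin; ring.
  rewrite (_ : f = fun s' => lorentz ((Q \o pf) s') (cst a' s')); last first.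
    by apply/funext => y; rewrite /f E.
  apply: is_derive_eq (is_derive_lorentz h (is_derive_cst a' s' 1)) _.
  by rewrite E /= (lorentzC _ 0) lorentz0l addr0.
have cf : {within `[0, s], continuous f}.
  apply: derivable_within_continuous => x; rewrite in_itv /= => /andP[x0].
  rewrite le_eqVlt => /orP[/eqP->|xs].
    by have [Q' [h _ _ _ _]] := drift c; have [] := df _ _ h.
  have [[p' [l' c']] _] : good x by apply: hg; rewrite x0.
  by have [Q' [h _ _ _ _]] := drift c'; have [] := df _ _ h.
have [|z] := @MVT _ f (fun x => 'D_1 f x) 0 s sp _ cf.
  move=> z; rewrite in_itv /= => /andP[z0 zs].
  have [[p' [l' c']] _] : good z by apply: hg; rewrite (ltW z0).
  by have [Q' [h _ _ _ _]] := drift c'; have [h1 h2] := df _ _ h; split.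
rewrite in_itv /= => /andP[z0 zs] fz.
have gz : good z by apply: hg; rewrite (ltW z0).
have [|Q' dQ' nQ'] := speed _ gz; first by rewrite (ltW z0) (le_trans (ltW zs)).
have [_ e] := df _ _ dQ'.
have E : f s - f 0 = qform q0 a a.
  by rewrite /f pf0 /a /qform !lorentz_bilin; ring.
have h1 : qnorm q0 a ^+ 2 <= 50 * C * w * s * qnorm q0 a.
  rewrite qnorm_sqr// -E fz e subr0 mulrAC.
  apply: ler_wpM2r => //; apply: (le_trans (ler_norm _)).
  apply: (le_trans (qform_le q0H _ _)); apply: ler_wpM2r => //; exact: qnorm_ge0.
have [->|a0] := eqVneq (qnorm q0 a) 0; first by rewrite !mulr_ge0.
have ap : 0 < qnorm q0 a by rewrite lt_def a0 qnorm_ge0.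
by rewrite -(ler_pM2r ap) -expr2.
Qed.

Lemma reach : exists p l, covered N 1 p l /\ qnorm q0 (Q p - Q p1) <= 50 * C * w.
Proof.
(* 50 C w <= 150 C <= 150 / 10^4 < 1/60. *)
have Cw : 50 * C * w <= 60^-1.
  by have := mulr_ge0 C0 (_ : 0 <= 3 - w); rewrite subr_ge0 => /(_ w3); move: Csmall; lra.
have Cw0 : 0 <= 50 * C * w by rewrite !mulr_ge0.
have drift_small (s : R) : 0 <= s <= 1 -> 50 * C * w * s <= 60^-1.
  by move=> /andP[s0 s1]; exact: le_trans (ler_piMr Cw0 s1) Cw.
have cov0 : covered N 0 p1 1.
  by split=> //; rewrite /N /conic scale0r expr0n /= scale0r !addr0 scale1r.
have A01 : forall s : R, 0 <= s <= 1 -> good s.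
  apply: real_induction.
  - split; first by exists p1, 1.
    by rewrite pf0 subrr qnorm0// invr_ge0.
  (* Open step: covering persists by [lift_open], and the strict bound below 1/16 persists by
     continuity of Q along the lift. *)
  - move=> s /andP[s0 s1] hs.
    have s01 : 0 <= s <= 1 by rewrite s0 ltW.
    have [cs _] : good s by apply: hs; rewrite s0 lexx.
    have hD : qnorm q0 (Q (pf s) - Q p1) <= 50 * C * w * s.
      by apply: improve => // s' /andP[h1 h2]; apply: hs; rewrite h1 ltW.
    have [p [l c]] := cs; have [Q' [dQ near_cov _ _ _]] := drift c.
    have dc : {for s, continuous (Q \o pf)}.
      by apply/differentiable_continuous/derivable1_diffP; case: dQ.
    have qc : {for s, continuous (fun y => qform q0 (Q (pf y) - Q p1) (Q (pf y) - Q p1))}.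
      have dc2 : {for s, continuous (fun y => Q (pf y) - Q p1)}.
        by apply: continuousB => //; exact: cvg_cst.
      have lq : {for s, continuous (fun y => lorentz (Q (pf y) - Q p1) q0)}.
        by apply: lorentz_continuous => //; exact: cvg_cst.
      apply: continuousD; first exact: lorentz_continuous.
      apply: continuousM => //; apply: continuousM => //; exact: cvg_cst.
    have lt1 : qform q0 (Q (pf s) - Q p1) (Q (pf s) - Q p1) < 16^-1 ^+ 2.
      rewrite -qnorm_sqr// ltr_sqr ?nnegrE ?qnorm_ge0//.
      by have := drift_small _ s01; move: hD; lra.
    have near_lt := cvgr_lt _ qc _ lt1.
    near=> s'; split; first by near: s'; exact: near_cov.
    rewrite -ler_sqr ?nnegrE ?qnorm_ge0// qnorm_sqr//; apply: ltW.
    by near: s'; exact: near_lt.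
  - move=> s /andP[s0 s1] hs.
    have s01 : 0 <= s <= 1 by rewrite ltW.
    (* From [space_le_qnorm]: 32 bounds the norms of both P and Q on the lift. *)
    pose b := Num.sqrt (4 * time q0 ^+ 2 * 32 ^+ 2).
    have tb v : qnorm q0 v <= 32 -> time v <= b.
      move=> hv; apply: (le_trans (ler_norm _)); rewrite /b -sqrtr_sqr ler_sqrt.
        apply: (@le_trans _ _ (4 * time q0 ^+ 2 * qnorm q0 v ^+ 2)).
          by apply: le_trans (space_le_qnorm q0H v); rewrite lerDr dot_ge0.
        apply: ler_wpM2l; first by rewrite mulr_ge0 ?sqr_ge0.
        by rewrite ler_sqr ?nnegrE ?qnorm_ge0.
      by apply: mulr_ge0; [apply: mulr_ge0|]; rewrite ?sqr_ge0.
    have cs : exists p l, covered N s p l.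
      apply: (lc (b := b)) => [|s'|s' h|s' /andP[h1 h2]].
      + by rewrite s0.
      + exact: N_null.
      + exact: N_time.
      + have [[p [l c]] hD] : good s' by apply: hs; rewrite h1.
        have [l' c'] := pfP c; exists (pf s'), l'.
        have s'01 : 0 <= s' <= 1 by rewrite h1 (le_trans (ltW h2)).
        have [_ n1 n2] := near_model s'01 c' hD.
        by split=> //; apply: tb => //; apply: (le_trans n2); lra.
    split=> //; apply: (le_trans (improve s01 hs cs)).
    have := drift_small _ s01; lra.
have s11 : 0 <= (1 : R) <= 1 by rewrite ler01 lexx.
have [cs _] := A01 1 s11; have [p [l c]] := cs.
have [l' c'] := pfP c; exists (pf 1), l'; split => //.
rewrite -[X in _ <= X]mulr1; apply: improve => // s' /andP[h1 h2].
by apply: A01; rewrite h1 ltW.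
Unshelve. all: by end_near. Qed.

End Reach.
End Family.
End Core.

(** * Two close points of a leaf have close values of P *)

Section CoreClose.
Context {R : realType} {n : nat} {M : choiceType}.
Local Notation V := 'rV[R]_(1 + n.+1).

Lemma ler_sqr_norm (x y : R) : `|x| <= y -> x ^+ 2 <= y ^+ 2.
Proof.
move=> xy; rewrite -(real_normK (num_real x)) ler_sqr ?nnegrE//.
exact: le_trans xy.
Qed.

(** A null vector has norm sqrt 2 |<v, q>|, so the assumption bounds the norm c by (3/2)(1 + c/100),
    and c is absorbed. *)
Lemma close_null_norm (q v : V) (d : R) : hyperboloid q -> lorentz v v = 0 ->
  `|lorentz v q| <= 1 + qnorm q v * d -> d <= 100^-1 -> qnorm q v <= 2.
Proof.
move=> qH v0 h d1.
have s2 : Num.sqrt 2 <= 3 / 2 :> R.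
  rewrite -ler_sqr ?nnegrE ?sqrtr_ge0 ?divr_ge0// sqr_sqrtr//; lra.
have e := qnorm_null q v0; have v1 := qnorm_ge0 q v.
have s0 : 0 <= Num.sqrt 2 :> R by exact: sqrtr_ge0.
have l0 := normr_ge0 (lorentz v q).
move: e s2 s0 l0 h; set a := Num.sqrt 2; set b := `|_|; set c := qnorm q v in v1 *.
move=> e s2 s0 l0 h.
have h1 : c * d <= c * 100^-1 by exact: ler_wpM2l.
have h2 : a * b <= 3 / 2 * b by exact: ler_wpM2r.
by clear -e h h1 h2; lra.
Qed.

Lemma null_pair_le0 (a b : V) : lorentz a a = 0 -> lorentz b b = 0 ->
  0 < time a -> 0 < time b -> lorentz a b <= 0.
Proof.
move=> /null_time aa /null_time bb a0 b0.
have := dot_CS (space a) (space b); rewrite aa bb -exprMn => CS.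
have : `|dot (space a) (space b)| <= time a * time b.
  rewrite -ler_sqr ?nnegrE ?mulr_ge0 ?(ltW a0) ?(ltW b0)//.
  by rewrite (real_normK (num_real _)).
by rewrite ler_norml /lorentz => /andP[_]; lra.
Qed.

(** A null vector with these products is Z = a (P + W + (w^2/4) Q), where W is orthogonal to P and
    Q: up to scale, the end at s = 1 of a conic that leaves [P p]. The numbers [a] and [w] are read
    off from <Z, Q> and <Z, P>. *)
Lemma reach_direction (D : set M) (P Q : M -> V) (C : R) q p Z (a w : R) :
  null_frame D P Q -> direction_injective D P -> lift_open D P Q C ->
  lift_closed D P Q -> 0 <= C -> 100 * (100 * C) <= 1 ->
  hyperboloid q -> D p -> lorentz Z Z = 0 -> lorentz Z (Q p) = - (2 * a) ->
  lorentz Z (P p) = - (2 * (a * (w ^+ 2 / 4))) -> 0 < a -> 0 <= w -> w <= 3 ->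
  `|lorentz (2^-1 *: (P p + Q p)) q| <= 2 ->
  qnorm q (P p) <= 2 -> qnorm q (Q p) <= 2 ->
  exists p' l, [/\ D p', 0 < l, P p' = l *: Z &
    qnorm q (Q p' - Q p) <= 50 * C * w].
Proof.
move=> nf dinj lo lc C0 Csmall qH Dp Z0 ZQ ZPp a0 w0 w3 qq nP nQ.
have [PP QQ PQ tP] := nf _ Dp; have pH := frame_point nf Dp.
have QP : lorentz (Q p) (P p) = -2 by rewrite lorentzC.
have an0 : a != 0 by rewrite gt_eqF.
have [W WE] : exists W, W = a^-1 *: Z - P p - (w ^+ 2 / 4) *: Q p by eexists.
have WP : lorentz W (P p) = 0.
  by rewrite WE !lorentz_bilin ZPp PP QP; field.
have WQ : lorentz W (Q p) = 0.
  by rewrite WE !lorentz_bilin ZQ PQ QQ; field.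
have WW : lorentz W W = w ^+ 2.
  rewrite {1}WE !lorentzDl !lorentzNl !lorentzZl (lorentzC (P p)) WP (lorentzC (Q p)) WQ.
  by rewrite WE !lorentzDr !lorentzNr !lorentzZr Z0 ZPp ZQ; field.
have Wq : lorentz W (2^-1 *: (P p + Q p)) = 0.
  by rewrite lorentzZr lorentzDr WP WQ addr0 mulr0.
have nW : qnorm q W <= 3 * w.
  rewrite -ler_sqr ?nnegrE ?qnorm_ge0 ?mulr_ge0//.
  (* The factor is 2 * 2^2 = 8, rounded up to 3^2. *)
  apply: (le_trans (qnorm_tangent qH pH Wq)); rewrite WW exprMn.
  apply: ler_wpM2r; first exact: sqr_ge0.
  by have := ler_sqr_norm qq; clear; lra.
have [p' [l [[Dp' l0 Pp'] h]]] :=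
  reach nf dinj lo lc C0 qH Dp WP WQ w0 w3 WW nP nQ nW Csmall.
exists p', (l / a); split=> //; first exact: divr_gt0.
rewrite Pp' -(scalerA l); congr (_ *: _).
by rewrite /conic expr1n !scale1r WE; apply/rowP => i; rewrite !mxE; ring.
Qed.

(** Meant for v = P or Q at a point with observer [q2], seen from [q1]. The case q2 = q1, d = 0
    covers the frame of [q1] itself. *)
Lemma near_frame (q1 q2 v : V) (d : R) : hyperboloid q1 ->
  lorentz v v = 0 -> lorentz v q2 = -1 -> qnorm q1 (q2 - q1) <= d ->
  0 <= d -> d <= 100^-1 ->
  qnorm q1 v <= 2 /\ `|lorentz v q1 + 1| <= 2 * d.
Proof.
move=> q1H v0 vq2 hd d0 d1.
have pair (e : R) : qnorm q1 v <= e -> `|lorentz v (q2 - q1)| <= e * d.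
  move=> he; apply: (le_trans (lorentz_le q1H _ _)).
  by apply: ler_pM => //; exact: qnorm_ge0.
have vq1 : lorentz v q1 + 1 = - lorentz v (q2 - q1).
  by rewrite lorentzDr lorentzNr vq2; ring.
have nv : qnorm q1 v <= 2.
  apply: (@close_null_norm _ _ d) => //.
  rewrite (_ : lorentz v q1 = - 1 - lorentz v (q2 - q1)); last first.
    by rewrite -vq1; ring.
  apply: (le_trans (ler_normB _ _)); rewrite normrN1 lerD2l.
  by apply: pair.
by split=> //; rewrite vq1 normrN; exact: pair.
Qed.

(** The ratio plays the part of w^2/4 in [reach_direction], and 9/4 is the condition w <= 3. *)
Lemma ratio_bounds (x y d : R) : `|x + 1| <= 2 * d -> `|y + 1| <= 2 * d ->
  d <= 100^-1 ->
  [/\ 0 < - x / 2, 0 <= (- y / 2) / (- x / 2) & (- y / 2) / (- x / 2) <= 9 / 4].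
Proof.
rewrite !ler_norml => /andP[h1 h2] /andP[h3 h4] h5.
have x0 : 0 < - x / 2 by lra.
have y0 : 0 <= - y / 2 by lra.
split=> //; first by rewrite divr_ge0// ltW.
by rewrite ler_pdivrMr//; lra.
Qed.

(** Closeness of the leaf points does not yet say that P and Q are close separately. Q is compared
    through a third point [p], reached from [p1] with w = 2 and from [p2] with w <= 3; the drift is
    at most 50 C (2 + 3) <= 250 / 10^4 = 1/40. *)
Lemma frame_drift (D : set M) (P Q : M -> V) (C : R) q1 q2 p1 p2 (d : R) :
  (3 <= n)%N ->
  null_frame D P Q -> direction_injective D P -> lift_open D P Q C ->
  lift_closed D P Q -> 0 <= C -> 100 * (100 * C) <= 1 ->
  D p1 -> D p2 ->
  q1 = 2^-1 *: (P p1 + Q p1) -> q2 = 2^-1 *: (P p2 + Q p2) ->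
  qnorm q1 (q2 - q1) <= d -> d <= 100^-1 ->
  qnorm q1 (Q p2 - Q p1) <= 40^-1.
Proof.
move=> hn nf dinj lo lc C0 Csmall Dp1 Dp2 q1def q2def hd d1.
have [PP1 QQ1 PQ1 tP1] := nf _ Dp1; have [PP2 QQ2 PQ2 tP2] := nf _ Dp2.
have QP1 : lorentz (Q p1) (P p1) = -2 by rewrite lorentzC.
have QP2 : lorentz (Q p2) (P p2) = -2 by rewrite lorentzC.
have q1H : hyperboloid q1 by rewrite q1def; exact: (frame_point nf Dp1).
have q1q1 : lorentz q1 q1 = -1 by case: q1H.
have d0 : 0 <= d by apply: le_trans hd; exact: qnorm_ge0.
have P1q1 : lorentz (P p1) q1 = -1.
  by rewrite q1def lorentzZr lorentzDr PP1 PQ1; field.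
have Q1q1 : lorentz (Q p1) q1 = -1.
  by rewrite q1def lorentzZr lorentzDr QQ1 QP1; field.
have P2q2 : lorentz (P p2) q2 = -1.
  by rewrite q2def lorentzZr lorentzDr PP2 PQ2; field.
have Q2q2 : lorentz (Q p2) q2 = -1.
  by rewrite q2def lorentzZr lorentzDr QQ2 QP2; field.
have n0 v : qnorm q1 (v - v) <= 0 by rewrite subrr qnorm0.
have c1 : (0 : R) <= 100^-1 by rewrite invr_ge0.
have [nP1 _] := near_frame q1H PP1 P1q1 (n0 _) (lexx _) c1.
have [nQ1 _] := near_frame q1H QQ1 Q1q1 (n0 _) (lexx _) c1.
have [nP2 P2q1] := near_frame q1H PP2 P2q2 hd d0 d1.
have [nQ2 Q2q1] := near_frame q1H QQ2 Q2q2 hd d0 d1.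
(* a direction orthogonal to both frames is reachable from both points *)
pose fr (j : 'I_4) := nth 0 [:: P p1; Q p1; P p2; Q p2] j.
have [z z0 hz] : exists2 v : V, v != 0 & forall j, lorentz v (fr j) = 0.
  by apply: lorentz_orthogonal_exists; rewrite add1n !ltnS.
have zP1 : lorentz z (P p1) = 0 := hz 0.
have zQ1 : lorentz z (Q p1) = 0 := hz 1.
have zP2 : lorentz z (P p2) = 0 := hz 2.
have zQ2 : lorentz z (Q p2) = 0 := hz 3.
have zq1 : lorentz z q1 = 0.
  by rewrite q1def lorentzZr lorentzDr zP1 zQ1 addr0 mulr0.
have zz : 0 < lorentz z z.
  rewrite lt_def (lorentz_orthogonal_ge0 q1H zq1) andbT.
  by apply: contra z0 => /eqP h; apply/eqP; exact: lorentz_orthogonal_eq0 q1H zq1 h.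
have [s s0 ss] : exists2 s : R, 0 < s & lorentz z z = s ^+ 2.
  by exists (Num.sqrt (lorentz z z)); rewrite ?sqrtr_gt0// sqr_sqrtr// ltW.
(* A unit timelike vector plus an orthogonal unit spacelike one is null. As [z] is orthogonal to
   both frames, the products of [Z] with them are those of [q1]. *)
have [Z ZE] : exists Z, Z = q1 + s^-1 *: z by eexists.
have ZZ : lorentz Z Z = 0.
  rewrite ZE lorentzDl !lorentzDr !lorentzZl !lorentzZr q1q1 (lorentzC q1 z) zq1 ss.
  by field; rewrite gt_eqF.
have ZP v : lorentz z v = 0 -> lorentz Z v = lorentz v q1.
  by move=> zv; rewrite ZE lorentzDl lorentzZl zv mulr0 addr0 lorentzC.
have dq1 : `|lorentz q2 q1| <= 2.
  have h := lorentz_le q1H (q2 - q1) q1; rewrite qnorm_self// mulr1 in h.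
  rewrite -[q2](subrK q1) lorentzDl q1q1 addrC.
  apply: (le_trans (ler_normD _ _)); rewrite normrN1.
  by move: h hd d1; clear; lra.
have [p [l [Dp l0 Pp near1]]] : exists p l, [/\ D p, 0 < l, P p = l *: Z &
      qnorm q1 (Q p - Q p1) <= 50 * C * 2].
  (* <Z, Q p1> = <Z, P p1> = -1 forces a = 1/2 and w = 2. *)
  apply: (reach_direction (a := 2^-1) nf dinj lo lc C0 Csmall q1H Dp1 ZZ) => //.
  - by rewrite ZP// Q1q1; field.
  - by rewrite ZP// P1q1; field.
  - by rewrite ler_nat.
  - by rewrite -q1def q1q1 normrN1 ler1n.
have [a20 ab0 ab] := ratio_bounds Q2q1 P2q1 d1.
have [a2 a2E] : exists a2, a2 = - lorentz (Q p2) q1 / 2 by eexists.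
have [b2 b2E] : exists b2, b2 = - lorentz (P p2) q1 / 2 by eexists.
rewrite -a2E -b2E in a20 ab0 ab.
have [w2 w2E] : exists w2, w2 = 2 * Num.sqrt (b2 / a2) by eexists.
have w2s : w2 ^+ 2 / 4 = b2 / a2.
  by rewrite w2E exprMn sqr_sqrtr//; field; rewrite gt_eqF.
have w20 : 0 <= w2 by rewrite w2E mulr_ge0// sqrtr_ge0.
have w23 : w2 <= 3.
  by rewrite -ler_sqr ?nnegrE//; move: w2s ab; clear; lra.
have [p' [l' [Dp' l'0 Pp' near2']]] : exists p' l', [/\ D p', 0 < l', P p' = l' *: Z &
      qnorm q1 (Q p' - Q p2) <= 50 * C * w2].
  apply: (reach_direction (a := a2) nf dinj lo lc C0 Csmall q1H Dp2 ZZ) => //.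
  - by rewrite ZP// a2E; field.
  - by rewrite ZP// w2s b2E; field; rewrite gt_eqF.
  - by rewrite -q2def.
(* Both lifts end over the ray of [Z], which determines the point by injectivity of the Gauss
   map. *)
have pp' : p = p'.
  apply: (dinj _ _ (l / l')) => //; first exact: divr_gt0.
  by rewrite Pp Pp' scalerA divfK ?gt_eqF.
rewrite -pp' in near2'.
have -> : Q p2 - Q p1 = (Q p - Q p1) - (Q p - Q p2).
  by apply/rowP => i; rewrite !mxE; ring.
apply: (le_trans (qnormB q1H _ _)).
have : 50 * C * w2 <= 50 * C * 3 by apply: ler_wpM2l => //; rewrite mulr_ge0.
by move: near1 near2' Csmall; clear; lra.
Qed.

(** Here a w is the norm of the tangential part of P(p2) - P(p1), and x + y bounds the whole
    difference. As 50 C <= 1/200, the inequality a w <= 2 d + w/200 absorbs the last term and gives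
    w <= 3 d. *)
Lemma final_bound (a w d C x y : R) : 0 <= C -> 100 * (100 * C) <= 1 -> 0 <= d ->
  95 / 100 <= a -> 0 <= w -> x <= 2 * d -> y <= 50 * C * w ->
  (a * w) ^+ 2 <= (x + y) * (a * w) -> x + y <= 10 * d.
Proof.
move=> C0 Cs d0 a1 w0 hx hy h.
have Cw : 100 * (100 * C) * w <= 1 * w by exact: ler_wpM2r.
suff : w <= 3 * d by move: Cw hx hy d0; clear; lra.
have [->|wn0] := eqVneq w 0; first by rewrite mulr_ge0.
have wp : 0 < w by rewrite lt_def wn0.
have ap : 0 < a by lra.
have h1 : a * w <= x + y.
  by rewrite -(ler_pM2r (mulr_gt0 ap wp)) -expr2.
have h2 : 95 / 100 * w <= a * w by exact: ler_wpM2r.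
by move: h1 h2 Cw hx hy d0; clear; lra.
Qed.

(** By [frame_drift] the two values of P are now known to be close, so the conic from [P p1] to the
    ray of [P p2] is short. Its lift ends at [p2], so the difference of Q is at most 50 C w, while w
    is in turn bounded by the difference of P; for small C this closes up. *)
Lemma core_close (D : set M) (P Q : M -> V) (C : R) q1 q2 p1 p2 (d : R) :
  (3 <= n)%N ->
  null_frame D P Q -> direction_injective D P -> lift_open D P Q C ->
  lift_closed D P Q -> 0 <= C -> 100 * (100 * C) <= 1 ->
  D p1 -> D p2 ->
  q1 = 2^-1 *: (P p1 + Q p1) -> q2 = 2^-1 *: (P p2 + Q p2) ->
  qnorm q1 (q2 - q1) <= d -> d <= 100^-1 ->
  qnorm q1 (P p2 - P p1) <= 10 * d.
Proof.
move=> hn nf dinj lo lc C0 Csmall Dp1 Dp2 q1def q2def hd d1.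
have nDQ := frame_drift hn nf dinj lo lc C0 Csmall Dp1 Dp2 q1def q2def hd d1.
have [PP1 QQ1 PQ1 tP1] := nf _ Dp1; have [PP2 QQ2 PQ2 tP2] := nf _ Dp2.
have QP1 : lorentz (Q p1) (P p1) = -2 by rewrite lorentzC.
have q1H : hyperboloid q1 by rewrite q1def; exact: (frame_point nf Dp1).
have q1q1 : lorentz q1 q1 = -1 by case: q1H.
have d0 : 0 <= d by apply: le_trans hd; exact: qnorm_ge0.
have P1q1 : lorentz (P p1) q1 = -1.
  by rewrite q1def lorentzZr lorentzDr PP1 PQ1; field.
have Q1q1 : lorentz (Q p1) q1 = -1.
  by rewrite q1def lorentzZr lorentzDr QQ1 QP1; field.
have n0 v : qnorm q1 (v - v) <= 0 by rewrite subrr qnorm0.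
have c1 : (0 : R) <= 100^-1 by rewrite invr_ge0.
have [nP1 _] := near_frame q1H PP1 P1q1 (n0 _) (lexx _) c1.
have [nQ1 _] := near_frame q1H QQ1 Q1q1 (n0 _) (lexx _) c1.
have [dq dqE] : exists dq, dq = q2 - q1 by eexists.
rewrite -dqE in hd.
have DP : P p2 - P p1 = 2 *: dq - (Q p2 - Q p1).
  rewrite dqE q1def q2def scalerBr !scalerA divff ?pnatr_eq0// !scale1r.
  by apply/rowP => i; rewrite !mxE; ring.
have n2dq : qnorm q1 (2 *: dq) <= 2 * d by rewrite qnormZ// ger0_norm// ler_pM2l.
(* 2/100 + 1/40 = 0.045. *)
have nDP : qnorm q1 (P p2 - P p1) <= 20^-1.
  rewrite DP; apply: (le_trans (qnormB q1H _ _)); move: n2dq nDQ d1; clear; lra.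
have small v : qnorm q1 v <= 2 -> `|lorentz (P p2 - P p1) v| <= 10^-1.
  move=> nv; apply: (le_trans (lorentz_le q1H _ _)).
  have : qnorm q1 (P p2 - P p1) * qnorm q1 v <= 20^-1 * 2.
    by apply: ler_pM => //; exact: qnorm_ge0.
  by clear; lra.
have [a aE] : exists a, a = - lorentz (P p2) (Q p1) / 2 by eexists.
have [b bE] : exists b, b = - lorentz (P p2) (P p1) / 2 by eexists.
have al : 95 / 100 <= a.
  have := small _ nQ1; rewrite lorentzDl lorentzNl PQ1 ler_norml aE => /andP[h1 h2].
  by move: h1 h2; clear; lra.
have bu : b <= 5 / 100.
  have := small _ nP1; rewrite lorentzDl lorentzNl PP1 ler_norml bE => /andP[h1 h2].
  by move: h1 h2; clear; lra.
have b0 : 0 <= b.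
  by have := null_pair_le0 PP2 PP1 tP2 tP1; rewrite bE; clear; lra.
have a0 : 0 < a by move: al; clear; lra.
have ba0 : 0 <= b / a by rewrite divr_ge0// ltW.
have [w wE] : exists w, w = 2 * Num.sqrt (b / a) by eexists.
have ws : w ^+ 2 / 4 = b / a.
  by rewrite wE exprMn sqr_sqrtr//; field; rewrite gt_eqF.
have w0 : 0 <= w by rewrite wE mulr_ge0// sqrtr_ge0.
have w3 : w <= 3.
  have : b / a <= 1 by rewrite ler_pdivrMr//; move: al bu; clear; lra.
  by rewrite -ler_sqr ?nnegrE//; move: ws; clear; lra.
have [p3 [l3 [Dp3 l30 Pp3 near3]]] : exists p' l', [/\ D p', 0 < l', P p' = l' *: P p2 &
      qnorm q1 (Q p' - Q p1) <= 50 * C * w].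
  apply: (reach_direction (a := a) nf dinj lo lc C0 Csmall q1H Dp1 PP2) => //.
  - by rewrite aE; field.
  - by rewrite ws bE; field; rewrite gt_eqF.
  - by rewrite -q1def q1q1 normrN1 ler1n.
have p32 : p3 = p2 by exact: dinj Dp3 Dp2 l30 Pp3.
rewrite p32 in near3.
have [W WE] : exists W, W = P p2 - a *: P p1 - b *: Q p1 by eexists.
have P2P1 : lorentz (P p2) (P p1) = - 2 * b by rewrite bE; field.
have P2Q1 : lorentz (P p2) (Q p1) = - 2 * a by rewrite aE; field.
have WP : lorentz W (P p1) = 0.
  by rewrite WE !lorentzDl !lorentzNl !lorentzZl P2P1 PP1 QP1; ring.
have WQ : lorentz W (Q p1) = 0.
  by rewrite WE !lorentzDl !lorentzNl !lorentzZl P2Q1 PQ1 QQ1; ring.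
have Wq : lorentz W q1 = 0 by rewrite q1def lorentzZr lorentzDr WP WQ addr0 mulr0.
have WW' : lorentz W W = lorentz (P p2) W.
  rewrite {1}WE !lorentzDl !lorentzNl !lorentzZl (lorentzC (P p1)) WP (lorentzC (Q p1)) WQ.
  by ring.
have WW : lorentz W W = (a * w) ^+ 2.
  have -> : (a * w) ^+ 2 = 4 * a * b.
    by rewrite exprMn -[w ^+ 2](@divfK _ 4)// ws; field; rewrite gt_eqF.
  by rewrite WW' WE !lorentzDr !lorentzNr !lorentzZr PP2 P2P1 P2Q1; ring.
have nW : qnorm q1 W = a * w.
  by apply/eqP; rewrite -(@eqrXn2 _ 2) ?qnorm_ge0 ?mulr_ge0 ?(ltW a0)// qnorm_orth// WW.
(* [W] is the part of [P p2] orthogonal to the frame at [p1]; pairing it with the difference bounds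
   its own norm by that of the difference. *)
have PW : (a * w) ^+ 2 = lorentz (P p2 - P p1) W.
  by rewrite -WW WW' lorentzDl lorentzNl (lorentzC (P p1)) WP oppr0 addr0.
rewrite DP; apply: (le_trans (qnormB q1H _ _)).
apply: (final_bound C0 Csmall d0 al w0 n2dq near3).
rewrite PW DP; apply: (le_trans (ler_norm _)); apply: (le_trans (lorentz_le q1H _ _)).
rewrite nW; apply: ler_wpM2r; first by rewrite mulr_ge0// (ltW a0).
exact: qnormB.
Qed.

End CoreClose.

(** * The leaves of the normal flow as rescaled null frames *)

Section Leaf.
Context {R : realType} {n : nat}.
Local Notation V := 'rV[R]_(1 + n.+1).

Definition direction (v : V) : 'rV[R]_n.+1 := (time v)^-1 *: space v.

Lemma direction_scale (k : R) v : k != 0 -> direction (k *: v) = direction v.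
Proof.
move=> k0; rewrite /direction timeZ spaceZ scalerA; congr (_ *: _).
by rewrite invfM mulrAC mulVf// mul1r.
Qed.

Lemma direction_vec v : time v != 0 -> v = time v *: vec 1 (direction v).
Proof.
move=> v0; apply: vecP; first by rewrite timeZ time_vec mulr1.
by rewrite spaceZ space_vec scalerA divff// scale1r.
Qed.

Lemma direction_continuous (T : topologicalType) (f : T -> V) u :
  time (f u) != 0 -> {for u, continuous f} ->
  {for u, continuous (fun y => direction (f y))}.
Proof.
move=> f0 fc; apply: row_continuous => j.
rewrite (_ : (fun y => _) = (fun y => (time (f y))^-1 * space (f y) 0 j)); last first.
  by apply/funext => y; rewrite mxE.
apply: continuousM; last exact/coord_continuous_at/space_continuous.
by apply: continuousV => //; exact: time_continuous.
Qed.

Variables (M : topologicalType) (D : set M) (P Q : M -> V) (C : R).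

Definition leaf (t : R) p := 2^-1 *: (expR t *: P p + expR (- t) *: Q p).

(** Continuity of the inverse of the Gauss map. The core estimate controls P from the leaf, and this
    passes from P back to the point. *)
Definition direction_near := forall x B, D x -> nbhs x B ->
  exists2 S, nbhs (direction (P x)) S &
    forall y, D y -> S (direction (P y)) -> B y.

Hypotheses (nf : null_frame D P Q) (dinj : direction_injective D P)
  (lo : lift_open D P Q C) (lc : lift_closed D P Q) (C0 : 0 <= C)
  (dn : direction_near).

Section Time.
Variable t : R.
Let Pt p := expR t *: P p.
Let Qt p := expR (- t) *: Q p.

Lemma scaled_frame : null_frame D Pt Qt.
Proof.
move=> p Dp; have [PP QQ PQ tP] := nf Dp; split.
- by rewrite !lorentz_bilin PP !mulr0.
- by rewrite !lorentz_bilin QQ !mulr0.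
- by rewrite !lorentz_bilin PQ mulrA -expRD subrr expR0 mul1r.
- by rewrite timeZ mulr_gt0// expR_gt0.
Qed.

Lemma scaled_injective : direction_injective D Pt.
Proof.
move=> p p' l Dp Dp' l0 /(congr1 (fun v => (expR t)^-1 *: v)).
rewrite !scalerA mulVf ?gt_eqF ?expR_gt0// scale1r => h.
apply: (dinj Dp Dp' l0); rewrite h; congr (_ *: _).
by rewrite mulrAC mulVf ?mul1r// gt_eqF// expR_gt0.
Qed.

Lemma scaled_covered (N : R -> V) s p l :
  covered D Pt N s p l <-> covered D P N s p (expR (- t) * l).
Proof.
split=> [] [Dp l0 h]; split=> //.
- by rewrite mulr_gt0// expR_gt0.
- by rewrite -scalerA -h scalerA -expRD addNr expR0 scale1r.
- by rewrite -(pmulr_rgt0 _ (expR_gt0 (- t))).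
- by rewrite /Pt h scalerA mulrA -expRD subrr expR0 mul1r.
Qed.

Lemma scaled_open : lift_open D Pt Qt (C * expR (- t) ^+ 2).
Proof.
move=> N N' s p l dN nN /scaled_covered h.
have [pp [ll [Q' [h1 h2 h3 h4]]]] := lo dN nN h.
exists pp, (fun s' => expR t * ll s'), (expR (- t) *: Q'); split.
- apply: filterS h1 => s' h1; apply/scaled_covered.
  by rewrite mulrA -expRD addNr expR0 mul1r.
- exact: is_deriveZ.
- by rewrite /Pt !lorentz_bilin h3 !mulr0.
- rewrite !lorentz_bilin.
  have e0 := sqr_ge0 (expR (- t)).
  have := ler_wpM2l e0 h4; congr (_ <= _); ring.
Qed.

Lemma scaled_closed : lift_closed D Pt Qt.
Proof.
move=> A W E s0 b s01 nN tN h.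
(* Undoing the scaling, the times of P and Q are at most [expR (- t) * b] and [expR t * b]; the sum
   serves for both. *)
have [|p [l c]] := lc (b := expR (- t) * b + expR t * b) s01 nN tN; last first.
  exists p, (expR t * l); apply/scaled_covered.
  by rewrite mulrA -expRD addNr expR0 mul1r.
move=> s hs; have [p [l [c hP hQ]]] := h s hs.
have [Dp _ _] := c; have [PP QQ PQ tP] := nf Dp.
have tQ : 0 < time (Q p).
  by apply: (null_future QQ PP tP); rewrite lorentzC PQ; lra.
have e1 := expR_gt0 t; have e2 := expR_gt0 (- t).
have E1 : expR (- t) * expR t = 1 by rewrite -expRD addNr expR0.
have b0 : 0 <= b.
  by apply: le_trans hP; rewrite timeZ mulr_ge0// ltW.
exists p, (expR (- t) * l); split; first exact/scaled_covered.
- apply: (@le_trans _ _ (expR (- t) * b)).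
    move: hP; rewrite timeZ => /(ler_wpM2l (ltW e2)).
    by rewrite mulrA E1 mul1r.
  by rewrite lerDl mulr_ge0// ltW.
- apply: (@le_trans _ _ (expR t * b)).
    move: hQ; rewrite timeZ => /(ler_wpM2l (ltW e1)).
    by rewrite mulrA (mulrC (expR t)) E1 mul1r.
  by rewrite lerDr mulr_ge0// ltW.
Qed.

Hypotheses (hn : (3 <= n)%N) (tlarge : 100 * (100 * (C * expR (- t) ^+ 2)) <= 1).

Lemma leaf_hyperboloid p : D p -> hyperboloid (leaf t p).
Proof. exact: (frame_point scaled_frame). Qed.

Lemma leaf_close p1 p2 (d : R) : D p1 -> D p2 -> d <= 100^-1 ->
  qnorm (leaf t p1) (leaf t p2 - leaf t p1) <= d ->
  qnorm (leaf t p1) (Pt p2 - Pt p1) <= 10 * d.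
Proof.
move=> Dp1 Dp2 d1 hd.
have Ct : 0 <= C * expR (- t) ^+ 2 by rewrite mulr_ge0// sqr_ge0.
exact: (core_close hn scaled_frame scaled_injective scaled_open scaled_closed Ct
  tlarge Dp1 Dp2 (erefl _) (erefl _) hd d1).
Qed.

Lemma leaf_injective : {in D &, injective (leaf t)}.
Proof.
move=> p1 p2; rewrite !inE => Dp1 Dp2 E.
have H := leaf_hyperboloid Dp1.
have := @leaf_close p1 p2 0 Dp1 Dp2 _ _.
rewrite E subrr qnorm0 -?E// mulr0 invr_ge0 => /(_ _ (lexx _)) => h.
have {}h : qnorm (leaf t p1) (Pt p2 - Pt p1) <= 0 by apply: h; rewrite ler0n.
have z : Pt p2 - Pt p1 = 0.
  apply: (qform_eq0 H); rewrite -qnorm_sqr//.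
  by rewrite (_ : qnorm _ _ = 0) ?expr0n//; apply/eqP; rewrite eq_le h qnorm_ge0.
apply: (scaled_injective Dp1 Dp2 (ltr01)); rewrite scale1r.
by apply/esym/eqP; rewrite -subr_eq0 z.
Qed.

Lemma norm_le_qnorm (q v : V) : hyperboloid q -> `|v| <= 2 * time q * qnorm q v.
Proof.
move=> qH; have q0 : 0 <= time q by case: qH => _ /ltW.
apply: norm_rowP => [|i]; first by rewrite !mulr_ge0 ?qnorm_ge0.
rewrite -ler_sqr ?nnegrE ?mulr_ge0 ?qnorm_ge0// (real_normK (num_real _)).
rewrite !exprMn (_ : 2 ^+ 2 = 4 :> R); last by ring.
apply: le_trans (space_le_qnorm qH v); case: (split_ordP i) => j ->.
  rewrite (_ : lshift _ j = 0); last by apply/val_inj; rewrite /= ord1.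
  by rewrite lerDr dot_ge0.
rewrite ler_wpDr ?sqr_ge0// /dot (bigD1 j)//= /space !mxE -expr2.
by rewrite lerDl sumr_ge0// => k _; rewrite -expr2 sqr_ge0.
Qed.

Lemma leaf_near x B : D x -> nbhs x B ->
  exists2 S, nbhs (leaf t x) S & forall y, D y -> S (leaf t y) -> B y.
Proof.
move=> Dx xB; have H := leaf_hyperboloid Dx.
have [S xS hS] := dn Dx xB.
have [_ _ _ tP] := scaled_frame Dx.
have et0 : expR t != 0 by rewrite gt_eqF// expR_gt0.
have cstc (T : topologicalType) (c : T) (u : V) : {for u, continuous (fun=> c)}.
  exact: cst_continuous.
have idc (u : V) : {for u, continuous (fun v : V => v)} by move=> A.
have dc : {for Pt x, continuous (fun v : V => direction v)}.
  exact: (@direction_continuous _ (fun v : V => v) _ (lt0r_neq0 tP) (idc _)).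
have /nbhs_ballP [r /= r0 hr] : nbhs (Pt x) [set v : V | S (direction v)].
  by apply: dc; rewrite direction_scale.
(* The factor of [norm_le_qnorm] times the 10 of [leaf_close]; [d] below makes K d at most r/2 and
   is also at most 1/100. *)
pose q := leaf t x; pose K := 2 * time q * 10.
have tq : 0 < time q by case: H.
have K0 : 0 < K by rewrite !mulr_gt0.
pose d := Num.min 100^-1 (r / (2 * K)).
have d0 : 0 < d by rewrite lt_min invr_gt0 ltr0n/= divr_gt0// mulr_gt0.
have qc : {for q, continuous (fun v : V => qform q (v - q) (v - q))}.
  have dc2 : {for q, continuous (fun v : V => v - q)}.
    by apply: continuousB; [exact: idc|exact: cstc].
  have lq : {for q, continuous (fun v : V => lorentz (v - q) q)}.
    by apply: lorentz_continuous; [exact: dc2|exact: cstc].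
  apply: continuousD; first exact: (lorentz_continuous dc2 dc2).
  exact: (continuousM (continuousM (cstc _ (2 : R) _) lq) lq).
have lt1 : qform q (q - q) (q - q) < d ^+ 2.
  by rewrite -qnorm_sqr// subrr qnorm0// expr0n/= exprn_gt0.
exists [set v : V | qform q (v - q) (v - q) < d ^+ 2]; first exact: (cvgr_lt _ qc _ lt1).
move=> y Dy /=; rewrite -qnorm_sqr// ltr_sqr ?nnegrE ?qnorm_ge0 ?(ltW d0)// => /ltW hd.
apply: hS => //; have d1 : d <= 100^-1 by rewrite ge_min lexx.
have h := leaf_close Dx Dy d1 hd.
have : ball (Pt x) r (Pt y).
  rewrite -ball_normE /= distrC; apply: (le_lt_trans (norm_le_qnorm _ H)).
  apply: (@le_lt_trans _ _ (K * d)).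
    rewrite /K -!mulrA; apply: ler_wpM2l => //; apply: ler_wpM2l; first exact: ltW.
    by [].
  have : d <= r / (2 * K) by rewrite ge_min lexx orbT.
  move=> /(ler_wpM2l (ltW K0)) hh; apply: (le_lt_trans hh).
  rewrite (_ : K * _ = r / 2); last by field; rewrite gt_eqF.
  by rewrite ltr_pdivrMr// ltr_pMr// ltr1n.
by move=> /hr /=; rewrite direction_scale.
Qed.

End Time.
End Leaf.

(** * Charts and the Gauss map *)

Lemma derive_at_interior_max {R : realType} (W : normedModType R) (f : W -> R) c v (l : R) :
  is_derive c v f l -> (\forall u \near c, f u <= f c) -> l = 0.
Proof.
move=> [df dl] fc.
have fl : (fun h : R => h^-1 * (f (h *: v + c) - f c)) @ 0^' --> l.
  by rewrite -dl; exact: df.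
have near0 : \forall h \near (0 : R), f (h *: v + c) <= f c.
  have ct : {for 0 : R, continuous (fun h : R => h *: v + c)}.
    apply: continuousD; last exact: cst_continuous.
    exact: scalel_continuous.
  have : nbhs (0 *: v + c) [set u | f u <= f c] by rewrite scale0r add0r.
  by move=> /ct.
apply/eqP; rewrite eq_le; apply/andP; split.
- apply: (cvgr_to_le (cvg_dnbhs_at_right fl)); near=> h.
  have h0 : 0 < h by near: h; exact: nbhs_right_gt.
  rewrite pmulr_rle0 ?invr_gt0// subr_le0.
  by near: h; rewrite near_withinE; apply: filterS near0 => h ? _.
- apply: (cvgr_to_ge (cvg_dnbhs_at_left fl)); near=> h.
  have h0 : h < 0 by near: h; exact: nbhs_left_lt.
  rewrite nmulr_rge0 ?invr_lt0// subr_le0.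
  by near: h; rewrite near_withinE; apply: filterS near0 => h ? _.
Unshelve. all: by end_near. Qed.

Section LocalInverse.
Context {R : realType} {n : nat}.
Variables (U : set 'rV[R]_n) (g : 'rV[R]_n -> 'rV[R]_n.+1).
Hypotheses (oU : open U) (dg : forall u, U u -> differentiable g u)
  (g1 : forall u, U u -> dot (g u) (g u) = 1)
  (dg0 : forall u v, U u -> 'D_v g u = 0 -> v = 0)
  (ginj : forall u u', U u -> U u' -> g u = g u' -> u = u').

Lemma is_derive_dot (f h : 'rV[R]_n -> 'rV[R]_n.+1) u v df dh :
  is_derive u v f df -> is_derive u v h dh ->
  is_derive u v (fun y => dot (f y) (h y)) (dot df (h u) + dot (f u) dh).
Proof.
move=> hf hh.
have D j := is_derive_prod (is_derive_coord j hf) (is_derive_coord j hh).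
by apply: is_derive_eq (is_derive_bigsum D) _; rewrite big_split.
Qed.

Lemma derivable_at u v : U u -> is_derive u v g ('D_v g u).
Proof. by move=> Uu; apply: derivableP; apply: diff_derivable; exact: dg. Qed.

Lemma dot_derive0 u v : U u -> dot ('D_v g u) (g u) = 0.
Proof.
move=> Uu; have D := derivable_at v Uu.
have [_ e] := is_derive_dot D D.
have Z : \near u, dot (g u) (g u) = cst 1 u by apply: open_near_eq Uu.
have := near_eq_derive v Z; rewrite e derive_cst (dotC (g u)) => /eqP.
by rewrite -mulr2n mulrn_eq0 => /eqP.
Qed.

(** The derivatives of [g] are orthogonal to [g u] and the differential is injective, so [g u] and
    the n rows of the jacobian form a basis of R^{n+1}. *)
Lemma tangent_complete u y : U u -> dot y (g u) = 0 ->
  (forall v, dot y ('D_v g u) = 0) -> y = 0.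
Proof.
move=> Uu yg yD.
pose J : 'M[R]_(n, n.+1) := jacobian g u.
have JE v : 'D_v g u = v *m J by rewrite deriveEjacobian//; exact: dg.
pose B : 'M[R]_(1 + n, n.+1) := col_mx (g u) J.
have Bfree : row_free (B : 'M[R]_(n.+1, n.+1)).
  rewrite -kermx_eq0; apply/eqP/row_matrixP => i; rewrite row0.
  have := sub_kermxP (row_sub i (kermx (B : 'M[R]_(n.+1, n.+1)))).
  set w := row i _ => wB.
  have {wB} : lsubmx (w : 'rV[R]_(1 + n)) *m g u + rsubmx (w : 'rV[R]_(1 + n)) *m J = 0.
    by rewrite -mul_row_col hsubmxK.
  rewrite -JE (mx11_scalar (lsubmx _)) mul_scalar_mx.
  set k := lsubmx _ 0 0; set v := rsubmx _ => h.
  have k0 : k = 0.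
    have := congr1 (fun x => dot x (g u)) h.
    rewrite /= dotDl dotZl g1// dot_derive0// mulr1 addr0 => ->.
    by rewrite /dot big1// => j _; rewrite mxE mul0r.
  rewrite k0 scale0r add0r in h; have v0 := dg0 Uu h.
  have : row_mx (lsubmx (w : 'rV[R]_(1 + n))) (rsubmx (w : 'rV[R]_(1 + n))) = 0.
    by rewrite (mx11_scalar (lsubmx _)) -/k -/v k0 v0 raddf0 row_mx0.
  by rewrite hsubmxK.
have BU : (B : 'M[R]_(n.+1, n.+1)) \in unitmx by rewrite -row_free_unit.
have By : B *m y^T = 0.
  apply/colP => i; rewrite !mxE.
  rewrite (_ : \sum_j _ = dot y (row i B)); last first.
    by apply: eq_bigr => j _; rewrite !mxE mulrC.
  case: (split_ordP (i : 'I_(1 + n))) => j ->.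
    rewrite (_ : row _ B = g u) ?yg//.
    by apply/rowP => k; rewrite mxE col_mxEu ord1.
  by rewrite (_ : row _ B = 'D_(delta_mx 0 j) g u) ?yD// JE -rowE; exact: rowKd.
apply: trmx_inj; rewrite trmx0; have := congr1 (mulmx (invmx (B : 'M[R]_(n.+1, n.+1)))) By.
by rewrite mulmx0 mulKmx.
Qed.

Lemma compact_closed_ball (u0 : 'rV[R]_n) (r : R) :
  compact [set u | `|u - u0| <= r].
Proof.
apply: bounded_closed_compact.
  exists (`|u0| + r); split; first exact: num_real.
  move=> x hx u /= hu; rewrite -[u](subrK u0).
  by apply: (le_trans (ler_normD _ _)); apply: ltW; apply: le_lt_trans hx; rewrite addrC lerD2l.
have -> : [set u | `|u - u0| <= r] = (fun u => `|u - u0|) @^-1` [set x | x <= r] by [].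
apply: closed_comp; last exact: closed_le.
move=> u _; apply: continuous_comp; last exact: norm_continuous.
by apply: continuousB; [move=> A|exact: cst_continuous].
Qed.

Lemma compact_sphere (u0 : 'rV[R]_n) (r : R) :
  compact [set u | `|u - u0| = r].
Proof.
have -> : [set u | `|u - u0| = r] = [set u | `|u - u0| <= r] `&` (fun u => `|u - u0|) @^-1` [set x | x >= r].
  apply/seteqP; split => u /=; first by move=> ->; split; rewrite lexx.
  by move=> [h1 h2]; apply/eqP; rewrite eq_le h1 h2.
apply: compact_closedI; first exact: compact_closed_ball.
apply: closed_comp; last exact: closed_ge.
move=> u _; apply: continuous_comp; last exact: norm_continuous.
by apply: continuousB; [move=> A|exact: cst_continuous].
Qed.

Lemma dot_triangle N (x y z : 'rV[R]_N) :
  dot (x - z) (x - z) <= 2 * (dot (x - y) (x - y) + dot (y - z) (y - z)).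
Proof.
have -> : x - z = (x - y) + (y - z) by rewrite subrKA.
move: (x - y) (y - z) => a b; have := dot_ge0 (a + (-1) *: b).
rewrite !dotDl !dotDr !dotZl !dotZr (dotC b a); lra.
Qed.

Lemma dot_subC N (x y : 'rV[R]_N) : dot (x - y) (x - y) = dot (y - x) (y - x).
Proof. rewrite -(opprB y x) -scaleN1r dotZl dotZr; ring. Qed.

Lemma dot_sub_unit N (x y : 'rV[R]_N) : dot x x = 1 -> dot y y = 1 ->
  dot (x - y) (x - y) = 2 - 2 * dot x y.
Proof.
move=> x1 y1; rewrite -[- y]scaleN1r !dotDl !dotDr !dotZl !dotZr x1 y1 (dotC y x); ring.
Qed.

(** Openness of [g] as a map to the sphere, by maximization: on a closed ball around [u0], a maximum
    point of <g u, y> is interior when [y] is close to [g u0], and at such a critical point [y] has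
    no component orthogonal to [g c]. *)
Lemma sphere_local_surj u0 B : U u0 -> nbhs u0 B -> exists2 d : R, 0 < d &
  forall y, dot y y = 1 -> dot (y - g u0) (y - g u0) < d ->
    exists u, [/\ U u, B u & g u = y].
Proof.
move=> Uu0 u0B.
have /nbhs_ballP [r /= r0 hr] : nbhs u0 (U `&` B).
  by apply: filterI => //; exact: open_nbhs_nbhs.
have {}hr u : `|u - u0| <= r / 2 -> U u /\ B u.
  move=> h; apply: hr; rewrite -ball_normE /= distrC; apply: (le_lt_trans h).
  by rewrite ltr_pdivrMr// ltr_pMr// ltr1n.
have gc u : U u -> {for u, continuous g}.
  by move=> Uu; apply: differentiable_continuous; exact: dg.
have r20 : 0 < r / 2 by rewrite divr_gt0.
pose S := [set u | `|u - u0| = r / 2].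
have SK u : S u -> `|u - u0| <= r / 2 by move=> ->.
(* The image of the bounding sphere stays away from [g u0] by injectivity and compactness; that
   sphere is empty for n = 0. *)
have [m m0 hm] : exists2 m : R, 0 < m & forall u, S u -> m <= dot (g u - g u0) (g u - g u0).
  have [S0|S0] := pselect (S !=set0); last first.
    by exists 1 => // u Su; exfalso; apply: S0; exists u.
  have cf : {within S, continuous (fun u => dot (g u - g u0) (g u - g u0))}.
    apply: continuous_in_subspaceT => u; rewrite inE => Su.
    have [Uu _] := hr u (SK _ Su).
    have cg : {for u, continuous (fun u => g u - g u0)}.
      by apply: continuousB; [exact: gc|exact: cst_continuous].
    exact: (dot_continuous cg cg).
  have [c] := EVT_min_rV S0 (@compact_sphere u0 (r / 2)) cf.
  rewrite inE => Sc hc; exists (dot (g c - g u0) (g c - g u0)); last first.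
    by move=> u Su; apply: hc; rewrite inE.
  rewrite lt_def dot_ge0 andbT; apply/eqP => /dot_eq0 /eqP; rewrite subr_eq0 => /eqP h.
  have [Uc _] := hr c (SK _ Sc).
  by move: Sc; rewrite /S /= (ginj Uc Uu0 h) subrr normr0 => e; rewrite -e ltxx in r20.
(* m/4 keeps the maximum off the boundary, where m <= 2 (|g c - y|^2 + |y - g u0|^2) <= 4 |y - g
   u0|^2; the bound 1 makes <y, g c> positive, which excludes y = - g c. *)
exists (Num.min (m / 4) 1); first by rewrite lt_min divr_gt0//= ltr01.
move=> y y1; rewrite lt_min => /andP[hy1 hy2].
pose K := [set u | `|u - u0| <= r / 2].
have K0 : K u0 by rewrite /K /= subrr normr0 ltW.
have cf : {within K, continuous (fun u => dot (g u) y)}.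
  apply: continuous_in_subspaceT => u; rewrite inE => Ku.
  have [Uu _] := hr u Ku.
  by apply: dot_continuous; [exact: gc|exact: cst_continuous].
have [c] := EVT_max_rV (ex_intro _ _ K0) (@compact_closed_ball u0 (r / 2)) cf.
rewrite inE => Kc hc; have [Uc Bc] := hr c Kc.
have hc0 : dot (g u0) y <= dot (g c) y by apply: hc; rewrite inE.
have yc : dot (y - g c) (y - g c) <= dot (y - g u0) (y - g u0).
  by rewrite !dot_sub_unit ?g1// !(dotC y) lerD2l lerN2 ler_pM2l.
have cin : `|c - u0| < r / 2.
  rewrite lt_def Kc andbT; apply/eqP => /esym e.
  have := hm c e; have := dot_triangle (g c) y (g u0).
  rewrite (dot_subC (g c) y).
  by move: hy1 yc; lra.
have Dc v : dot y ('D_v g c) = 0.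
  have Dy u : U u -> is_derive u v (fun u => dot (g u) y) (dot ('D_v g u) y).
    move=> Uu; apply: is_derive_eq (is_derive_dot (derivable_at v Uu) (is_derive_cst y u v)) _.
    by rewrite (_ : dot _ 0 = 0) ?addr0// /dot big1// => j _; rewrite mxE mulr0.
  rewrite dotC; apply: (derive_at_interior_max (f := fun u => dot (g u) y) (Dy c Uc)).
    near=> u.
    have h : `|u - u0| <= r / 2.
      rewrite -[u](subrK c) -addrA; apply: (le_trans (ler_normD _ _)); rewrite -lerBrDr.
      near: u; apply/nbhs_ballP; exists (r / 2 - `|c - u0|); first by rewrite /= subr_gt0.
      by move=> z; rewrite -ball_normE /= distrC => /ltW.
    by apply: hc; rewrite inE.
have yE : y = dot y (g c) *: g c.
  apply/eqP; rewrite -subr_eq0; apply/eqP; apply: (tangent_complete Uc).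
    by rewrite -scaleN1r !dotDl !dotZl g1//; ring.
  by move=> v; rewrite -scaleN1r !dotDl !dotZl Dc (dotC (g c)) dot_derive0//; ring.
exists c; split=> //; rewrite yE.
have k2 : dot y (g c) ^+ 2 = 1 by move: y1; rewrite {1 2}yE dotZl dotZr g1// mulr1.
have : 0 < dot y (g c).
  by move: hy2 yc; rewrite !dot_sub_unit ?g1//; lra.
move: k2 => /eqP; rewrite sqrf_eq1 => /orP[/eqP->|/eqP->]; first by rewrite scale1r.
by rewrite oppr_gt0 ltr10.
Unshelve. all: by end_near. Qed.
End LocalInverse.

Section RegularCharts.
Context {R : realType} {n : nat}.
Local Notation V := 'rV[R]_(1 + n.+1).

Lemma differentiable_approx (W W' : normedModType R) (f : W -> W') x :
  differentiable f x -> forall e, 0 < e ->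
  \forall h \near 0, `|f (h + x) - f x - 'd f x h| <= e * `|h|.
Proof.
move=> /diff_locally /eqaddoP h e e0.
by have := h e e0; apply: filterS => y; rewrite /= !fctE opprD addrA.
Qed.

Lemma differentiable_row (W : normedModType R) m (f : W -> 'rV[R]_m) x :
  (forall j, differentiable (fun u => f u 0 j) x) -> differentiable f x.
Proof.
move=> h.
rewrite (_ : f = \sum_j (fun u => f u 0 j *: (delta_mx 0 j : 'rV[R]_m))); last first.
  by apply/funext => u; rewrite fct_sumE -row_sum_delta.
by apply: differentiable_sum => j; apply: differentiableZl.
Qed.

Lemma differentiable_coord_of (W : normedModType R) m (f : W -> 'rV[R]_m) x j :
  differentiable f x -> differentiable (fun u => f u 0 j) x.
Proof.
move=> h; apply: (@differentiable_comp _ _ _ _ f (fun M : 'rV[R]_m => M 0 j)) => //.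
exact: differentiable_coord.
Qed.

Lemma mulmx_bound m k (A : 'M[R]_(m, k)) :
  exists2 L : R, 0 < L & forall w : 'rV[R]_m, `|w *m A| <= L * `|w|.
Proof.
have s0 : 0 <= \sum_i \sum_j `|A i j| by apply: sumr_ge0 => i _; apply: sumr_ge0.
exists (\sum_i \sum_j `|A i j| + 1); first by rewrite ltr_wpDl.
move=> w; apply: norm_rowP => [|j]; first by rewrite mulr_ge0// addr_ge0.
rewrite mxE; apply: (le_trans (ler_norm_sum _ _ _)).
apply: (@le_trans _ _ ((\sum_i \sum_j `|A i j|) * `|w|)); last first.
  by apply: ler_wpM2r => //; rewrite lerDl.
rewrite mulr_suml; apply: ler_sum => i _; rewrite normrM mulrC.
apply: ler_pM => //; last exact: coord_le_norm.
by rewrite (bigD1 j)//= lerDl sumr_ge0.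
Qed.

Section InverseCurve.
Variables (U : set 'rV[R]_n) (g : 'rV[R]_n -> 'rV[R]_n.+1).
Hypotheses (oU : open U) (dg : forall u, U u -> differentiable g u)
  (g1 : forall u, U u -> dot (g u) (g u) = 1)
  (dg0 : forall u v, U u -> 'D_v g u = 0 -> v = 0)
  (ginj : forall u u', U u -> U u' -> g u = g u' -> u = u').

(** The local inverse is continuous along [c] by [sphere_local_surj]. Its derivative is obtained by
    applying a left inverse of the jacobian to the first-order expansion of [g]; the target has
    dimension n + 1, so there is no two-sided inverse. *)
Lemma inverse_curve u0 (c : R -> 'rV[R]_n.+1) (s : R) c' : U u0 ->
  is_derive s 1 c c' -> c s = g u0 -> (\forall s' \near s, dot (c s') (c s') = 1) ->
  exists (u : R -> 'rV[R]_n) u',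
    [/\ u s = u0, \forall s' \near s, U (u s') /\ g (u s') = c s' & is_derive s 1 u u'].
Proof.
move=> Uu0 dc cs cn.
pose u s' := xget u0 [set v | U v /\ g v = c s'].
have cc : {for s, continuous c}.
  by apply/differentiable_continuous/derivable1_diffP; case: dc.
have hu B : nbhs u0 B -> \forall s' \near s, [/\ U (u s'), B (u s') & g (u s') = c s'].
  move=> /(sphere_local_surj oU dg g1 dg0 ginj Uu0) [d d0 hd].
  have dcont : {for s, continuous (fun s' => dot (c s' - g u0) (c s' - g u0))}.
    have cb : {for s, continuous (fun s' => c s' - g u0)}.
      by apply: continuousB; [exact: cc|exact: cst_continuous].
    exact: (dot_continuous cb cb).
  have lt1 : dot (c s - g u0) (c s - g u0) < d.
    by rewrite cs subrr /dot big1// => i _; rewrite mxE mul0r.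
  have lt2 := cvgr_lt _ dcont _ lt1; 
  near=> s'.
  have cn1 : dot (c s') (c s') = 1 by near: s'; exact: cn.
  have ltd : dot (c s' - g u0) (c s' - g u0) < d by near: s'; exact: lt2.
  have [v [Uv Bv gv]] := hd _ cn1 ltd.
  have [Uu gu] : U (u s') /\ g (u s') = c s'.
    by rewrite /u; case: xgetP => [y -> //|/(_ v)[]].
  by rewrite (ginj Uu Uv _)// gu gv.
have us : u s = u0.
  have [Uu _ gu] := nbhs_singleton (hu setT filterT).
  by apply: ginj => //; rewrite gu.
pose A := jacobian g u0.
have JE v : 'd g u0 v = v *m A by rewrite /A /jacobian mul_rV_lin1.
have Afree : row_free A.
  rewrite -kermx_eq0; apply/eqP/row_matrixP => i; rewrite row0.
  apply: (dg0 Uu0); rewrite deriveE; last exact: dg.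
  by rewrite JE; exact: sub_kermxP (row_sub i (kermx A)).
have AK m (v : 'M[R]_(m, n)) : v *m A *m pinvmx A = v by rewrite -mulmxA mulmxVp// mulmx1.
have [L L0 hL] := mulmx_bound (pinvmx A).
exists u, (c' *m pinvmx A); split => //.
  by apply: filterS (hu setT filterT) => s' [].
have [dc1 dc2] := dc.
have qc : (fun h : R => h^-1 *: (c (h + s) - c s)) @ 0^' --> c'.
  move: dc1; rewrite /derivable -dc2 /derive.
  rewrite (_ : (fun h : R => h^-1 *: ((c \o shift s) h%:A - c s)) =
     (fun h : R => h^-1 *: (c (h + s) - c s)) )//.
  by apply/funext => h; rewrite /= [h%:A]mulr1.
pose K := `|c'| + 1.
have K0 : 0 < K by rewrite ltr_wpDl.
suff qu : (fun h : R => h^-1 *: (u (h + s) - u s)) @ 0^' --> c' *m pinvmx A.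
  have E : (fun h : R => h^-1 *: ((u \o shift s) h%:A - u s)) =
     (fun h : R => h^-1 *: (u (h + s) - u s)).
    by apply/funext => h; rewrite /= [h%:A]mulr1.
  split; rewrite /derivable /derive E; first by apply/cvg_ex; exists (c' *m pinvmx A).
  exact: cvg_lim qu.
apply/cvgrPdist_le => e e0.
(* With error (2 L)^-1 half of |k| is absorbed, giving |k| <= 2 L K |h|; with the second error the
   remainder is then at most e/2 |h|; the third one is for the difference quotient of [c]. *)
have e1 : 0 < (2 * L)^-1 by rewrite invr_gt0 mulr_gt0.
have e2 : 0 < e / (4 * L ^+ 2 * K) by rewrite divr_gt0// !mulr_gt0// exprn_gt0.
have e3 : 0 < e / (2 * L) by rewrite divr_gt0// mulr_gt0.
have shift_cvg (B : set R) : nbhs s B -> \forall h \near (0 : R)^', B (h + s).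
  move=> sB; have ct : {for 0 : R, continuous (fun h : R => h + s)}.
    by apply: continuousD; [move=> ?|exact: cst_continuous].
  have : nbhs (0 + s) B by rewrite add0r.
  by move=> /ct; exact: nbhs_dnbhs.
have approx (d : R) : 0 < d -> \forall h \near (0 : R)^',
    `|c (h + s) - c s - (u (h + s) - u0) *m A| <= d * `|u (h + s) - u0|.
  move=> d0; have := differentiable_approx (dg Uu0) d0.
  move=> /nbhs_ballP [r /= r0 hr].
  have nb : nbhs u0 (ball u0 r) by exact: nbhsx_ballx.
  apply: filterS (shift_cvg _ (hu _ nb)) => h [Uu Bu gu].
  have := hr (u (h + s) - u0); rewrite -ball_normE /= sub0r normrN => hh.
  have : `|u (h + s) - u0| < r.
    by move: Bu; rewrite -ball_normE /= distrC.
  by move=> /hh; rewrite subrK gu JE -cs.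
have ap1 := approx _ e1; have ap2 := approx _ e2.
have q1 := (cvgrPdist_le _ _).1 qc 1 ltr01.
have q2 := (cvgrPdist_le _ _).1 qc _ e3.
near=> h.
have h0 : h != 0 by near: h; exact: nbhs_dnbhs_neq.
have a1 : `|c (h + s) - c s - (u (h + s) - u0) *m A| <= (2 * L)^-1 * `|u (h + s) - u0|.
  by near: h; exact: ap1.
have a2 : `|c (h + s) - c s - (u (h + s) - u0) *m A| <= e / (4 * L ^+ 2 * K) * `|u (h + s) - u0|.
  by near: h; exact: ap2.
have a3 : `|c' - h^-1 *: (c (h + s) - c s)| <= 1 by near: h; exact: q1.
have a4 : `|c' - h^-1 *: (c (h + s) - c s)| <= e / (2 * L) by near: h; exact: q2.
rewrite us; move: a1 a2 a3 a4; set k := u (h + s) - u0; set dl := c (h + s) - c s.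
move=> a1 a2 a3 a4.
have hp : 0 < `|h| by rewrite normr_gt0.
have dlb : `|dl| <= K * `|h|.
  rewrite -ler_pdivrMr// mulrC -normfV -normrZ /K addrC -lerBlDr.
  by apply: le_trans a3; rewrite distrC; apply: le_trans (ler_dist_dist _ _); exact: ler_norm.
have kd (d : R) : 0 <= d -> `|dl - k *m A| <= d * `|k| -> `|k - dl *m pinvmx A| <= L * d * `|k|.
  move=> d0 hd; rewrite -{1}(AK _ k) -mulmxBl; apply: (le_trans (hL _)).
  by rewrite distrC -mulrA; exact: (ler_wpM2l (ltW L0) hd).
have k1 : `|k| <= 2 * L * K * `|h|.
  have := kd _ (ltW e1) a1; rewrite invfM mulrCA mulfV ?gt_eqF// mulr1 => h1.
  have : `|k| <= `|k - dl *m pinvmx A| + `|dl *m pinvmx A|.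
    by apply: le_trans (ler_normD _ _); rewrite subrK.
  have := hL dl; have := ler_wpM2l (ltW L0) dlb; lra.
have k2 : `|k - dl *m pinvmx A| <= e / 2 * `|h|.
  apply: (le_trans (kd _ (ltW e2) a2)).
  have Le : 0 <= L * (e / (4 * L ^+ 2 * K)) by rewrite mulr_ge0// ltW.
  apply: (le_trans (ler_wpM2l Le k1)).
  have -> : L * (e / (4 * L ^+ 2 * K)) * (2 * L * K * `|h|) = e / 2 * `|h|.
    by field; rewrite !gt_eqF.
  exact: lexx.
have -> : c' *m pinvmx A - h^-1 *: k =
   (c' - h^-1 *: dl) *m pinvmx A - h^-1 *: (k - dl *m pinvmx A).
  by rewrite mulmxBl scalerBr -scalemxAl; apply/rowP => i; rewrite !mxE; ring.
apply: (le_trans (ler_normB _ _)); rewrite (splitr e); apply: lerD.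
  apply: (le_trans (hL _)); apply: (le_trans (ler_wpM2l (ltW L0) a4)).
  have -> : L * (e / (2 * L)) = e / 2 by field; rewrite gt_eqF.
  exact: lexx.
by rewrite normrZ normfV mulrC ler_pdivrMr.
Unshelve. all: by end_near. Qed.

End InverseCurve.
End RegularCharts.

Section RegularCharts.
Context {R : realType} {n : nat}.
Local Notation V := 'rV[R]_(1 + n.+1).

(** What is used of a chart, in a form common to both parts of the theorem. Since P is a positive
    multiple of (1, G), <dP, dP> is the square of that factor times |dG|^2, so [rc_immersion] says
    that the Gauss map is an immersion. *)
Record regular_chart (M : topologicalType) (D : set M) (P Q : M -> V) (C : R)
    (U : set 'rV[R]_n) (c : 'rV[R]_n -> M) : Prop := RegularChart {
  rc_open : open U ;
  rc_dom : forall u, U u -> D (c u) ;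
  rc_inj : forall u u', U u -> U u' -> c u = c u' -> u = u' ;
  rc_cont : forall u, U u -> {for u, continuous c} ;
  rc_diffP : forall u, U u -> differentiable (P \o c) u ;
  rc_diffQ : forall u, U u -> differentiable (Q \o c) u ;
  rc_immersion : forall u v, U u ->
    lorentz ('D_v (P \o c) u) ('D_v (P \o c) u) = 0 -> v = 0 ;
  rc_normal : forall u v, U u -> lorentz ('D_v (Q \o c) u) (P (c u)) = 0 ;
  rc_bound : forall u v, U u -> lorentz ('D_v (Q \o c) u) ('D_v (Q \o c) u) <=
    C ^+ 2 * lorentz ('D_v (P \o c) u) ('D_v (P \o c) u) }.

Lemma differentiable_direction (W : normedModType R) (F : W -> V) x :
  time (F x) != 0 -> differentiable F x -> differentiable (fun u => direction (F u)) x.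
Proof.
move=> t0 dF; apply: differentiable_row => j.
rewrite (_ : (fun u => _) = (fun u => (F u 0 0)^-1) * (fun u => F u 0 (rshift 1 j))).
  apply: differentiableM; last exact: differentiable_coord_of.
  by apply: differentiableV => //; exact: differentiable_coord_of.
by apply/funext => u; rewrite /direction /time !mxE.
Qed.

Lemma null_direction (v : V) : lorentz v v = 0 -> time v != 0 ->
  dot (direction v) (direction v) = 1.
Proof.
by move=> /null_time h v0; rewrite /direction dotZl dotZr h; field.
Qed.

Lemma is_derive_null (F : R -> V) (s : R) dF : is_derive s 1 F dF ->
  (\forall s' \near s, lorentz (F s') (F s') = 0) -> lorentz (F s) dF = 0.
Proof.
move=> D Z; have [_ e] := is_derive_lorentz D D.
have E : \near s, cst 0 s = lorentz (F s) (F s) by apply: filterS Z => s' ->.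
have [_ e0] := near_eq_is_derive E (is_derive_cst (0 : R) s 1).
by move: e; rewrite e0 (lorentzC dF) => /esym/eqP; rewrite -mulr2n mulrn_eq0 => /eqP.
Qed.

(* N is null, hence orthogonal to N', so the derivative of the scale l adds
   nothing to the norm. *)
Lemma null_speed (N : R -> V) (l : R -> R) (s : R) N' l' :
  is_derive s 1 N N' -> is_derive s 1 l l' ->
  (forall s, lorentz (N s) (N s) = 0) ->
  exists F', is_derive s 1 (fun s => l s *: N s) F' /\
     lorentz F' F' = l s ^+ 2 * lorentz N' N'.
Proof.
move=> dN dl N0; exists (l' *: N s + l s *: N'); split.
  apply: is_derive_row => j.
  rewrite (_ : (fun y => _) = (fun y => l y * N y 0 j)); last first.
    by apply/funext => y; rewrite mxE.
  apply: is_derive_eq (is_derive_prod dl (is_derive_coord j dN)) _.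
  by rewrite !mxE.
have nz : \forall s' \near s, lorentz (N s') (N s') = 0.
  by apply: (filterS _ (@filterT _ (nbhs s) _)) => s' _; exact: N0.
have z := is_derive_null dN nz.
rewrite !lorentzDl !lorentzDr !lorentzZl !lorentzZr N0 (lorentzC N') z; ring.
Qed.

Variables (M : topologicalType) (D : set M) (P Q : M -> V) (C : R).
Hypotheses (nf : null_frame D P Q) (dinj : direction_injective D P)
  (atlas : forall p, D p -> exists U c u,
     [/\ regular_chart D P Q C U c, U u & c u = p]).

Lemma direction_eq p p' : D p -> D p' ->
  direction (P p) = direction (P p') -> p = p'.
Proof.
move=> Dp Dp' h; have [_ _ _ t1] := nf Dp; have [_ _ _ t2] := nf Dp'.
apply: (dinj Dp Dp' (l := time (P p) / time (P p'))); first exact: divr_gt0.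
have E1 := direction_vec (lt0r_neq0 t1); have E2 := direction_vec (lt0r_neq0 t2).
by rewrite {1}E1 h {3}E2 scalerA divfK// lt0r_neq0.
Qed.

Section Chart.
Variables (U : set 'rV[R]_n) (c : 'rV[R]_n -> M).
Hypothesis rc : regular_chart D P Q C U c.
Let g u := direction (P (c u)).

Let t_gt0 u : U u -> 0 < time (P (c u)).
Proof. by move=> Uu; have [] := nf (rc_dom rc Uu). Qed.

Let dg u : U u -> differentiable g u.
Proof.
move=> Uu; apply: differentiable_direction (rc_diffP rc Uu).
by rewrite gt_eqF// t_gt0.
Qed.

Let g1 u : U u -> dot (g u) (g u) = 1.
Proof.
move=> Uu; apply: null_direction; last by rewrite gt_eqF// t_gt0.
by have [] := nf (rc_dom rc Uu).
Qed.

Let ginj u u' : U u -> U u' -> g u = g u' -> u = u'.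
Proof.
move=> Uu Uu' h; apply: (rc_inj rc Uu Uu').
by apply: direction_eq h; exact: (rc_dom rc).
Qed.

(** P is its time times (1, g), so if [g] is stationary along [v], the derivative of P is a multiple
    of the null vector (1, g). *)
Let dg0 u v : U u -> 'D_v g u = 0 -> v = 0.
Proof.
move=> Uu h; apply: (rc_immersion rc Uu).
have dP : is_derive u v (P \o c) ('D_v (P \o c) u).
  by apply: derivableP; apply: diff_derivable; exact: (rc_diffP rc Uu).
have Dg : is_derive u v g 0.
  by rewrite -h; apply: derivableP; apply: diff_derivable; exact: dg.
have dt := is_derive_coord 0 dP.
set F := 'D_v (P \o c) u in dP dt *.
have sF : space F = F 0 0 *: g u.
  apply/rowP => j.
  have -> : space F 0 j = F 0 (rshift 1 j) by rewrite mxE.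
  have -> : (F 0 0 *: g u) 0 j = F 0 0 * g u 0 j by rewrite mxE.
  have [_ <-] := is_derive_coord (rshift 1 j) dP.
  have [_ e] := is_derive_prod dt (is_derive_coord j Dg).
  have z0 : (0 : 'rV[R]_n.+1) 0 j = 0 by rewrite mxE.
  rewrite z0 mulr0 addr0 in e; rewrite -e; apply: near_eq_derive.
  apply: open_near_eq (rc_open rc) _ Uu => w Uw.
  rewrite /g /direction /time !mxE mulrA mulfV ?mul1r//.
  by rewrite gt_eqF// (t_gt0 Uw).
rewrite /lorentz sF dotZl dotZr g1// /time; ring.
Qed.

Lemma chart_direction_near u0 B : U u0 -> nbhs (c u0) B ->
  exists2 S, nbhs (direction (P (c u0))) S &
    forall y, D y -> S (direction (P y)) -> B y.
Proof.
move=> Uu0 hB.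
have [d d0 hd] := sphere_local_surj (rc_open rc) dg g1 dg0 ginj Uu0 (rc_cont rc Uu0 hB).
exists [set y | dot (y - g u0) (y - g u0) < d].
  have cb : {for g u0, continuous (fun y : 'rV[R]_n.+1 => y - g u0)}.
    by apply: continuousB; [move=> ?|exact: cst_continuous].
  have dc := dot_continuous cb cb.
  apply: (cvgr_lt _ dc); rewrite subrr /dot big1// => i _; by rewrite mxE mul0r.
move=> y Dy /= ltd; have [PP _ _ tP] := nf Dy.
have y1 : dot (direction (P y)) (direction (P y)) = 1.
  by apply: null_direction; rewrite ?gt_eqF.
have [u [Uu Bu gu]] := hd _ y1 ltd.
by rewrite (_ : y = c u)//; apply: direction_eq => //; exact: (rc_dom rc Uu).
Qed.

(** The curve of directions of [N] is pulled back by [inverse_curve]. Along the lift P is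
    [ll s *: N s], whose speed is given by [null_speed]; [rc_bound] transfers it to Q. *)
Lemma chart_lift (N : R -> V) N' (s : R) u0 (l : R) : U u0 -> is_derive s 1 N N' ->
  (forall s, lorentz (N s) (N s) = 0) -> 0 < l -> P (c u0) = l *: N s ->
  exists (pp : R -> M) (ll : R -> R) Q',
    [/\ \forall s' \near s, covered D P N s' (pp s') (ll s'),
        is_derive s 1 (Q \o pp) Q', lorentz Q' (P (c u0)) = 0 &
        lorentz Q' Q' <= C ^+ 2 * (l ^+ 2 * lorentz N' N')].
Proof.
move=> Uu0 dN N0 l0 Pl.
have tPu := t_gt0 Uu0.
have tN : 0 < time (N s).
  by move: tPu; rewrite Pl timeZ pmulr_rgt0.
have dNd : differentiable N s by apply/derivable1_diffP; case: dN.
have Nc : {for s, continuous N} by exact: differentiable_continuous.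
have tNc : {for s, continuous (fun y => time (N y))} by exact: time_continuous.
have tN_near : \forall s' \near s, 0 < time (N s') by exact: (cvgr_gt _ tNc).
pose ga s' := direction (N s').
have dga : is_derive s 1 ga ('D_1 ga s).
  apply: derivableP; apply/derivable1_diffP; apply: differentiable_direction dNd.
  by rewrite gt_eqF.
have gas : ga s = g u0 by rewrite /g Pl direction_scale// gt_eqF.
have ga1 : \forall s' \near s, dot (ga s') (ga s') = 1.
  by apply: filterS tN_near => s' t'; apply: null_direction => //; rewrite gt_eqF.
have [u [u' [us hu du]]] := inverse_curve (rc_open rc) dg g1 dg0 ginj Uu0 dga gas ga1.
pose ll s' := time (P (c (u s'))) / time (N s').
have llE s' : U (u s') -> g (u s') = ga s' -> 0 < time (N s') ->
    P (c (u s')) = ll s' *: N s'.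
  move=> Us gE t'; have E1 := direction_vec (lt0r_neq0 (t_gt0 Us)).
  have E2 := direction_vec (lt0r_neq0 t').
  rewrite E1 -/(g _) gE [in RHS]E2 scalerA /ll divfK// lt0r_neq0//.
have good : \forall s' \near s, covered D P N s' (c (u s')) (ll s').
  apply: filterS2 hu tN_near => s' [Us gE] t'.
  split; first exact: (rc_dom rc Us); last exact: llE.
  by rewrite /ll divr_gt0// t_gt0.
have comp (f : M -> V) : differentiable (f \o c) u0 ->
    is_derive s 1 (f \o (c \o u)) ('D_u' (f \o c) u0).
  move=> df; have [du1 du2] := du.
  have dfs : differentiable (f \o c) (u s) by rewrite us.
  have := is_derive_comp dfs du1; rewrite du2 us.
  by rewrite -(deriveE _ df).
have dPu := comp P (rc_diffP rc Uu0).
have dQu := comp Q (rc_diffQ rc Uu0).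
have lls : ll s = l.
  by rewrite /ll us Pl timeZ mulfK// gt_eqF.
have dll : is_derive s 1 ll ('D_1 ll s).
  apply: derivableP.
  apply: (@derivableM _ _ (fun s' => time (P (c (u s')))) (fun s' => (time (N s'))^-1)).
    by have [] := is_derive_coord 0 dPu.
  apply: derivableV; first by rewrite gt_eqF.
  by have [] := is_derive_coord 0 dN.
have [F' [dF' nF']] := null_speed dN dll N0.
have EF : 'D_u' (P \o c) u0 = F'.
  have E : \near s, (P \o (c \o u)) s = (ll s *: N s).
    by apply: filterS good => s' [].
  have [_ e1] := near_eq_is_derive E dPu; have [_ e2] := dF'.
  by rewrite -e1 -e2.
exists (c \o u), ll, ('D_u' (Q \o c) u0); split=> //.
- exact: (rc_normal rc _ Uu0).
- by have := rc_bound rc u' Uu0; rewrite EF nF' lls.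
Qed.
End Chart.

Lemma atlas_lift_open : lift_open D P Q C.
Proof.
move=> N N' s p l dN N0 [Dp l0 Pp].
have [U [c [u [rc Uu cu]]]] := atlas Dp; subst p.
exact: (chart_lift rc Uu dN N0 l0 Pp).
Qed.

Lemma atlas_direction_near : direction_near D P.
Proof.
move=> x B Dx xB; have [U [c [u [rc Uu cu]]]] := atlas Dx; subst x.
exact: (chart_direction_near rc Uu xB).
Qed.
End RegularCharts.

(** * Hypersurfaces with a unit normal field *)

Section Spectral.
Context {R : realType} {n : nat}.
Implicit Types (A B : 'M[R]_n) (v w : 'rV[R]_n).

Definition qf A v w : R := dot (v *m A) w.

Lemma qfDl A v v' w : qf A (v + v') w = qf A v w + qf A v' w.
Proof. by rewrite /qf mulmxDl dotDl. Qed.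

Lemma qfZl A (k : R) v w : qf A (k *: v) w = k * qf A v w.
Proof. by rewrite /qf -scalemxAl dotZl. Qed.

Lemma qfDr A v w w' : qf A v (w + w') = qf A v w + qf A v w'.
Proof. by rewrite /qf dotDr. Qed.

Lemma qfZr A (k : R) v w : qf A v (k *: w) = k * qf A v w.
Proof. by rewrite /qf dotZr. Qed.

Lemma qf0r A v : qf A v 0 = 0.
Proof. by rewrite -(scale0r (0 : 'rV[R]_n)) qfZr mul0r. Qed.

Lemma qf_sumr A v k (f : 'I_k -> 'rV[R]_n) :
  qf A v (\sum_i f i) = \sum_i qf A v (f i).
Proof.
elim: (index_enum _) => [|i r ih]; first by rewrite !big_nil qf0r.
by rewrite !big_cons qfDr ih.
Qed.

Lemma qf_mxE A v w : qf A v w = (v *m A *m w^T) 0 0.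
Proof. by rewrite mxE; apply: eq_bigr => i _; rewrite [w^T _ _]mxE. Qed.

Lemma qfC A v w : A^T = A -> qf A v w = qf A w v.
Proof.
move=> sA; rewrite !qf_mxE.
have -> : v *m A *m w^T = (w *m A *m v^T)^T by rewrite !trmx_mul trmxK sA mulmxA.
by rewrite mxE.
Qed.

Lemma mulmxr_continuous m (A : 'M[R]_(n, m)) v :
  {for v, continuous (fun v : 'rV[R]_n => v *m A)}.
Proof.
apply: row_continuous => j.
rewrite (_ : (fun y => _) = (fun y : 'rV[R]_n => \sum_i y 0 i * A i j)); last first.
  by apply/funext => y; rewrite mxE.
apply: continuous_bigsum => i; apply: continuousM; last exact: cst_continuous.
exact: coord_continuous.
Qed.

Lemma qf_continuous A (T : topologicalType) (f g : T -> 'rV[R]_n) u :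
  {for u, continuous f} -> {for u, continuous g} ->
  {for u, continuous (fun y => qf A (f y) (g y))}.
Proof.
move=> cf cg.
have h : {for u, continuous (fun y => f y *m A)}.
  exact: (@continuous_comp _ _ _ f (fun v => v *m A) u cf (@mulmxr_continuous _ A (f u))).
exact: (dot_continuous h cg).
Qed.

Lemma continuous_id_at v : {for v, continuous (fun v : 'rV[R]_n => v)}.
Proof. by move=> A. Qed.

Lemma qf_diag_continuous A v : {for v, continuous (fun v : 'rV[R]_n => qf A v v)}.
Proof.
exact: (@qf_continuous A _ (fun v => v) (fun v => v) v (@continuous_id_at v) (@continuous_id_at v)).
Qed.

Section PosDef.
Variables A B : 'M[R]_n.
Hypotheses (sA : A^T = A) (sB : B^T = B) (pA : forall v, v != 0 -> 0 < qf A v v).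

Lemma qf_coercive : exists2 m : R, 0 < m & forall v, m * `|v| ^+ 2 <= qf A v v.
Proof.
pose S := [set v : 'rV[R]_n | `|v - 0| = 1].
have [S0|S0] := pselect (S !=set0).
  have cf : {within S, continuous (fun v => qf A v v)}.
    apply: continuous_in_subspaceT => v _.
    exact: qf_diag_continuous.
  have [c] := EVT_min_rV S0 (@compact_sphere _ _ 0 1) cf.
  rewrite inE => Sc hc; exists (qf A c c).
    apply: pA; apply/eqP => c0; move: Sc; rewrite /S /= c0 subrr normr0 => /eqP.
    by rewrite eq_sym oner_eq0.
  move=> v; have [->|v0] := eqVneq v 0; first by rewrite normr0 expr0n mulr0 qf0r.
  have nv : 0 < `|v| by rewrite normr_gt0.
  have : qf A c c <= qf A (`|v|^-1 *: v) (`|v|^-1 *: v).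
    apply: hc; rewrite inE /S /= subr0 normrZ normfV normr_id mulVf//.
    by rewrite gt_eqF.
  rewrite qfZl qfZr mulrA -expr2 exprVn mulrC => h.
  by rewrite -ler_pdivlMr// exprn_gt0.
exists 1 => // v; rewrite mul1r; have [->|v0] := eqVneq v 0.
  by rewrite normr0 expr0n qf0r.
exfalso; apply: S0; exists (`|v|^-1 *: v); rewrite /S /= subr0 normrZ normfV normr_id.
by rewrite mulVf// normr_eq0.
Qed.

(** The families are indexed by [nat] so that the induction on k keeps their type. *)
Definition partial_eigenbasis k (e : nat -> 'rV[R]_n) (ka : nat -> R) :=
  (forall i j, (i < k)%N -> (j < k)%N -> qf A (e i) (e j) = (i == j)%:R) /\
  (forall i w, (i < k)%N -> qf B (e i) w = ka i * qf A (e i) w).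

Lemma linear_coef0 (x y : R) : (forall s, 0 <= 2 * s * x + s ^+ 2 * y) -> x = 0.
Proof.
move=> h; have y0 : 0 <= `|y| := normr_ge0 y.
have yy := ler_norm y.
(* Small enough that the linear term wins: the value is x^2 times a negative number. *)
pose s := - x / (`|y| + 1).
have p : 0 < `|y| + 1 by lra.
have := h s; rewrite /s.
have -> : 2 * (- x / (`|y| + 1)) * x + (- x / (`|y| + 1)) ^+ 2 * y =
  x ^+ 2 * (y - 2 * (`|y| + 1)) / (`|y| + 1) ^+ 2 by field; rewrite gt_eqF.
rewrite pmulr_lge0 ?invr_gt0 ?exprn_gt0// => h2.
have x2 := sqr_ge0 x.
apply/eqP; rewrite -sqrf_eq0 eq_le x2 andbT.
move: h2; move: (x ^+ 2) x2 => z z0; nra.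
Qed.

(** The next vector maximizes the form of [B] on the A-unit vectors that are A-orthogonal to the
    previous ones; the maximum is the eigenvalue. *)
Lemma extend_eigenbasis k e ka : (k < n)%N -> partial_eigenbasis k e ka ->
  exists e' ka', partial_eigenbasis k.+1 e' ka'.
Proof.
move=> kn [he hB].
pose perp v := forall i, (i < k)%N -> qf A (e i) v = 0.
pose S := [set v : 'rV[R]_n | qf A v v = 1 /\ perp v].
have [m m0 hm] := qf_coercive.
have S0 : S !=set0.
  pose K : 'M[R]_(n, k) := \matrix_(a, j) (e j *m A) 0 a.
  have [v v0 vK] := left_kernel_neq0 K kn.
  have pv : perp v.
    move=> i ik; have := congr1 (fun M : 'rV_k => M 0 (Ordinal ik)) vK.
    rewrite !mxE => <-; rewrite /qf; apply: eq_bigr => a _; by rewrite !mxE mulrC.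
  have vv := pA v0.
  exists ((Num.sqrt (qf A v v))^-1 *: v); split.
    have s0 : 0 < Num.sqrt (qf A v v) by rewrite sqrtr_gt0.
    rewrite qfZl qfZr -{3}(sqr_sqrtr (ltW vv)).
    by move: s0; move: (Num.sqrt _) => s s0; field; rewrite gt_eqF.
  by move=> i ik; rewrite qfZr pv// mulr0.
have Sc : compact S.
  apply: bounded_closed_compact.
    exists (Num.sqrt m^-1); split; first exact: num_real.
    move=> x hx v [v1 _]; apply: le_trans (ltW hx).
    rewrite -(ger0_norm (normr_ge0 v)) -sqrtr_sqr ler_sqrt ?invr_ge0 ?(ltW m0)//.
    by rewrite -(ler_pM2l m0) mulfV ?gt_eqF// -v1; exact: hm.
  have -> : S = (fun v => qf A v v) @^-1` [set 1] `&`
     \bigcap_(i in [set i | (i < k)%N]) ((fun v => qf A (e i) v) @^-1` [set 0]).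
    by apply/seteqP; split => v [].
  apply: closedI.
    apply: closed_comp; last exact: closed_eq.
    move=> v _; exact: qf_diag_continuous.
  apply: closed_bigI => i _; apply: closed_comp; last exact: closed_eq.
  move=> v _; apply: (@qf_continuous A _ (fun=> e i) (fun v => v)); last exact: continuous_id_at.
  exact: cst_continuous.
have cB : {within S, continuous (fun v => qf B v v)}.
  by apply: continuous_in_subspaceT => v _; exact: qf_diag_continuous.
have [c] := EVT_max_rV S0 Sc cB.
rewrite inE => -[c1 cp] hc.
pose mu := qf B c c.
have hmu v : perp v -> qf B v v <= mu * qf A v v.
  move=> pv; have [->|v0] := eqVneq v 0; first by rewrite !qf0r mulr0.
  have vv := pA v0.
  have [s s0 ss] : exists2 s : R, 0 < s & qf A v v = s ^+ 2.
    by exists (Num.sqrt (qf A v v)); rewrite ?sqrtr_gt0// sqr_sqrtr// ltW.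
  have : qf B (s^-1 *: v) (s^-1 *: v) <= mu.
    apply: hc; rewrite inE; split; last by move=> i ik; rewrite qfZr pv// mulr0.
    by rewrite qfZl qfZr ss; field; rewrite gt_eqF.
  rewrite qfZl qfZr mulrA -expr2 exprVn mulrC ss => h.
  by rewrite -ler_pdivrMr// exprn_gt0.
(* First variation: mu A - B is nonnegative on the orthogonal space and vanishes at [c], so its
   linear term along [f] is zero. *)
have crit f : perp f -> qf B c f = mu * qf A c f.
  move=> pf; apply/eqP; rewrite -subr_eq0 -oppr_eq0 opprB; apply/eqP.
  apply: (@linear_coef0 _ (mu * qf A f f - qf B f f)) => s.
  have : qf B (c + s *: f) (c + s *: f) <= mu * qf A (c + s *: f) (c + s *: f).
    by apply: hmu => i ik; rewrite qfDr qfZr cp// pf// mulr0 addr0.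
  rewrite -subr_ge0 !qfDl !qfDr !qfZl !qfZr c1 (qfC f c sA) (qfC f c sB) -/mu.
  congr (_ <= _); ring.
have ce j : (j < k)%N -> qf A c (e j) = 0 by move=> jk; rewrite qfC// cp.
have Bce j : (j < k)%N -> qf B c (e j) = 0.
  by move=> jk; rewrite qfC// hB// cp// mulr0.
exists (fun i => if i == k then c else e i), (fun i => if i == k then mu else ka i).
split.
  move=> i j; rewrite !ltnS (leq_eqVlt i) (leq_eqVlt j).
  case: eqVneq => [->|ik] /=.
    case: eqVneq => [->|jk] /=; first by rewrite c1.
    by move=> _ jlt; rewrite ce// eq_sym (negbTE jk).
  case: eqVneq => [->|jk] /= ilt jlt; last exact: he.
  by rewrite cp// (negbTE ik).
move=> i w; rewrite ltnS leq_eqVlt; case: eqVneq => [_ _|ik /=]; last exact: hB.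
have [f fE] : exists f, f = w - \sum_(j < k) qf A (e j) w *: e j by eexists.
have pf : perp f.
  move=> i' ik; rewrite fE qfDr -scaleN1r qfZr qf_sumr.
  rewrite (bigD1 (Ordinal ik))//= qfZr he// eqxx mulr1 big1 ?addr0; first by ring.
  move=> j ji; rewrite qfZr he//.
  have -> : (i' == j) = false by apply/eqP => h; case/eqP: ji; exact/val_inj.
  by rewrite mulr0.
have wE : w = f + \sum_(j < k) qf A (e j) w *: e j by rewrite fE subrK.
rewrite wE !qfDr !qf_sumr (crit _ pf) mulrDr; congr (_ + _).
rewrite !big1 ?mulr0// => j _; first by rewrite qfZr ce// mulr0.
by rewrite qfZr Bce// mulr0.
Qed.

Lemma simultaneous_diagonalization : exists (e : 'I_n -> 'rV[R]_n) (ka : 'I_n -> R),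
  (forall i j, qf A (e i) (e j) = (i == j)%:R) /\
  (forall i w, qf B (e i) w = ka i * qf A (e i) w).
Proof.
suff H k : (k <= n)%N -> exists e ka, partial_eigenbasis k e ka.
  have [e [ka [h1 h2]]] := H n (leqnn n).
  by exists (fun i => e i), (fun i => ka i); split => *; rewrite ?h1 ?h2.
elim: k => [|k ih] kn; first by exists (fun=> 0), (fun=> 0); split.
by have [e [ka h]] := ih (ltnW kn); exact: extend_eigenbasis kn h.
Qed.

End PosDef.
End Spectral.

(** * Leaves are immersed for large time *)

Section LeafImmersion.
Context {R : realType} {n : nat}.
Local Notation V := 'rV[R]_(1 + n.+1).

Lemma C1_differentiable_row m k (U : set 'rV[R]_m) (f : 'rV[R]_m -> 'rV[R]_k) x :
  open U -> U x -> Ck 1 U f -> differentiable f x.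
Proof.
move=> oU Ux hf; apply: differentiable_row => j.
exact: (C1_differentiable oU Ux (Ck_coord j oU hf)).
Qed.

(** For t >= 0, e^{-2t} <= e^{-t}, and 10^4 C <= t <= e^t. *)
Lemma small_at_large_time (C t : R) : 0 <= C -> 100 * (100 * C) + 1 <= t ->
  100 * (100 * (C * expR (- t) ^+ 2)) <= 1.
Proof.
move=> C0 ht; have t0 : 0 <= t by lra.
have e1 := expR_ge1Dx t; have e0 := expR_gt0 t.
have en : expR (- t) <= 1 by rewrite -expR0 ler_expR oppr_le0.
have en0 := expR_gt0 (- t).
have ee : expR t * expR (- t) = 1 by rewrite -expRD subrr expR0.
have sq : expR (- t) ^+ 2 <= expR (- t) by rewrite expr2 ler_piMl// ltW.
have h1 : 100 * (100 * C) * expR (- t) ^+ 2 <= 100 * (100 * C) * expR (- t).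
  by apply: ler_wpM2l => //; rewrite !mulr_ge0.
have h2 : 100 * (100 * C) * expR (- t) <= expR t * expR (- t).
  by apply: ler_wpM2r; [exact: ltW|lra].
by move: h1 h2 ee; move: (expR (- t) ^+ 2) (expR t * expR (- t)) => a b; lra.
Qed.

(** A zero derivative means dP = - e^{-2t} dQ; then <dP, dP> <= (C e^{-2t})^2 <dP, dP> <= <dP, dP> /
    4, and <dP, dP> >= 0 because dP is orthogonal to P and Q. *)
Lemma leaf_immersed (M : topologicalType) (D : set M) (P Q : M -> V) (C t : R) U c u v :
  null_frame D P Q -> regular_chart D P Q C U c -> U u ->
  100 * (100 * (C * expR (- t) ^+ 2)) <= 1 -> 0 <= C ->
  'D_v (leaf P Q t \o c) u = 0 -> v = 0.
Proof.
move=> nf rc Uu ht C0 h; apply: (rc_immersion rc Uu).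
have dP : is_derive u v (P \o c) ('D_v (P \o c) u).
  by apply: derivableP; apply: diff_derivable; exact: (rc_diffP rc Uu).
have dQ : is_derive u v (Q \o c) ('D_v (Q \o c) u).
  by apply: derivableP; apply: diff_derivable; exact: (rc_diffQ rc Uu).
have Dl : is_derive u v (leaf P Q t \o c)
    (2^-1 *: (expR t *: 'D_v (P \o c) u + expR (- t) *: 'D_v (Q \o c) u)).
  exact: (is_deriveZ (2^-1) (is_deriveD (is_deriveZ (expR t) dP) (is_deriveZ (expR (- t)) dQ))).
have bound := rc_bound rc v Uu; have normal := rc_normal rc v Uu.
have [_ e] := Dl; rewrite h in e.
have PP0 : lorentz ('D_v (P \o c) u) (P (c u)) = 0.
  have [_ e1] := is_derive_lorentz dP dP.
  have Z : \near u, lorentz ((P \o c) u) ((P \o c) u) = cst 0 u.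
    by apply: open_near_eq (rc_open rc) _ Uu => w Uw /=; have [] := nf _ (rc_dom rc Uw).
  have := near_eq_derive v Z; rewrite e1 derive_cst (lorentzC ((P \o c) u)) => /eqP.
  by rewrite -mulr2n mulrn_eq0 => /eqP.
have PQ0 : lorentz ('D_v (P \o c) u) (Q (c u)) = 0.
  have [_ e1] := is_derive_lorentz dP dQ.
  have Z : \near u, lorentz ((P \o c) u) ((Q \o c) u) = cst (-2) u.
    by apply: open_near_eq (rc_open rc) _ Uu => w Uw /=; have [] := nf _ (rc_dom rc Uw).
  have := near_eq_derive v Z; rewrite e1 derive_cst (lorentzC ((P \o c) u)).
  by rewrite /= normal addr0.
have H := frame_point nf (rc_dom rc Uu).
have ge0 : 0 <= lorentz ('D_v (P \o c) u) ('D_v (P \o c) u).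
  by apply: (lorentz_orthogonal_ge0 H); rewrite lorentzZr lorentzDr PP0 PQ0 addr0 mulr0.
move: e bound ge0; set X := 'D_v (P \o c) u; set Y := 'D_v (Q \o c) u => e bound ge0.
have XY : X = - (expR (- t) ^+ 2) *: Y.
  have : expR t *: X + expR (- t) *: Y = 0.
    by apply: (scalerI (_ : 2^-1 != 0 :> R)); rewrite ?invr_neq0// -e scaler0.
  move=> /(congr1 (fun v => expR (- t) *: v)); rewrite scaler0 scalerDr !scalerA.
  rewrite -expRD addNr expR0 scale1r -expr2 => /eqP; rewrite addr_eq0 => /eqP ->.
  by rewrite scaleNr.
have : lorentz X X = (expR (- t) ^+ 2) ^+ 2 * lorentz Y Y.
  by rewrite XY !lorentz_bilin; ring.
have s0 := sqr_ge0 (expR (- t)).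
have Cs : C * expR (- t) ^+ 2 <= 2^-1 by move: ht; clear; lra.
have Cs0 : 0 <= C * expR (- t) ^+ 2 by rewrite mulr_ge0.
move: (expR (- t) ^+ 2) s0 Cs Cs0 => s s0 Cs Cs0.
have s2 := sqr_ge0 s.
move=> E; have h1 : s ^+ 2 * lorentz Y Y <= s ^+ 2 * (C ^+ 2 * lorentz X X) by exact: ler_wpM2l.
have h2 : (C * s) ^+ 2 <= 2^-1 ^+ 2 by rewrite ler_sqr ?nnegrE ?invr_ge0.
have h3 : (C * s) ^+ 2 * lorentz X X <= 2^-1 ^+ 2 * lorentz X X by exact: ler_wpM2r.
apply/eqP; rewrite eq_le ge0 andbT.
move: E h1 h3; rewrite exprMn mulrA; move: (lorentz X X) (lorentz Y Y) => x y.
by rewrite (mulrC (C ^+ 2)); clear; lra.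
Qed.

Lemma lorentz_nondegenerate (N : nat) (d : 'rV[R]_(1 + N)) :
  (forall x, lorentz x d = 0) -> d = 0.
Proof.
move=> h; apply: vecP.
  have := h (vec 1 0); rewrite /lorentz time_vec space_vec (_ : dot 0 _ = 0).
    by rewrite addr0 mul1r => /eqP; rewrite oppr_eq0 => /eqP ->; rewrite /time mxE.
  by rewrite /dot big1// => i _; rewrite mxE mul0r.
have := h (vec 0 (space d)); rewrite /lorentz time_vec space_vec mul0r oppr0 add0r.
by move=> /dot_eq0 ->; rewrite /space raddf0.
Qed.

(* a unit timelike vector, a unit spacelike one and the n tangent vectors D i
   span Minkowski space *)
Lemma lorentz_frame_complete (p q d : V) (T : 'M[R]_(n, 1 + n.+1)) :
  lorentz p p = -1 -> lorentz q q = 1 -> lorentz p q = 0 ->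
  (forall v : 'rV[R]_n, lorentz (v *m T) p = 0) ->
  (forall v : 'rV[R]_n, lorentz (v *m T) q = 0) ->
  (forall v : 'rV[R]_n, v *m T = 0 -> v = 0) ->
  lorentz p d = 0 -> lorentz q d = 0 ->
  (forall v : 'rV[R]_n, lorentz (v *m T) d = 0) -> d = 0.
Proof.
move=> pp qq pq Tp Tq T0 pd qd Td.
pose B : 'M[R]_(1 + (1 + n), 1 + n.+1) := col_mx p (col_mx q T).
have BE (w : 'rV[R]_(1 + (1 + n))) : w *m B =
   (lsubmx w) 0 0 *: p + ((lsubmx (rsubmx w)) 0 0 *: q + rsubmx (rsubmx w) *m T).
  rewrite -[w in LHS]hsubmxK mul_row_col -[rsubmx w in LHS]hsubmxK mul_row_col.
  by rewrite {1}(mx11_scalar (lsubmx w)) {1}(mx11_scalar (lsubmx (rsubmx w))) !mul_scalar_mx.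
have Bfree : row_free (B : 'M[R]_(1 + n.+1, 1 + n.+1)).
  rewrite -kermx_eq0; apply/eqP/row_matrixP => i; rewrite row0.
  have := sub_kermxP (row_sub i (kermx (B : 'M[R]_(1 + n.+1, 1 + n.+1)))).
  set w := row i _ => wB.
  have {wB} := wB; rewrite (BE w).
  set k := _ 0 0; set l := _ 0 0; set v := rsubmx (rsubmx _) => h.
  have k0 : k = 0.
    have := congr1 (fun x => lorentz x p) h.
    rewrite lorentz0l !lorentzDl !lorentzZl pp (lorentzC q) pq Tp; lra.
  have l0 : l = 0.
    have := congr1 (fun x => lorentz x q) h.
    rewrite lorentz0l !lorentzDl !lorentzZl qq pq Tq; lra.
  have v0 : v = 0 by apply: T0; move: h; rewrite k0 l0 !scale0r !add0r.
  have : row_mx (lsubmx (w : 'rV[R]_(1 + (1 + n)))) (row_mx (lsubmx (rsubmx (w : 'rV[R]_(1 + (1 + n)))))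
     (rsubmx (rsubmx (w : 'rV[R]_(1 + (1 + n)))))) = 0.
    by rewrite (mx11_scalar (lsubmx _)) (mx11_scalar (lsubmx (rsubmx _))) -/k -/l -/v k0 l0 v0 !raddf0 !row_mx0.
  by rewrite !hsubmxK.
have BU : (B : 'M[R]_(1 + n.+1, 1 + n.+1)) \in unitmx by rewrite -row_free_unit.
pose dl : 'cV[R]_(1 + n.+1) := \col_i lorentz (delta_mx 0 i) d.
have dlE (x : V) : (x *m dl) 0 0 = lorentz x d.
  rewrite {2}(row_sum_delta x) lorentz_suml mxE; apply: eq_bigr => i _.
  by rewrite lorentzZl mxE.
have Bd : B *m dl = 0.
  apply/colP => i.
  have -> : (B *m dl) i 0 = lorentz (row i B) d by rewrite -dlE -row_mul [RHS]mxE.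
  by rewrite rowE BE !lorentzDl !lorentzZl pd qd Td !mulr0 !addr0 [RHS]mxE.
apply: lorentz_nondegenerate => x; rewrite -dlE.
have -> : dl = 0.
  have := congr1 (mulmx (invmx (B : 'M[R]_(1 + n.+1, 1 + n.+1)))) Bd.
  by rewrite mulmx0 mulKmx.
by rewrite mulmx0 mxE.
Qed.

End LeafImmersion.

Section DeriveSwap.
Context {R : realType} {m k : nat}.
Variable U : set 'rV[R]_m.
Hypothesis oU : open U.

Lemma derive_coord_near (f : 'rV[R]_m -> 'rV[R]_k) (h : 'rV[R]_m -> R) x b j :
  U x -> Ck 1 U f -> (forall x, U x -> f x 0 j = h x) ->
  ('D_b f x) 0 j = 'D_b h x.
Proof.
move=> Ux hf fh; rewrite (derive_coord j (Ck_derivable b hf Ux)).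
exact: (near_eq_derive b (open_near_eq oU fh Ux)).
Qed.

Lemma derive_swap (f : 'rV[R]_m -> 'rV[R]_k) x a b : U x -> Ck 2 U f ->
  'D_b ('D_a f) x = 'D_a ('D_b f) x.
Proof.
move=> Ux hf; apply/rowP => j.
have dc a' y (Uy : U y) := derive_coord j (Ck_derivable a' hf Uy).
have E1 := derive_coord_near b Ux (Ck_derive a hf) (dc a).
have E2 := derive_coord_near a Ux (Ck_derive b hf) (dc b).
have E3 := derive_schwarz a b oU Ux (Ck_coord j oU hf).
exact: (etrans E1 (etrans E3 (esym E2))).
Qed.

End DeriveSwap.

Section Hypersurface.
Context {R : realType} {n : nat}.
Local Notation V := 'rV[R]_(1 + n.+1).
Variables (M : topologicalType) (A : set (chart R n M)) (phi eta : M -> V).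
Hypotheses (mA : smooth_atlas A) (imm : immersed_hypersurface A phi)
  (nor : unit_normal A phi eta).

Section Chart.
Variable c : chart R n M.
Hypothesis Ac : A c.
Let U := cdom c.

Let oU : open U.
Proof. by case: mA => /(_ c Ac)[]. Qed.

Let sphi : smooth U (phi \o c).
Proof. by case: imm => -[/(_ c Ac)]. Qed.

Let seta : smooth U (eta \o c).
Proof. by case: nor => /(_ c Ac). Qed.

Lemma diff_phi u : U u -> differentiable (phi \o c) u.
Proof. by move=> Uu; exact: (C1_differentiable_row oU Uu (sphi 1)). Qed.

Lemma diff_eta u : U u -> differentiable (eta \o c) u.
Proof. by move=> Uu; exact: (C1_differentiable_row oU Uu (seta 1)). Qed.

Let dphi u v : U u -> is_derive u v (phi \o c) ('D_v (phi \o c) u).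
Proof. by move=> Uu; apply: derivableP; apply: diff_derivable; exact: diff_phi. Qed.

Let deta u v : U u -> is_derive u v (eta \o c) ('D_v (eta \o c) u).
Proof. by move=> Uu; apply: derivableP; apply: diff_derivable; exact: diff_eta. Qed.

Lemma lorentz_derive_cst (f g : 'rV[R]_n -> V) u v df dg (k : R) : U u ->
  is_derive u v f df -> is_derive u v g dg ->
  (forall w, U w -> lorentz (f w) (g w) = k) ->
  lorentz df (g u) + lorentz (f u) dg = 0.
Proof.
move=> Uu hf hg hk; have [_ e] := is_derive_lorentz hf hg.
have Z : \near u, lorentz (f u) (g u) = cst k u by apply: open_near_eq oU hk Uu.
by have := near_eq_derive v Z; rewrite e derive_cst.
Qed.

Let hyp p : lorentz (phi p) (phi p) = -1.
Proof. by case: imm => _ /(_ p)[]. Qed.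

Lemma tangent_phi u v : U u -> lorentz ('D_v (phi \o c) u) (phi (c u)) = 0.
Proof.
move=> Uu; have := lorentz_derive_cst Uu (dphi v Uu) (dphi v Uu) (fun w _ => hyp (c w)).
by rewrite (lorentzC ((phi \o c) u)) => /eqP; rewrite -mulr2n mulrn_eq0 => /eqP.
Qed.

Lemma tangent_normal u v : U u -> lorentz ('D_v (phi \o c) u) (eta (c u)) = 0.
Proof. by move=> Uu; have [_ _ _] := nor; apply. Qed.

Lemma normal_phi u v : U u -> lorentz ('D_v (eta \o c) u) (phi (c u)) = 0.
Proof.
have [_ _ pe _] := nor.
move=> Uu; have := lorentz_derive_cst Uu (dphi v Uu) (deta v Uu) (fun w _ => pe (c w)).
by rewrite /= tangent_normal// add0r lorentzC.
Qed.

Lemma normal_normal u v : U u -> lorentz ('D_v (eta \o c) u) (eta (c u)) = 0.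
Proof.
have [_ ee _ _] := nor.
move=> Uu; have := lorentz_derive_cst Uu (deta v Uu) (deta v Uu) (fun w _ => ee (c w)).
by rewrite (lorentzC ((eta \o c) u)) => /eqP; rewrite -mulr2n mulrn_eq0 => /eqP.
Qed.

Lemma pair_derive (fa : 'rV[R]_n -> V) u b : U u -> Ck 1 U fa ->
  (forall w, U w -> lorentz (fa w) (eta (c w)) = 0) ->
  lorentz ('D_b (eta \o c) u) (fa u) = - lorentz ('D_b fa u) (eta (c u)).
Proof.
move=> Uu hf h0; have dfa := derivableP (Ck_derivable b hf Uu).
have := lorentz_derive_cst Uu dfa (deta b Uu) h0.
by rewrite (lorentzC (fa u)) => /eqP; rewrite addrC addr_eq0 => /eqP.
Qed.

(** Differentiating <dphi(w), eta> = 0 along [v] turns the left side into minus the product of the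
    mixed second derivative of phi with eta. *)
Lemma second_form_symmetric u v w : U u ->
  lorentz ('D_v (eta \o c) u) ('D_w (phi \o c) u) =
  lorentz ('D_w (eta \o c) u) ('D_v (phi \o c) u).
Proof.
move=> Uu; have E a b :=
  @pair_derive _ _ b Uu (Ck_derive a (sphi 2)) (fun w Uw => @tangent_normal w a Uw).
have S := derive_swap oU w v Uu (sphi 2).
exact: (etrans (E w v) (etrans (congr1 (fun z => - lorentz z (eta (c u))) S) (esym (E v w)))).
Qed.

Let jac (f : M -> V) u := jacobian (f \o c) u.

Let jacE (f : M -> V) u v : differentiable (f \o c) u ->
  'D_v (f \o c) u = v *m jac f u.
Proof. by move=> df; rewrite deriveEjacobian. Qed.

Let gram (f g : M -> V) u : 'M[R]_n :=
  \matrix_(i, j) lorentz ('D_(delta_mx 0 i) (f \o c) u) ('D_(delta_mx 0 j) (g \o c) u).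

Let gramE (f g : M -> V) u v w : differentiable (f \o c) u -> differentiable (g \o c) u ->
  qf (gram f g u) v w = lorentz ('D_v (f \o c) u) ('D_w (g \o c) u).
Proof.
move=> df dg; rewrite (jacE v df) (jacE w dg).
rewrite {2}(row_sum_delta v) {2}(row_sum_delta w) !mulmx_suml.
rewrite lorentz_suml /qf /dot.
under eq_bigr do rewrite mxE mulr_suml.
rewrite exchange_big /=; apply: eq_bigr => i _; rewrite lorentz_sumr.
apply: eq_bigr => j _.
by rewrite -!scalemxAl !lorentzZl !lorentzZr mxE (jacE _ df) (jacE _ dg); ring.
Qed.

(** The convexity hypothesis only speaks about given principal frames, so one has to be produced:
    the two fundamental forms, as forms on R^n, are diagonalized together. *)
Lemma principal_frame u : U u -> exists (e : 'I_n -> 'rV[R]_n) (ka : 'I_n -> R),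
  (forall i j, lorentz ('D_(e i) (phi \o c) u) ('D_(e j) (phi \o c) u) = (i == j)%:R) /\
  (forall i, 'D_(e i) (eta \o c) u = - ka i *: 'D_(e i) (phi \o c) u).
Proof.
move=> Uu; have dp := diff_phi Uu; have de := diff_eta Uu.
pose I := gram phi phi u; pose II := - gram eta phi u.
have IIE v w : qf II v w = - lorentz ('D_v (eta \o c) u) ('D_w (phi \o c) u).
  by rewrite -gramE// /qf /II mulmxN -scaleN1r dotZl mulN1r.
have gE (f g : M -> V) i j : gram f g u i j =
    lorentz ('D_(delta_mx 0 i) (f \o c) u) ('D_(delta_mx 0 j) (g \o c) u) by rewrite mxE.
have sI : I^T = I.
  by apply/matrixP => i j; rewrite mxE; apply: (etrans (gE _ _ _ _)); rewrite lorentzC gE.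
have sII : II^T = II.
  apply/matrixP => i j; rewrite mxE.
  have h k l : II k l = - gram eta phi u k l by rewrite mxE.
  by rewrite !h !gE second_form_symmetric.
have pH : hyperboloid (phi (c u)) by case: imm => _.
have immu v : 'D_v (phi \o c) u = 0 -> v = 0 by case: imm => -[_ h] _; exact: h Ac Uu.
have pI v : v != 0 -> 0 < qf I v v.
  move=> v0; rewrite gramE// lt_def (lorentz_orthogonal_ge0 pH (tangent_phi v Uu)) andbT.
  apply: contra v0 => /eqP h; apply/eqP; apply: immu.
  exact: lorentz_orthogonal_eq0 pH (tangent_phi v Uu) h.
have [e [ka [h1 h2]]] := simultaneous_diagonalization sI sII pI.
exists e, ka; split; first by move=> i j; rewrite -gramE.
(* The diagonalization gives equality against tangent vectors only. The difference is also
   orthogonal to phi and eta, hence zero. *)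
move=> i; apply/eqP; rewrite -subr_eq0 scaleNr opprK; apply/eqP.
have [_ ee pe _] := nor.
apply: (@lorentz_frame_complete _ _ (phi (c u)) (eta (c u)) _ (jac phi u)) => //.
- by move=> v; rewrite -jacE// tangent_phi.
- by move=> v; rewrite -jacE// tangent_normal.
- by move=> v; rewrite -jacE//; exact: immu.
- by rewrite lorentzC lorentzDl lorentzZl normal_phi// tangent_phi// mulr0 addr0.
- by rewrite lorentzC lorentzDl lorentzZl normal_normal// tangent_normal// mulr0 addr0.
- move=> v; rewrite -jacE// lorentzC lorentzDl lorentzZl.
  have := h2 i v; rewrite IIE gramE// => E; rewrite -E.
  by rewrite addrN.
Qed.

Let P p := phi p + eta p.
Let Q p := phi p - eta p.

(** In a principal frame dP has coefficients 1 - k and dQ has 1 + k. With r = 2/(1 - k0), k <= k0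
    gives 2 <= r (1 - k), so |1 + k| <= (1 + r)(1 - k). *)
Lemma horospherical_bound (k0 : R) u v : k0 < 1 -> U u ->
  (forall ka, principal_curvatures phi eta c u ka -> forall i, ka i <= k0) ->
  (lorentz ('D_v (P \o c) u) ('D_v (P \o c) u) = 0 -> v = 0) /\
  lorentz ('D_v (Q \o c) u) ('D_v (Q \o c) u) <=
    (1 + 2 / (1 - k0)) ^+ 2 * lorentz ('D_v (P \o c) u) ('D_v (P \o c) u).
Proof.
move=> k1 Uu hk; have [e [ka [h1 h2]]] := principal_frame Uu.
have kak i : ka i <= k0 by apply: hk; exists e.
have dp := diff_phi Uu; have de := diff_eta Uu.
have dP : differentiable (P \o c) u by exact: (differentiableD dp de).
have dQ : differentiable (Q \o c) u by exact: (differentiableB dp de).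
pose E : 'M[R]_n := \matrix_i e i.
have rowE' i : row i E = e i by rewrite rowK.
have EU : E \in unitmx.
  have : E *m gram phi phi u *m E^T = 1%:M.
    apply/matrixP => i j; rewrite !mxE -h1 -(gramE _ _ dp dp) qf_mxE -!rowE' tr_row.
    rewrite -!row_mul mxE; rewrite [in RHS]mxE; apply: eq_bigr => k _.
    by rewrite !mxE.
  by move=> /mulmx1_unit []; rewrite unitmx_mul => /andP[].
pose a := v *m invmx E.
have vE : v = \sum_i a 0 i *: e i.
  rewrite -[LHS](mulmxKV EU) -/a mulmx_sum_row; apply: eq_bigr => i _.
  by rewrite rowE'.
have DP : 'D_v (P \o c) u = \sum_i (a 0 i * (1 - ka i)) *: 'D_(e i) (phi \o c) u.
  rewrite (jacE v dP) {1}vE mulmx_suml; apply: eq_bigr => i _.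
  rewrite -scalemxAl -jacE// (@deriveD _ _ _ (phi \o c) (eta \o c));
    [|exact: diff_derivable|exact: diff_derivable].
  by rewrite h2 -scalerA scalerBl scale1r scaleNr.
have DQ : 'D_v (Q \o c) u = \sum_i (a 0 i * (1 + ka i)) *: 'D_(e i) (phi \o c) u.
  rewrite (jacE v dQ) {1}vE mulmx_suml; apply: eq_bigr => i _.
  rewrite -scalemxAl -jacE// (@deriveB _ _ _ (phi \o c) (eta \o c));
    [|exact: diff_derivable|exact: diff_derivable].
  by rewrite h2 -scalerA scalerDl scale1r scaleNr opprK.
have norm (F : 'I_n -> V) (b : 'I_n -> R) :
    (forall i j, lorentz (F i) (F j) = (i == j)%:R) ->
    lorentz (\sum_i b i *: F i) (\sum_i b i *: F i) = \sum_i b i ^+ 2.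
  move=> hF; rewrite lorentz_suml; apply: eq_bigr => i _; rewrite lorentzZl lorentz_sumr.
  rewrite (bigD1 i)//= lorentzZr hF eqxx mulr1 big1 ?addr0 ?expr2// => j ji.
  by rewrite lorentzZr hF eq_sym (negbTE ji) mulr0.
have {}norm b := norm (fun i => 'D_(e i) (phi \o c) u) b h1.
rewrite DP DQ !norm; split.
  move=> /eqP; rewrite psumr_eq0; last by move=> i _; exact: sqr_ge0.
  move=> /allP h; rewrite vE big1// => i _.
  have := h i (mem_index_enum _); rewrite /= sqrf_eq0 mulf_eq0 => /orP[/eqP->|].
    by rewrite scale0r.
  rewrite subr_eq0 => /eqP k1'; have := kak i; rewrite -k1' => hh.
  by move: (le_lt_trans hh k1); rewrite ltxx.
rewrite mulr_sumr; apply: ler_sum => i _; rewrite !exprMn [X in _ <= X]mulrCA.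
apply: ler_wpM2l; first exact: sqr_ge0.
have ki := kak i; have kp : 0 < 1 - k0 by rewrite subr_gt0.
have r0 : 0 < 2 / (1 - k0) by rewrite divr_gt0.
have x0 : 0 <= 1 - ka i by lra.
rewrite -exprMn; apply: ler_sqr_norm; rewrite ler_norml; apply/andP; split.
  have := mulr_ge0 (ltW r0) x0; lra.
have : 2 <= 2 / (1 - k0) * (1 - ka i).
  rewrite mulrAC ler_pdivlMr//; lra.
lra.
Qed.

End Chart.
End Hypersurface.

(** * Unfolding a proper hypersurface *)

Section Unfolding.
Context {R : realType} {n : nat}.
Local Notation V := 'rV[R]_(1 + n.+1).

Lemma hyperboloid_time_ge1 N (y : 'rV[R]_(1 + N)) : hyperboloid y -> 1 <= time y.
Proof.
move=> [y1 y0]; have := dot_ge0 (space y); move: y1; rewrite /lorentz => y1 h.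
rewrite -ler_sqr ?nnegrE ?(ltW y0)// expr1n; lra.
Qed.

Lemma compact_hyperboloid_slab N (b : R) :
  compact [set y : 'rV[R]_(1 + N) | hyperboloid y /\ time y <= b].
Proof.
have idc (u : 'rV[R]_(1 + N)) : {for u, continuous (fun v : 'rV[R]_(1 + N) => v)} by move=> A.
have tc : continuous (@time R N) by move=> u; exact: (time_continuous (idc u)).
have -> : [set y : 'rV[R]_(1 + N) | hyperboloid y /\ time y <= b] =
   (fun y => lorentz y y) @^-1` [set -1] `&` (@time R N @^-1` [set x | 1 <= x] `&`
    @time R N @^-1` [set x | x <= b]).
  apply/seteqP; split => y /=.
    by move=> [yH yb]; split; [case: yH|split=> //; exact: hyperboloid_time_ge1].
  move=> [y1 [y0 yb]]; split=> //; split=> //; exact: lt_le_trans y0.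
apply: bounded_closed_compact.
  exists `|b|; split; first exact: num_real.
  move=> x hx y [/= y1 [y0 yb]]; apply: le_trans (ltW hx).
  have b0 : 0 <= b by apply: le_trans yb; apply: le_trans y0.
  have yb2 : time y ^+ 2 <= b ^+ 2.
    by rewrite ler_sqr ?nnegrE// (le_trans _ y0).
  rewrite ger0_norm//; apply: norm_rowP => // i.
  rewrite -ler_sqr ?nnegrE// (real_normK (num_real _)).
  case: (split_ordP i) => j ->.
    by rewrite (_ : lshift _ j = 0)//; apply/val_inj; rewrite /= ord1.
  apply: le_trans yb2.
  have : dot (space y) (space y) <= time y ^+ 2 by move: y1; rewrite /lorentz; lra.
  apply: le_trans; rewrite /dot (bigD1 j)//= /space !mxE -expr2.
  by rewrite lerDl sumr_ge0// => k _; rewrite -expr2 sqr_ge0.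
apply: closedI.
  apply: closed_comp; last exact: closed_eq.
  by move=> u _; exact: (lorentz_continuous (idc u) (idc u)).
by apply: closedI; apply: closed_comp.
Qed.

Variables (M : topologicalType) (A : set (chart R n M)) (phi eta : M -> V)
  (G : M -> 'rV[R]_n.+1).
Hypotheses (mA : smooth_atlas A) (imm : immersed_hypersurface A phi)
  (nor : unit_normal A phi eta) (prop : proper_map phi)
  (gm : gauss_map phi eta G) (Ginj : injective G).

Let P p := phi p + eta p.
Let Q p := phi p - eta p.

Lemma hypersurface_null_frame : null_frame [set: M] P Q.
Proof.
move=> p _; have [_ ee pe _] := nor; have [pp _] := imm.2 p.
rewrite /P /Q !lorentz_bilin pp ee pe (lorentzC (eta p)) pe; split; try ring.
by have [rho /(_ p)[_ ->]] := gm; rewrite timeZ time_vec mulr1 expR_gt0.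
Qed.

Lemma hypersurface_direction p : direction (P p) = G p.
Proof.
have [rho /(_ p)[_ h]] := gm; rewrite /P h direction_scale ?gt_eqF ?expR_gt0//.
by rewrite /direction time_vec space_vec invr1 scale1r.
Qed.

Lemma hypersurface_direction_injective : direction_injective [set: M] P.
Proof.
move=> p p' l _ _ l0 h; apply: Ginj; rewrite -!hypersurface_direction h.
by rewrite direction_scale// gt_eqF.
Qed.

Variable k0 : R.
Hypotheses (k01 : k0 < 1) (hk : forall c u ka, A c -> cdom c u ->
  principal_curvatures phi eta c u ka -> forall i, ka i <= k0).

Let C := 1 + 2 / (1 - k0).

Lemma hypersurface_chart c : A c -> regular_chart [set: M] P Q C (cdom c) c.
Proof.
move=> Ac; have [/(_ c Ac)[oU cinj cc _] _ _] := mA.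
have dp u : cdom c u -> differentiable (phi \o c) u := diff_phi mA imm Ac (u := u).
have de u : cdom c u -> differentiable (eta \o c) u := diff_eta mA nor Ac (u := u).
have bound u v (Uu : cdom c u) := horospherical_bound mA imm nor Ac v k01 Uu
   (fun ka => @hk c u ka Ac Uu).
split; [exact: oU|by []| |exact: cc| | | | |].
- by move=> u u' Uu Uu'; apply: cinj; rewrite inE.
- by move=> u Uu; exact: (differentiableD (dp _ Uu) (de _ Uu)).
- by move=> u Uu; exact: (differentiableB (dp _ Uu) (de _ Uu)).
- by move=> u v Uu; have [] := bound u v Uu.
- move=> u v Uu; rewrite (@deriveB _ _ _ (phi \o c) (eta \o c));
    [|apply: diff_derivable; exact: dp|apply: diff_derivable; exact: de].
  rewrite /P lorentzDl lorentzNl !lorentzDr (tangent_phi mA imm Ac)//.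
  rewrite (tangent_normal nor Ac)// (normal_phi mA imm nor Ac)//.
  by rewrite (normal_normal mA nor Ac)//; ring.
- by move=> u v Uu; have [] := bound u v Uu.
Qed.

Lemma hypersurface_atlas p : [set: M] p -> exists U c u,
  [/\ regular_chart [set: M] P Q C U c, U u & c u = p].
Proof.
move=> _; have [_ /(_ p)[c Ac [u Uu cu]] _] := mA.
by exists (cdom c), c, u; split; [exact: hypersurface_chart|exact: Uu|exact: cu].
Qed.

Lemma continuous_P p : {for p, continuous P}.
Proof.
have [_ /(_ p)[c Ac [u Uu cu]] _] := mA; subst p.
have rc := hypersurface_chart Ac.
have [/(_ c Ac)[oU _ _ copen] _ _] := mA.
have cPc := differentiable_continuous (rc_diffP rc Uu).
move=> B hB; have hB' : nbhs u ((P \o c) @^-1` B) by apply: cPc.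
have : nbhs u ((P \o c) @^-1` B `&` cdom c).
  by apply: filterI => //; exact: open_nbhs_nbhs.
rewrite nbhsE => -[W [oW Wu] WB].
have oc : open (c @` W) by apply: copen => // w /WB [].
have : nbhs (c u) (c @` W) by apply: open_nbhs_nbhs; split=> //; exists u.
by apply: filterS => _ [w /WB [Bw _] <-].
Qed.

(** The points phi of the lift stay in a compact part of the hyperboloid, so by properness the lift
    has a cluster point as s tends to [s0] from the left. By continuity its direction is that of the
    conic at [s0]; a cluster point suffices. *)
Lemma hypersurface_lift_closed : lift_closed [set: M] P Q.
Proof.
move=> E0 W E s0 b /andP[s00 s01] N0 Nt h.
set N := conic E0 W E in N0 Nt h *.
have [p1 _] : exists p : M, True.
  by have [|p _] := h 0; [rewrite lexx|exists p].
pose f s := xget p1 [set p | exists l, [/\ covered [set: M] P N s p l,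
   time (P p) <= b & time (Q p) <= b]].
have fP s : 0 <= s < s0 -> exists l, [/\ covered [set: M] P N s (f s) l,
   time (P (f s)) <= b & time (Q (f s)) <= b].
  by move=> /h [p [l hp]]; rewrite /f; case: xgetP => [y -> //|/(_ p)[]]; exists l.
pose K := [set y : V | hyperboloid y /\ time y <= b].
have cK : compact (phi @^-1` K).
  by apply: prop; [move=> y []|exact: compact_hyperboloid_slab].
have near_s0 : \forall s \near s0^'-, 0 <= s < s0.
  near=> s; apply/andP; split; last by near: s; exact: nbhs_left_lt.
  by near: s; exact: nbhs_left_ge.
have FK : (f @ s0^'-) (phi @^-1` K).
  apply: filterS near_s0 => s hs; have [l [_ hP hQ]] := fP s hs.
  split; first exact: imm.2.
  have -> : phi (f s) = 2^-1 *: (P (f s) + Q (f s)).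
    by rewrite /P /Q; apply/rowP => i; rewrite !mxE; field.
  by rewrite timeZ timeD; move: hP hQ; lra.
have [p [Kp clp]] := cK _ _ FK.
have s0P : 0 < time (N s0) by apply: Nt; rewrite (ltW s00).
have [_ _ _ tP] := hypersurface_null_frame (p := p) I.
have dE : direction (P p) = direction (N s0).
  have cN : {for s0, continuous N}.
    apply/differentiable_continuous/derivable1_diffP.
    by have [] := is_derive_conic E0 W E s0.
  have cdN := direction_continuous (lt0r_neq0 s0P) cN.
  have cdP := direction_continuous (lt0r_neq0 tP) (@continuous_P p).
  apply/eqP; rewrite -subr_eq0 -normr_le0; apply/ler_addgt0Pl => e e0; rewrite addr0.
  have e2 : 0 < e / 2 by rewrite divr_gt0.
  have n1 : \forall x \near p, `|direction (P p) - direction (P x)| <= e / 2.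
    exact: ((cvgrPdist_le _ _).1 cdP _ e2).
  have n2 : \forall s \near s0^'-, `|direction (N s0) - direction (N s)| <= e / 2.
    have cl : (fun s => direction (N s)) @ s0^'- --> direction (N s0).
      by apply: cvg_trans cdN; apply: cvg_app; exact: cvg_within.
    exact: ((cvgrPdist_le _ _).1 cl _ e2).
  have FB : (f @ s0^'-) [set x | exists s, [/\ 0 <= s < s0, x = f s &
      `|direction (N s0) - direction (N s)| <= e / 2]].
    by apply: filterS2 near_s0 n2 => s hs d2; exists s.
  have [x [[s [hs -> d2]] d1]] := clp _ _ FB n1.
  have [l [[_ l0 Pl] _ _]] := fP s hs.
  have dd : direction (P (f s)) = direction (N s).
    by rewrite Pl direction_scale// gt_eqF.
  rewrite /= dd in d1.
  have -> : direction (P p) - direction (N s0) =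
     (direction (P p) - direction (N s)) - (direction (N s0) - direction (N s)).
    by rewrite opprB addrA subrK.
  by apply: (le_trans (ler_normB _ _)); rewrite (splitr e) lerD.
exists p, (time (P p) / time (N s0)); split=> //; first exact: divr_gt0.
have E1 := direction_vec (lt0r_neq0 tP); have E2 := direction_vec (lt0r_neq0 s0P).
by rewrite {1}E1 dE {3}E2 scalerA divfK// lt0r_neq0.
Unshelve. all: by end_near. Qed.

Lemma normal_flowE t p : normal_flow phi eta t p = leaf P Q t p.
Proof.
by rewrite /normal_flow /leaf /P /Q; apply/rowP => i; rewrite !mxE; field.
Qed.

Lemma smooth_normal_flow t : smooth_map A (normal_flow phi eta t).
Proof.
move=> c Ac k; have [/(_ c Ac)[oU _ _ _] _ _] := mA.
apply: Ck_add => //; apply: Ck_scale => //.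
  by have [[h _] _] := imm; exact: h.
by have [h _ _ _] := nor; exact: h.
Qed.

Lemma unfolding (hn : (3 <= n)%N) : exists2 t0 : R, 0 < t0 & forall t, t0 <= t ->
  (forall p, hyperboloid (normal_flow phi eta t p)) /\
  embedding [set: M] A (normal_flow phi eta t).
Proof.
have C0 : 0 <= C.
  by rewrite /C addr_ge0// divr_ge0// subr_ge0 ltW.
exists (100 * (100 * C) + 1); first by rewrite ltr_wpDl// !mulr_ge0.
move=> t /(small_at_large_time C0) ht.
have nf := hypersurface_null_frame.
have di := hypersurface_direction_injective.
have at' := hypersurface_atlas.
have lo := atlas_lift_open nf di at'.
have dn := atlas_direction_near nf di at'.
have lc := hypersurface_lift_closed.
have E : normal_flow phi eta t = leaf P Q t by apply/funext => p; exact: normal_flowE.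
split; first by move=> p; rewrite E; exact: (leaf_hyperboloid nf).
split.
- split; first exact: smooth_normal_flow.
  move=> c u v Ac Uu; rewrite E.
  exact: (leaf_immersed nf (hypersurface_chart Ac) Uu ht C0).
- rewrite E; exact: (leaf_injective nf di lo lc C0 hn ht).
- move=> x B Dx xB; rewrite E; exact: (leaf_near nf di lo lc C0 dn hn ht Dx xB).
Qed.

End Unfolding.

(** * Conformal metrics on spherical domains *)

Section VectorCalculus.
Context {R : realType}.

Lemma is_derive_scalev (W : normedModType R) m (f : W -> R) (g : W -> 'rV[R]_m) u v df dg :
  is_derive u v f df -> is_derive u v g dg ->
  is_derive u v (fun y => f y *: g y) (df *: g u + f u *: dg).
Proof.
move=> hf hg; apply: is_derive_row => j.
rewrite (_ : (fun y => _) = (fun y => f y * g y 0 j)); last first.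
  by apply/funext => y; rewrite mxE.
apply: is_derive_eq (is_derive_prod hf (is_derive_coord j hg)) _.
by rewrite !mxE.
Qed.

Lemma is_derive_vec (W : normedModType R) m (f : W -> R) (g : W -> 'rV[R]_m) u v df dg :
  is_derive u v f df -> is_derive u v g dg ->
  is_derive u v (fun y => vec (f y) (g y)) (vec df dg).
Proof.
move=> hf hg; apply: (@is_derive_row _ _ _ (fun y => vec (f y) (g y))) => i.
case: (split_ordP i) => j ->.
  rewrite (_ : (fun y => _) = f); last by apply/funext => y; rewrite /vec row_mxEl mxE ord1.
  by rewrite /vec row_mxEl mxE ord1.
rewrite (_ : (fun y => _) = (fun y => g y 0 j)); last by apply/funext => y; rewrite /vec row_mxEr.
by rewrite /vec row_mxEr; exact: is_derive_coord.
Qed.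

Lemma is_derive_dotv (W : normedModType R) m (f g : W -> 'rV[R]_m) u v df dg :
  is_derive u v f df -> is_derive u v g dg ->
  is_derive u v (fun y => dot (f y) (g y)) (dot df (g u) + dot (f u) dg).
Proof.
move=> hf hg.
have D j := is_derive_prod (is_derive_coord j hf) (is_derive_coord j hg).
by apply: is_derive_eq (is_derive_bigsum D) _; rewrite big_split.
Qed.

Lemma Ck_id (W : normedModType R) k (U : set W) : Ck k U (fun u : W => u).
Proof.
have c x : {for x, continuous (fun u : W => u)} by move=> A.
case: k => [|k]; first by split=> // x _; exact: c.
apply: CkS => [x _|v x _|v]; [exact: c|exact: derivable_id|].
rewrite (_ : 'D_v _ = fun=> v); first exact: Ck_cst.
by apply/funext => x; rewrite derive_id.
Qed.

Lemma Ck_vec (W : normedModType R) m k (U : set W) (f : W -> R) (g : W -> 'rV[R]_m) :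
  open U -> Ck k U f -> Ck k U g -> Ck k U (fun y => vec (f y) (g y)).
Proof.
move=> oU hf hg; apply: (@Ck_row _ _ _ _ _ (fun y => vec (f y) (g y)) oU) => i.
case: (split_ordP i) => j ->.
  rewrite (_ : (fun y => _) = f)//.
  by apply/funext => y; rewrite /vec row_mxEl mxE ord1.
rewrite (_ : (fun y => _) = (fun y => g y 0 j)); first exact: Ck_coord.
by apply/funext => y; rewrite /vec row_mxEr.
Qed.

Lemma Ck_scalev (W : normedModType R) m k (U : set W) (f : W -> R) (g : W -> 'rV[R]_m) :
  open U -> Ck k U f -> Ck k U g -> Ck k U (fun y => f y *: g y).
Proof.
move=> oU hf hg; apply: Ck_row => // j.
rewrite (_ : (fun y => _) = (fun y => f y * g y 0 j)).
  by apply: Ck_mul => //; exact: Ck_coord.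
by apply/funext => y; rewrite mxE.
Qed.

Lemma Ck_dot (W : normedModType R) m k (U : set W) (f g : W -> 'rV[R]_m) :
  open U -> Ck k U f -> Ck k U g -> Ck k U (fun y => dot (f y) (g y)).
Proof.
move=> oU hf hg; apply: (@Ck_sum _ _ _ _ _ _ (fun i y => f y 0 i * g y 0 i) oU) => i.
by apply: Ck_mul => //; exact: Ck_coord.
Qed.

(** Lets smoothness on a chart of the sphere be checked on the two pieces seen by the two
    stereographic projections. *)
Lemma Ck_union (W W' : normedModType R) k (U U' : set W) (f : W -> W') :
  Ck k U f -> Ck k U' f -> Ck k (U `|` U') f.
Proof.
elim: k f => [|k ih] f h h'.
  by split=> // x [Ux|Ux]; [exact: (Ck_continuous h Ux)|exact: (Ck_continuous h' Ux)].
apply: CkS => [x|v x|v].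
- by move=> [Ux|Ux]; [exact: (Ck_continuous h Ux)|exact: (Ck_continuous h' Ux)].
- by move=> [Ux|Ux]; [exact: (Ck_derivable v h Ux)|exact: (Ck_derivable v h' Ux)].
- by apply: ih; exact: Ck_derive.
Qed.

Lemma Ck_comp_row (W : normedModType R) k m p (U : set W) (U' : set 'rV[R]_m)
    (f : 'rV[R]_m -> 'rV[R]_p) (g : W -> 'rV[R]_m) : open U -> open U' ->
  (forall x, U x -> U' (g x)) -> Ck k U' f -> Ck k U g -> Ck k U (f \o g).
Proof.
move=> oU oU' UU' hf hg; apply: Ck_row => // j.
exact: (Ck_comp oU oU' UU' (Ck_coord j oU' hf) hg).
Qed.

Lemma vecD m (a b : R) (x y : 'rV[R]_m) : vec a x + vec b y = vec (a + b) (x + y).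
Proof. by rewrite /vec add_row_mx raddfD. Qed.

Lemma vecZ m (k a : R) (x : 'rV[R]_m) : k *: vec a x = vec (k * a) (k *: x).
Proof. by rewrite /vec scale_row_mx scale_scalar_mx. Qed.

Lemma dot_vec m (a b : R) (x y : 'rV[R]_m) :
  dot (vec a x : 'rV[R]_m.+1) (vec b y) = a * b + dot x y.
Proof.
rewrite /dot (@big_split_ord _ _ _ 1 m xpredT (fun i => vec a x 0 i * vec b y 0 i)).
congr (_ + _); first by rewrite big_ord1 /vec !row_mxEl !mxE.
by apply: eq_bigr => i _; rewrite /vec !row_mxEr.
Qed.

End VectorCalculus.

(** * Stereographic coordinates *)

Section Stereographic.
Context {R : realType} {n : nat}.
Local Notation V := 'rV[R]_(1 + n.+1).
Variable e : R.
Hypothesis e2 : e * e = 1.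
Implicit Types u v a : 'rV[R]_n.

Definition lam u : R := 2 / (1 + dot u u).
(* Inverse stereographic projection from (- e, 0), for e = 1 or -1; vec and time
   also split R^{n+1} as R x R^n here. *)
Definition sgm u : 'rV[R]_n.+1 := vec (e * (lam u - 1)) (lam u *: u).
Definition spr (x : 'rV[R]_n.+1) : 'rV[R]_n :=
  (1 + e * time (x : 'rV[R]_(1 + n)))^-1 *: space (x : 'rV[R]_(1 + n)).

Lemma den_gt0 u : 0 < 1 + dot u u.
Proof. by rewrite ltr_pwDl// dot_ge0. Qed.

Lemma lam_gt0 u : 0 < lam u.
Proof. by rewrite divr_gt0// den_gt0. Qed.

Lemma lamE u : lam u * (1 + dot u u) = 2.
Proof. by rewrite divfK// gt_eqF// den_gt0. Qed.

Lemma sgm_sphere u : dot (sgm u) (sgm u) = 1.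
Proof.
rewrite dot_vec dotZl dotZr; have := lamE u; set l := lam u; set s := dot u u => h.
have -> : e * (l - 1) * (e * (l - 1)) = (e * e) * (l - 1) ^+ 2 by ring.
rewrite e2 mul1r (_ : l * (l * s) = l * (l * (1 + s)) - l * l); last by ring.
rewrite h; ring.
Qed.

Lemma sprK u : spr (sgm u) = u.
Proof.
rewrite /spr time_vec space_vec scalerA mulrA e2 mul1r addrC subrK.
by rewrite mulVf ?scale1r// gt_eqF// lam_gt0.
Qed.

Lemma sgmK (x : 'rV[R]_n.+1) : dot x x = 1 ->
  1 + e * time (x : 'rV[R]_(1 + n)) != 0 -> sgm (spr x) = x.
Proof.
move=> x1 x0; set a := time (x : 'rV[R]_(1 + n)) in x0 *.
set y := space (x : 'rV[R]_(1 + n)).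
have xE : x = vec a y by apply: (@vecP _ _ (x : 'rV[R]_(1 + n)) (vec a y)); rewrite ?time_vec ?space_vec.
have yy : dot y y = 1 - a * a by move: x1; rewrite {1 2}xE dot_vec => <-; ring.
have lE : lam (spr x) = 1 + e * a.
  rewrite /lam /spr -/a -/y dotZl dotZr yy.
  have -> : 1 - a * a = (1 + e * a) * (1 - e * a).
    have ea : (e * e) * (a * a) = a * a by rewrite e2 mul1r.
    by rewrite -{1}ea; ring.
  have [b bE] : exists b, b = 1 + e * a by eexists.
  rewrite (_ : 1 - e * a = 2 - b) -?bE; last by rewrite bE; ring.
  move: x0; rewrite -bE => b0.
  rewrite (_ : 1 + _ = 2 / b); last by field.
  by field.
rewrite /sgm lE /spr -/a -/y scalerA mulfV// scale1r [RHS]xE; congr vec.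
by rewrite addrC addKr mulrA e2 mul1r.
Qed.

Lemma is_derive_dot_self u v : is_derive u v (fun y : 'rV[R]_n => dot y y) (2 * dot u v).
Proof.
have d := is_derive_id u v.
apply: is_derive_eq (is_derive_dotv d d) _; rewrite (dotC v); ring.
Qed.

Lemma is_derive_lam u v : is_derive u v lam (- (lam u ^+ 2 * dot u v)).
Proof.
have d0 : is_derive u v (fun y : 'rV[R]_n => 1 + dot y y) (0 + 2 * dot u v).
  exact: (is_deriveD (is_derive_cst (1 : R) u v) (is_derive_dot_self u v)).
have dn : 1 + dot u u != 0 by rewrite gt_eqF// den_gt0.
have dd : derivable (fun y : 'rV[R]_n => 1 + dot y y) u v by have [] := d0.
have dV : is_derive u v (fun y : 'rV[R]_n => (1 + dot y y)^-1)
    (- (1 + dot u u) ^- 2 *: (2 * dot u v)).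
  split; first exact: derivableV.
  rewrite (@deriveV _ _ (fun y : 'rV[R]_n => 1 + dot y y))//.
  by have [_ ->] := d0; rewrite add0r.
have := is_derive_prod (is_derive_cst (2 : R) u v) dV.
move=> h; apply: is_derive_eq h _; rewrite /cst mul0r add0r /lam /GRing.scale /=.
by field.
Qed.

Definition dsgm u v : 'rV[R]_n.+1 :=
  vec (- (e * (lam u ^+ 2 * dot u v))) (lam u *: v + (- (lam u ^+ 2 * dot u v)) *: u).

Lemma is_derive_sgm u v : is_derive u v sgm (dsgm u v).
Proof.
have dl := is_derive_lam u v.
have d1 := is_derive_prod (is_derive_cst e u v) (is_deriveB dl (is_derive_cst (1 : R) u v)).
have d2 := is_derive_scalev dl (is_derive_id u v).
have := is_derive_vec d1 d2.
move=> h; apply: is_derive_eq h _; rewrite /dsgm; congr vec.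
  by rewrite /cst mul0r add0r subr0 mulrN.
by rewrite addrC.
Qed.

Lemma dsgm_dot u v w : dot (dsgm u v) (dsgm u w) = lam u ^+ 2 * dot v w.
Proof.
rewrite /dsgm dot_vec !dotDl !dotDr !dotZl !dotZr (dotC v u).
have := lamE u; set l := lam u; set s := dot u u; set p := dot u v; set q := dot u w => h.
have -> : - (e * (l ^+ 2 * p)) * - (e * (l ^+ 2 * q)) = (e * e) * (l ^+ 4 * p * q) by ring.
rewrite e2 mul1r.
have -> : s = (l * (1 + s)) / l - 1 by field; rewrite gt_eqF// lam_gt0.
by rewrite h; field; rewrite gt_eqF// lam_gt0.
Qed.

Lemma dsgm_eq0 u v : dsgm u v = 0 -> v = 0.
Proof.
move=> h; apply: dot_eq0; have := dsgm_dot u v v; rewrite h.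
rewrite (_ : dot 0 0 = 0); last by rewrite /dot big1// => i _; rewrite mxE mul0r.
move=> /esym /eqP; rewrite mulf_eq0 sqrf_eq0 gt_eqF ?lam_gt0//= => /eqP; exact.
Qed.

Lemma Ck_lam k (U : set 'rV[R]_n) : open U -> Ck k U lam.
Proof.
move=> oU; apply: Ck_mul => //; first exact: Ck_cst.
apply: Ck_inv => // [x _|]; first by rewrite gt_eqF// den_gt0.
by apply: Ck_add => //; [exact: Ck_cst|apply: Ck_dot => //; exact: Ck_id].
Qed.

Lemma smooth_sgm (U : set 'rV[R]_n) : open U -> smooth U sgm.
Proof.
move=> oU k; apply: Ck_vec => //.
  apply: Ck_mul => //; first exact: Ck_cst.
  by apply: Ck_add => //; [exact: Ck_lam|exact: Ck_cst].
by apply: Ck_scalev => //; [exact: Ck_lam|exact: Ck_id].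
Qed.

Lemma sgm_continuous u : {for u, continuous sgm}.
Proof. exact: (Ck_continuous (smooth_sgm openT 0) I). Qed.

End Stereographic.

Section ConformalFrame.
Context {R : realType} {n : nat}.
Local Notation V := 'rV[R]_(1 + n.+1).
Variable e : R.
Hypothesis e2 : e * e = 1.
Implicit Types u v a b : 'rV[R]_n.

(* horo parametrizes a section of the light cone isometric to R^n, and horo u is
   proportional to (1, sgm u); dhoro u a is its derivative at u along a. *)
Definition horo u : V :=
  vec ((1 + dot u u) / 2) (vec (e * ((1 - dot u u) / 2)) u : 'rV[R]_n.+1).
Definition dhoro u a : V := vec (dot u a) (vec (- (e * dot u a)) a : 'rV[R]_n.+1).
(** The constant null vector with <horo u, cohoro> = -1, orthogonal to every [dhoro u a]; twice it
    is the field Q of the flat metric. *)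
Definition cohoro : V := vec 1 (vec (- e) (0 : 'rV[R]_n) : 'rV[R]_n.+1).

Lemma is_derive_horo u v : is_derive u v horo (dhoro u v).
Proof.
have d0 := is_derive_dot_self u v.
have d1 : is_derive u v (fun y : 'rV[R]_n => (1 + dot y y) / 2) (dot u v).
  have := is_derive_prod (is_deriveD (is_derive_cst (1 : R) u v) d0) (is_derive_cst (2^-1 : R) u v).
  move=> h; apply: is_derive_eq h _; by rewrite /cst; field.
have d2 : is_derive u v (fun y : 'rV[R]_n => e * ((1 - dot y y) / 2)) (- (e * dot u v)).
  have := is_derive_prod (is_derive_cst (e : R) u v)
    (is_derive_prod (is_deriveB (is_derive_cst (1 : R) u v) d0) (is_derive_cst (2^-1 : R) u v)).
  move=> h; apply: is_derive_eq h _; by rewrite /cst; field.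
exact: (is_derive_vec d1 (is_derive_vec d2 (is_derive_id u v))).
Qed.

Lemma is_derive_dhoro u v (a : 'rV[R]_n -> 'rV[R]_n) a' : is_derive u v a a' ->
  is_derive u v (fun y => dhoro y (a y)) (dot v (a u) *: cohoro + dhoro u a').
Proof.
move=> da; have d0 := is_derive_dotv (is_derive_id u v) da.
have d1 := is_deriveN (is_derive_prod (is_derive_cst e u v) d0).
have h := is_derive_vec d0 (is_derive_vec d1 da).
apply: is_derive_eq h _; rewrite /cohoro /dhoro !vecZ !vecD scaler0 add0r.
by congr (vec _ (vec _ _)); rewrite /cst; ring.
Qed.

Lemma dhoroD u a b : dhoro u (a + b) = dhoro u a + dhoro u b.
Proof. by rewrite /dhoro !vecD dotDr mulrDr opprD. Qed.

Lemma dhoroZ u k a : dhoro u (k *: a) = k *: dhoro u a.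
Proof. by rewrite /dhoro !vecZ dotZr; congr (vec _ (vec _ _)); ring. Qed.

(** [horo u] is null and orthogonal to its derivatives, so its multiples do not count: norms of dP
    and dQ are read off in R^n. *)
Lemma lorentz_horo u a b (k l : R) :
  lorentz (dhoro u a + k *: horo u) (dhoro u b + l *: horo u) = dot a b.
Proof.
rewrite /dhoro /horo !vecZ !vecD lorentz_vec dot_vec !dotDl !dotDr !dotZl !dotZr.
rewrite (dotC a u); set s := dot u u; set p := dot u a; set q := dot u b.
rewrite (_ : (- (e * p) + k * (e * ((1 - s) / 2))) * (- (e * q) + l * (e * ((1 - s) / 2)))
  = (e * e) * ((- p + k * ((1 - s) / 2)) * (- q + l * ((1 - s) / 2)))); last by ring.
by rewrite e2; field.
Qed.

Variables (E : 'rV[R]_n -> R) (om : 'rV[R]_n -> 'rV[R]_n).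

Definition frameP u : V := E u *: horo u.
(** With om = d log E, this is the null vector that has product -2 with [frameP] and is orthogonal
    to the derivatives of [frameP]. *)
Definition frameQ u : V := (E u)^-1 *:
  (2 *: cohoro + dot (om u) (om u) *: horo u + 2 *: dhoro u (om u)).

Variables (u v om' : 'rV[R]_n).
Hypotheses (E0 : E u != 0) (dE : is_derive u v E (E u * dot (om u) v))
  (dom : is_derive u v om om').

(* -2 times the Schouten endomorphism of the metric E^2 times the flat one, where
   om = d log E and om' is its derivative along v *)
Definition schouten : 'rV[R]_n :=
  dot (om u) (om u) *: v + 2 *: om' + (- 2 * dot (om u) v) *: om u.

Lemma is_derive_frameP :
  is_derive u v frameP (E u *: (dhoro u v + dot (om u) v *: horo u)).
Proof.
have h := is_derive_scalev dE (is_derive_horo u v).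
by apply: is_derive_eq h _; rewrite scalerDr scalerA addrC.
Qed.

Lemma is_derive_frameQ : is_derive u v frameQ
  ((E u)^-1 *: (dhoro u schouten + dot (om u) schouten *: horo u)).
Proof.
have dV : is_derive u v (fun y => (E y)^-1) (- ((E u)^-1 * dot (om u) v)).
  have [dE1 dE2] := dE; split; first exact: derivableV.
  by rewrite (@deriveV _ _ E)// dE2 /GRing.scale /=; field.
have d1 := is_derive_scalev (is_derive_dotv dom dom) (is_derive_horo u v).
have d2 := is_deriveZ (2 : R) (is_derive_dhoro dom).
have d3 : is_derive u v (fun y => 2 *: cohoro + dot (om y) (om y) *: horo y + 2 *: dhoro y (om y)) _
  := is_deriveD (is_deriveD (is_derive_cst (2 *: cohoro) u v) d1) d2.
have h := is_derive_scalev dV d3.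
apply: is_derive_eq h _; rewrite /schouten !dhoroD !dhoroZ !dotDr !dotZr.
rewrite (dotC om') (dotC v) /=.
move: (E u) E0 (dot (om u) (om u)) (dot (om u) v) (dot (om u) om') => x x0 s p q.
move: cohoro (horo u) (dhoro u v) (dhoro u om') (dhoro u (om u)) => w0 w1 w2 w3 w4.
by apply/rowP => i; rewrite !mxE; field.
Qed.

End ConformalFrame.

Section SphericalChart.
Context {R : realType} {n : nat}.
Variables (e : R) (Omega U : set 'rV[R]_n.+1) (rho : 'rV[R]_n.+1 -> R).
Hypotheses (e2 : e * e = 1) (oU : open U) (OmegaE : Omega = U `&` @sphere R n)
  (srho : smooth_map (sphere_charts Omega) (rho : 'rV[R]_n.+1 -> R^o)).
Implicit Types u v : 'rV[R]_n.

Definition sdom : set 'rV[R]_n := sgm e @^-1` U.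
Definition srep u : R := rho (sgm e u).
Definition sgrad u : 'rV[R]_n := \row_i 'D_(delta_mx 0 i) srep u.

Lemma sdom_open : open sdom.
Proof. rewrite openE => u Uu; exact: (@sgm_continuous R n e u _ (open_nbhs_nbhs (conj oU Uu))). Qed.

Lemma sdom_Omega u : sdom u -> Omega (sgm e u).
Proof. by move=> Wu; rewrite OmegaE; split=> //; exact: sgm_sphere. Qed.

Lemma sgm_chart : sphere_charts Omega (Chart sdom (sgm e)).
Proof.
split=> /=; first exact: sdom_open.
- by move=> u u' _ _ /(congr1 (spr e)); rewrite !sprK.
- by apply: smooth_sgm; exact: sdom_open.
- move=> u v _; have [_ ->] := is_derive_sgm e u v; exact: (dsgm_eq0 e2).
- by move=> _ [u Wu <-]; split; [exact: sdom_Omega|exact: sgm_sphere].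
Qed.

Lemma smooth_srep k : Ck k sdom srep.
Proof. exact: (srho sgm_chart k). Qed.

Lemma is_derive_srep u v : sdom u -> is_derive u v srep (dot (sgrad u) v).
Proof.
move=> Wu; have di : derivable (fun y : 'rV[R]_n => y) u v by exact: derivable_id.
have h := derive_comp_row (C1_differentiable sdom_open Wu (smooth_srep 1)) di.
apply: is_derive_eq h _; rewrite derive_id; apply: eq_bigr => i _.
by rewrite mulrC mxE.
Qed.

Lemma Ck_sgrad k : Ck k sdom sgrad.
Proof.
apply: (Ck_row sdom_open) => i.
have h := Ck_derive (delta_mx 0 i) (smooth_srep k.+1).
by apply: (Ck_ext sdom_open _ h) => u _; rewrite mxE.
Qed.

Lemma Ck_spr k (O : set 'rV[R]_n.+1) : open O ->
  (forall x, O x -> 1 + e * time (x : 'rV[R]_(1 + n)) != 0) -> Ck k O (spr e).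
Proof.
move=> oO h.
have ct : Ck k O (fun x : 'rV[R]_n.+1 => x 0 0) by exact: (Ck_coord 0 oO (Ck_id k O)).
apply: (Ck_row oO) => j.
have cj : Ck k O (fun x : 'rV[R]_n.+1 => x 0 (rshift 1 j)).
  exact: (Ck_coord (rshift 1 j) oO (Ck_id k O)).
have cd : Ck k O (fun x : 'rV[R]_n.+1 => 1 + e * x 0 0).
  apply: (Ck_add oO (Ck_cst k O (1 : R))); exact: (Ck_mul oO (Ck_cst k O e) ct).
have := Ck_mul oO (Ck_inv oO h cd) cj.
by apply: (Ck_ext oO) => x _; rewrite /spr /time !mxE.
Qed.

Section Transition.
Variables (c : chart R n 'rV[R]_n.+1) (cS : sphere_charts Omega c).

(** [sphere_charts] holds all regular parametrizations, so facts found in stereographic coordinates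
    are carried to [c] by [spr e \o c]. This is the part of [c] that avoids the centre of
    projection. *)
Definition tdom : set 'rV[R]_n :=
  cdom c `&` c @^-1` [set x : 'rV[R]_n.+1 | 1 + e * time (x : 'rV[R]_(1 + n)) != 0].

Lemma half_open : open [set x : 'rV[R]_n.+1 | 1 + e * time (x : 'rV[R]_(1 + n)) != 0].
Proof.
have cc (x : 'rV[R]_n.+1) :
    {for x, continuous (fun y : 'rV[R]_n.+1 => 1 + e * time (y : 'rV[R]_(1 + n)))}.
  apply: continuousD; first exact: cst_continuous.
  apply: continuousM; first exact: cst_continuous.
  by apply: (@time_continuous R n _ (fun y : 'rV[R]_n.+1 => y)); move=> A.
apply: (@open_comp _ _ (fun y : 'rV[R]_n.+1 => 1 + e * time (y : 'rV[R]_(1 + n)))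
  [set z : R | z != 0]); last exact: open_neq.
by move=> x _; exact: cc.
Qed.

Lemma tdom_open : open tdom.
Proof.
have [oc _ sc _ _] := cS; rewrite openE => u [cu hu].
have h1 : nbhs u (cdom c) by exact: (open_nbhs_nbhs (conj oc cu)).
have h2 : nbhs u (c @^-1` [set x : 'rV[R]_n.+1 | 1 + e * time (x : 'rV[R]_(1 + n)) != 0]).
  exact: (Ck_continuous (sc 0) cu (open_nbhs_nbhs (conj half_open hu))).
by rewrite /interior; apply: filterI.
Qed.

Lemma tdomK u : tdom u -> sgm e (spr e (c u)) = c u.
Proof.
move=> [cu hu]; have [_ _ _ _ ci] := cS; apply: sgmK => //.
by have [] := ci (c u) (ex_intro2 _ _ u cu erefl).
Qed.

Lemma tdom_sdom u : tdom u -> sdom (spr e (c u)).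
Proof.
move=> tu; rewrite /sdom /= tdomK//; have [cu hu] := tu; have [_ _ _ _ ci] := cS.
by have [] := ci (c u) (ex_intro2 _ _ u cu erefl); rewrite OmegaE => -[].
Qed.

Lemma Ck_transition k : Ck k tdom (spr e \o c).
Proof.
have [_ _ sc _ _] := cS.
have hc : Ck k tdom c by apply: Ck_subset (sc k) => u [].
have hs := @Ck_spr k _ half_open (fun x h => h).
by apply: (Ck_comp_row tdom_open half_open _ hs hc) => u [].
Qed.

Lemma transition_derive (u : 'rV[R]_n) v : tdom u ->
  is_derive u v c (dsgm e (spr e (c u)) ('D_v (spr e \o c) u)) /\
  is_derive u v (rho \o c : 'rV[R]_n -> R)
     (dot (sgrad (spr e (c u))) ('D_v (spr e \o c) u)).
Proof.
move=> tu; have Wu : sdom ((spr e \o c) u) := tdom_sdom tu.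
have dt : derivable (spr e \o c) u v by exact: (Ck_derivable v (Ck_transition 1) tu).
have dr : differentiable srep ((spr e \o c) u).
  exact: (C1_differentiable sdom_open Wu (smooth_srep 1)).
have ds : differentiable (sgm e) ((spr e \o c) u).
  exact: (C1_differentiable_row sdom_open Wu (@smooth_sgm R n e _ sdom_open 1%N)).
have E1 : \near u, (sgm e \o (spr e \o c)) u = c u.
  by apply: open_near_eq tdom_open _ tu => w tw; exact: tdomK.
have E2 : \near u, (srep \o (spr e \o c)) u = (rho \o c) u.
  by apply: open_near_eq tdom_open _ tu => w tw; rewrite /srep /= tdomK.
have D1 := is_derive_comp ds dt; have D2 := is_derive_comp dr dt.
move: ('D_v (spr e \o c) u) D1 D2 => a D1 D2.
have [_ s1] := is_derive_sgm e ((spr e \o c) u) a; have [_ s2] := is_derive_srep a Wu.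
split.
- exact: (near_eq_is_derive E1 (is_derive_eq D1 (etrans (esym (deriveE a ds)) s1))).
- exact: (near_eq_is_derive E2 (is_derive_eq D2 (etrans (esym (deriveE a dr)) s2))).
Qed.

End Transition.

(** This is lam^-2 times [dsgm] applied to the flat gradient, as the round metric is lam^2 times the
    flat one. *)
Definition sgradient u : 'rV[R]_n.+1 :=
  vec (- (e * dot (sgrad u) u)) ((lam u)^-1 *: sgrad u + (- dot (sgrad u) u) *: u).

Lemma sgradient_tangent u : dot (sgradient u) (sgm e u) = 0.
Proof.
rewrite /sgradient /sgm dot_vec !dotDl !dotZl !dotZr.
move: (dot (sgrad u) u) (lamE u) (lam_gt0 u) => p.
move: (lam u) (dot u u) => l s h l0.
rewrite (_ : - (e * p) * (e * (l - 1)) = - (e * e) * (p * (l - 1))); last by ring.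
rewrite e2 (_ : s = 2 / l - 1); last by rewrite -h; field; rewrite gt_eqF.
by field; rewrite gt_eqF.
Qed.

Lemma sgradient_dsgm u v : dot (sgradient u) (dsgm e u v) = dot (sgrad u) v.
Proof.
rewrite /sgradient /dsgm dot_vec !dotDl !dotDr !dotZl !dotZr.
move: (dot (sgrad u) u) (lamE u) (lam_gt0 u) (dot u v) (dot (sgrad u) v) => p.
move: (lam u) (dot u u) => l s h l0 q r.
rewrite (_ : - (e * p) * - (e * (l ^+ 2 * q)) = (e * e) * (p * (l ^+ 2 * q))); last by ring.
rewrite e2 (_ : s = 2 / l - 1); last by rewrite -h; field; rewrite gt_eqF.
by field; rewrite gt_eqF.
Qed.

(** [sphere_gradient] is a choice, so two things are shown: [sgradient u] satisfies the defining
    condition in every chart, and by [tangent_complete] only one vector does. *)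
Lemma sphere_gradient_sgm u : sdom u -> sphere_gradient Omega rho (sgm e u) = sgradient u.
Proof.
move=> Wu; rewrite /sphere_gradient; set S := [set w | _].
have Sw : S (sgradient u).
  split=> [|c u' v cS cu' E]; first exact: sgradient_tangent.
  have tu : tdom c u'.
    split=> //=; rewrite E time_vec mulrA e2 mul1r addrC subrK.
    by rewrite gt_eqF// lam_gt0.
  have [[_ h1] [_ h2]] := transition_derive cS v tu.
  have E' : spr e (c u') = u by rewrite E sprK.
  by rewrite h1 [RHS]h2 E' sgradient_dsgm.
have Sx := xgetPex 0 (ex_intro _ _ Sw).
move: (xget 0 S) Sx => w [w1 w2].
have ds u0 : sdom u0 -> differentiable (sgm e) u0.
  by move=> Wu'; exact: (C1_differentiable_row sdom_open Wu' (@smooth_sgm R n e _ sdom_open 1%N)).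
have d0 u0 v : sdom u0 -> 'D_v (sgm e) u0 = 0 -> v = 0.
  by move=> _; have [_ ->] := is_derive_sgm e u0 v; exact: (dsgm_eq0 e2).
have g1 u0 : sdom u0 -> dot (sgm e u0) (sgm e u0) = 1.
  by move=> _; exact: sgm_sphere.
apply/eqP; rewrite -subr_eq0; apply/eqP.
have dB (x y z : 'rV[R]_n.+1) : dot (x - y) z = dot x z - dot y z.
  by rewrite -scaleN1r dotDl dotZl mulN1r.
apply: (tangent_complete sdom_open ds g1 d0 Wu) => [|v].
  by rewrite dB w1 sgradient_tangent subrr.
have [_ hs] := is_derive_srep v Wu; have [_ hg] := is_derive_sgm e u v.
have := w2 _ u v sgm_chart Wu (erefl _); rewrite /= dB hg sgradient_dsgm => ->.
by rewrite (_ : 'D_v _ u = dot (sgrad u) v) ?subrr.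
Qed.

End SphericalChart.

(** * Curvature of a conformally flat metric *)

Section ConformallyFlat.
Context {R : realType} {n : nat}.
Variables (W : set 'rV[R]_n) (g : 'rV[R]_n -> 'M[R]_n) (E : 'rV[R]_n -> R)
  (om : 'rV[R]_n -> 'rV[R]_n).
Hypotheses (oW : open W) (E0 : forall u, W u -> 0 < E u)
  (gE : forall u, W u -> g u = (E u ^+ 2)%:M)
  (dE : forall u v, W u -> is_derive u v E (E u * dot (om u) v))
  (dom : forall u v, W u -> derivable om u v).
Implicit Types i j k l m p q : 'I_n.

Lemma delta_rowE i j : (delta_mx 0 i : 'rV[R]_n) 0 j = (i == j)%:R.
Proof. by rewrite mxE eqxx eq_sym. Qed.

Lemma sum_delta k (f : 'I_n -> R) : \sum_q (k == q)%:R * f q = f k.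
Proof.
rewrite (bigD1 k)//= eqxx mul1r big1 ?addr0// => q qk.
by rewrite eq_sym (negbTE qk) mul0r.
Qed.

Lemma sum_scalar_mx (a : R) k (f : 'I_n -> R) : \sum_q a%:M k q * f q = a * f k.
Proof.
rewrite -(sum_delta k f) mulr_sumr; apply: eq_bigr => q _.
by rewrite mxE -mulr_natr; ring.
Qed.

Lemma dot_deltar (x : 'rV[R]_n) i : dot x (delta_mx 0 i) = x 0 i.
Proof.
rewrite /dot -[RHS](sum_delta i (fun q => x 0 q)).
by apply: eq_bigr => q _; rewrite delta_rowE mulrC.
Qed.

Lemma partial_metric u i j l : W u ->
  partial i (fun w => g w j l) u = 2 * E u ^+ 2 * (om u 0 i * (j == l)%:R).
Proof.
move=> Wu; rewrite /partial.
have d := dE (delta_mx 0 i) Wu.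
have d2 := is_derive_prod (is_derive_prod d d) (is_derive_cst ((j == l)%:R : R) u (delta_mx 0 i)).
have N : \near u, E u * E u * (j == l)%:R = g u j l.
  by apply: open_near_eq oW _ Wu => w Ww; rewrite gE// mxE expr2 mulr_natr.
have [_ ->] := near_eq_is_derive N d2.
rewrite dot_deltar /cst; ring.
Qed.

Lemma christoffel_conformal u k i j : W u -> christoffel g k i j u =
  om u 0 i * (j == k)%:R + om u 0 j * (i == k)%:R - om u 0 k * (i == j)%:R.
Proof.
move=> Wu; rewrite /christoffel gE// invmx_scalar.
have e0 : E u != 0 by rewrite gt_eqF// E0.
have -> : \sum_l (E u ^- 2)%:M k l * (partial i (fun w => g w j l) u +
    partial j (fun w => g w i l) u - partial l (fun w => g w i j) u) =
  \sum_l (k == l)%:R * (2 * (om u 0 i * (j == l)%:R + om u 0 j * (i == l)%:R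
     - om u 0 l * (i == j)%:R)).
  by apply: eq_bigr => l _; rewrite mxE !partial_metric// -mulr_natr; field.
by rewrite sum_delta; field.
Qed.

Let dom_ u i j : R := ('D_(delta_mx 0 i) om u) 0 j.

Lemma partial_form u i j : W u -> partial i (fun w => om w 0 j) u = dom_ u i j.
Proof. by move=> Wu; rewrite /partial /dom_ derive_coord//; exact: dom. Qed.

(* -2 times the Schouten tensor of g *)
Definition schouten_coef u i j : R :=
  dot (om u) (om u) * (i == j)%:R + 2 * dom_ u i j - 2 * (om u 0 i * om u 0 j).

(** Only these components are computed: when n >= 3 they already determine the Schouten
    coefficients. *)
Lemma riemann_conformal u i m j : W u -> i != m -> j != m ->
  riemann g i m m j u =
  - (E u ^+ 2 / 2) * (schouten_coef u i j + (i == j)%:R * schouten_coef u m m).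
Proof.
move=> Wu im jm; rewrite /riemann gE//.
have h k l : is_derive u (delta_mx 0 k) (fun w => om w 0 l) (dom_ u k l).
  by rewrite -partial_form//; split=> //; have [] := is_derive_coord l (derivableP (@dom u (delta_mx 0 k) Wu)).
have D1 : partial i (christoffel g j m m) u = - dom_ u i j.
  have N : \near u, - om u 0 j = christoffel g j m m u.
    apply: open_near_eq oW _ Wu => w Ww; rewrite christoffel_conformal//.
    by rewrite eqxx (eq_sym m j) (negbTE jm) ?mulr0n ?mulr1n; ring.
  have [_ e1] := near_eq_is_derive N (is_deriveN (h i j)); exact: e1.
have D2 : partial m (christoffel g j i m) u = dom_ u m m * (i == j)%:R.
  have N : \near u, om u 0 m * (i == j)%:R = christoffel g j i m u.
    apply: open_near_eq oW _ Wu => w Ww; rewrite christoffel_conformal//.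
    by rewrite (negbTE im) (eq_sym m j) (negbTE jm) ?mulr0n ?mulr1n; ring.
  have [_ e1] := near_eq_is_derive N (is_derive_prod (h m m)
    (is_derive_cst ((i == j)%:R : R) u (delta_mx 0 m))).
  by apply: etrans e1 _; rewrite /cst; ring.
have D3 : \sum_q (christoffel g j i q u * christoffel g q m m u
                 - christoffel g j m q u * christoffel g q i m u)
  = (i == j)%:R * (om u 0 m ^+ 2 - dot (om u) (om u)) + om u 0 i * om u 0 j.
  set d := (i == j)%:R.
  have -> : \sum_q (christoffel g j i q u * christoffel g q m m u
                 - christoffel g j m q u * christoffel g q i m u) =
    \sum_q ((j == q)%:R * (om u 0 i * (2 * om u 0 m * (m == q)%:R - om u 0 q)) +
      (m == q)%:R * (2 * d * om u 0 q * om u 0 m) - d * (om u 0 q * om u 0 q) -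
      (i == q)%:R * (om u 0 j * (2 * om u 0 m * (m == q)%:R - om u 0 q)) -
      ((j == q)%:R * (om u 0 m * (om u 0 i * (m == q)%:R + om u 0 m * (i == q)%:R)) -
      (m == q)%:R * (om u 0 j * (om u 0 i * (m == q)%:R + om u 0 m * (i == q)%:R)))).
    apply: eq_bigr => q _; rewrite !christoffel_conformal// -/d.
    by rewrite eqxx (eq_sym m j) (negbTE jm) (negbTE im) !(eq_sym q) ?mulr0n ?mulr1n; ring.
  rewrite !(big_split, sumrN) /= !sum_delta -mulr_sumr /dot.
  by rewrite eqxx (eq_sym m j) (eq_sym m i) (negbTE jm) (negbTE im) -/d ?mulr0n ?mulr1n; ring.
rewrite sum_scalar_mx D1 D2 D3 /schouten_coef eqxx mulr1n.
move: (dom_ u i j) (dom_ u m m) (dot (om u) (om u)) ((i == j)%:R : R) (E u).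
by move: (om u 0 i) (om u 0 m) (om u 0 j) => *; field.
Qed.

End ConformallyFlat.

Section CurvatureBound.
Context {R : realType} {n : nat}.

Lemma sum_deltar k (f : 'I_n -> R) : \sum_q f q * (k == q)%:R = f k.
Proof. by rewrite -[RHS](sum_delta k f); apply: eq_bigr => q _; rewrite mulrC. Qed.

Lemma derive_row_sum m (f : 'rV[R]_n -> 'rV[R]_m) u v : differentiable f u ->
  'D_v f u = \sum_i v 0 i *: 'D_(delta_mx 0 i) f u.
Proof.
move=> df; have linE (L : {linear 'rV[R]_n -> 'rV[R]_m}) : L v = \sum_i v 0 i *: L (delta_mx 0 i).
  by rewrite {1}(row_sum_delta v) linear_sum; apply: eq_bigr => i _; rewrite linearZ.
apply: etrans (deriveE v df) _; apply: etrans (linE ('d f u)) _.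
by apply: eq_bigr => i _; congr (_ *: _); rewrite deriveE.
Qed.

Lemma riemann_form_delta (g : 'rV[R]_n -> 'M[R]_n) u a b c d :
  riemann_form g u (delta_mx 0 a) (delta_mx 0 b) (delta_mx 0 c) (delta_mx 0 d) =
  riemann g a b c d u.
Proof.
rewrite /riemann_form.
under eq_bigr => i _ do under eq_bigr => j _ do under eq_bigr => k _ do
  under eq_bigr => l _ do rewrite !delta_rowE.
under eq_bigr => i _ do under eq_bigr => j _ do under eq_bigr => k _ do
  rewrite sum_deltar.
under eq_bigr => i _ do under eq_bigr => j _ do rewrite sum_deltar.
under eq_bigr => i _ do rewrite sum_deltar.
by rewrite sum_deltar.
Qed.

Lemma gnorm_delta (g : 'rV[R]_n -> 'M[R]_n) u E i : 0 <= E ->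
  g u = (E ^+ 2)%:M -> Defs.gnorm g u (delta_mx 0 i) = E.
Proof.
move=> E0 gE; rewrite /Defs.gnorm gE.
under eq_bigr => k _ do under eq_bigr => l _ do rewrite !delta_rowE.
under eq_bigr => k _ do rewrite sum_deltar.
by rewrite sum_deltar mxE eqxx mulr1n sqrtr_sqr ger0_norm.
Qed.

Hypothesis hn : (3 <= n)%N.

Lemma third_index (i j : 'I_n) : exists m, (i != m) && (j != m).
Proof.
apply/existsP; rewrite -[X in is_true X]negbK negb_exists; apply/negP => /forallP h.
have : (#|'I_n| <= #|pred2 i j|)%N.
  apply/subset_leq_card/fintype.subsetP => m _; rewrite inE.
  by have := h m; rewrite negb_and !negbK !(eq_sym m).
by rewrite card_ord card2 => /(leq_trans hn); case: (i != j).
Qed.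

(** Three distinct indices are needed: off the diagonal a third index [m] isolates S i j, and 2 S i
    i is (S i i + S m m) + (S i i + S k k) - (S m m + S k k), of absolute value at most 6 K. *)
Lemma pairwise_bound (S : 'I_n -> 'I_n -> R) (K : R) : 0 <= K ->
  (forall i m j, i != m -> j != m -> `|S i j + (i == j)%:R * S m m| <= 2 * K) ->
  forall i j, `|S i j| <= 3 * K.
Proof.
move=> K0 h i j; have [<-|ij] := eqVneq i j; last first.
  have [m /andP [im jm]] := third_index i j.
  have := h i m j im jm; rewrite (negbTE ij) mul0r addr0; move: K0; lra.
have [m /andP [im _]] := third_index i i; have [k /andP [ik mk]] := third_index i m.
have := h i m i im im; have := h i k i ik ik; have := h m k m mk mk.
rewrite !eqxx !mul1r !ler_norml => /andP [a1 a2] /andP [b1 b2] /andP [c1 c2].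
by apply/andP; split; lra.
Qed.

Lemma row_mul_bound (S : 'I_n -> 'I_n -> R) (K : R) (v w : 'rV[R]_n) :
  (forall i j, `|S i j| <= K) -> (forall j, w 0 j = \sum_i v 0 i * S i j) ->
  dot w w <= (n%:R * K) ^+ 2 * dot v v.
Proof.
move=> h wE.
have K0 : 0 <= K.
  have [i _] := third_index (Ordinal (ltn_trans (isT : (0 < 2)%N) hn)) (Ordinal (ltn_trans (isT : (0 < 2)%N) hn)).
  exact: le_trans (normr_ge0 _) (h i i).
have hj j : w 0 j * w 0 j <= n%:R * K ^+ 2 * dot v v.
  pose s : 'rV[R]_n := \row_i S i j.
  have -> : w 0 j = dot v s by rewrite wE; apply: eq_bigr => i _; rewrite mxE.
  rewrite -expr2; apply: (le_trans (dot_CS v s)); rewrite mulrC.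
  apply: ler_wpM2r; first exact: dot_ge0.
  rewrite (_ : n%:R * K ^+ 2 = \sum_(i < n) K ^+ 2); last first.
    by rewrite sumr_const card_ord mulr_natl.
  apply: ler_sum => i _; rewrite mxE -expr2 -real_normK ?num_real//.
  by rewrite ler_sqr ?nnegrE.
apply: (@le_trans _ _ (\sum_(j < n) n%:R * K ^+ 2 * dot v v)).
  by apply: ler_sum => j _; exact: hj.
by rewrite sumr_const card_ord -mulr_natl le_eqVlt; apply/orP; left; apply/eqP; ring.
Qed.

Variables (W : set 'rV[R]_n) (g : 'rV[R]_n -> 'M[R]_n) (E : 'rV[R]_n -> R)
  (om : 'rV[R]_n -> 'rV[R]_n) (C : R).
Hypotheses (oW : open W) (E0 : forall u, W u -> 0 < E u)
  (gE : forall u, W u -> g u = (E u ^+ 2)%:M)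
  (dE : forall u v, W u -> is_derive u v E (E u * dot (om u) v))
  (dom : forall u, W u -> differentiable om u)
  (C0 : 0 <= C)
  (gC : forall u a b c d, W u -> `|riemann_form g u a b c d| <=
     C * (Defs.gnorm g u a * Defs.gnorm g u b * Defs.gnorm g u c * Defs.gnorm g u d)).

Lemma schouten_bound u v : W u ->
  dot (schouten om u v ('D_v om u)) (schouten om u v ('D_v om u)) <=
  (n%:R * (3 * (C * E u ^+ 2))) ^+ 2 * dot v v.
Proof.
move=> Wu; have domv u' v' : W u' -> derivable om u' v'.
  by move=> Wu'; apply: diff_derivable; exact: dom.
have e0 := E0 Wu.
apply: (@row_mul_bound (schouten_coef om u)).
  apply: pairwise_bound; first by rewrite mulr_ge0// sqr_ge0.
  move=> i m j im jm.
  have := @gC u (delta_mx 0 i) (delta_mx 0 m) (delta_mx 0 m) (delta_mx 0 j) Wu.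
  rewrite riemann_form_delta (riemann_conformal oW E0 gE dE domv Wu im jm).
  (* Coordinate vectors have norm E, so the curvature component is at most C E^4; dividing by E^2/2
     leaves 2 C E^2. *)
  have e2 : 0 < E u ^+ 2 / 2 by rewrite divr_gt0// exprn_gt0.
  rewrite !(gnorm_delta _ (ltW e0) (gE Wu)) normrM normrN (ger0_norm (ltW e2)).
  rewrite -(ler_pM2l e2 _ (2 * _)); congr (_ <= _); by field.
move=> j.
rewrite (derive_row_sum v (dom Wu)).
rewrite /schouten /schouten_coef.
have [D DE] : exists D : 'I_n -> 'rV[R]_n, forall i, 'D_(delta_mx 0 i) om u = D i.
  by eexists.
under eq_bigr => i _ do rewrite DE.
under [RHS]eq_bigr => i _ do rewrite DE.
rewrite !mxE summxE.
have -> : \sum_i v 0 i * (dot (om u) (om u) * (i == j)%:R + 2 * (D i) 0 j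
   - 2 * (om u 0 i * om u 0 j)) =
  \sum_i ((j == i)%:R * (dot (om u) (om u) * v 0 i) + 2 * (v 0 i * (D i) 0 j)
   + (- 2 * om u 0 j) * (om u 0 i * v 0 i)).
  by apply: eq_bigr => i _; rewrite (eq_sym j); ring.
rewrite !big_split /= sum_delta -!mulr_sumr.
congr (_ + _ + _); last by rewrite /dot; ring.
by congr (2 * _); apply: eq_bigr => i _; rewrite mxE.
Qed.

End CurvatureBound.

(** * The null frame of a conformal metric on a spherical domain *)

Section HorosphericalFrame.
Context {R : realType} {n : nat}.
Local Notation V := 'rV[R]_(1 + n.+1).
Variables (Omega U : set 'rV[R]_n.+1) (rho : 'rV[R]_n.+1 -> R).
Hypotheses (oU : open U) (OmegaE : Omega = U `&` @sphere R n)
  (srho : smooth_map (sphere_charts Omega) (rho : 'rV[R]_n.+1 -> R^o)).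

Definition horoP (x : 'rV[R]_n.+1) : V := expR (rho x) *: vec 1 x.
(** Twice the coefficient of e^{-t} in the explicit immersion; [horoP] is twice that of e^t. *)
Definition horoQ (x : 'rV[R]_n.+1) : V :=
  let dr := sphere_gradient Omega rho x in
  expR (- rho x) *: ((1 + dot dr dr) *: vec 1 x + 2 *: vec 0 (- x + dr)).

Lemma horospherical_leaf t x :
  horospherical_hypersurface Omega rho t x = leaf horoP horoQ t x.
Proof.
rewrite /horospherical_hypersurface /leaf /horoP /horoQ.
move: (sphere_gradient Omega rho x) => w.
have -> : - 2 * rho x - 2 * t = (- rho x - t) + (- (rho x + t)) by ring.
rewrite (opprD (rho x) t) !expRD !scalerDr !scalerA addrA -scalerDl; congr (_ *: _ + _ *: _).
  rewrite !expRN; field; by rewrite !gt_eqF ?mulr_gt0 ?expR_gt0.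
by field.
Qed.

Lemma omega_sgm x : Omega x -> exists e u, [/\ e * e = 1, sdom e U u & sgm e u = x].
Proof.
rewrite OmegaE => -[Ux x1].
have [e [e2 ne]] : exists e : R, e * e = 1 /\ 1 + e * time (x : 'rV[R]_(1 + n)) != 0.
  have [h|h] := leP 0 (time (x : 'rV[R]_(1 + n))); [exists 1|exists (- 1)].
    by split; [ring|rewrite mul1r gt_eqF//; move: h; lra].
  by split; [ring|rewrite gt_eqF//; move: h; lra].
exists e, (spr e x); split=> //; last exact: sgmK.
by rewrite /sdom /= sgmK.
Qed.

Lemma gradient_tangent x : Omega x -> dot (sphere_gradient Omega rho x) x = 0.
Proof.
move=> /omega_sgm [e [u [e2 Wu <-]]].
by rewrite (sphere_gradient_sgm e2 oU OmegaE srho Wu) sgradient_tangent.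
Qed.

Lemma horo_null_frame : null_frame Omega horoP horoQ.
Proof.
move=> x Ox; have g0 := gradient_tangent Ox.
have x1 : dot x x = 1 by move: Ox; rewrite OmegaE => -[].
rewrite /horoP /horoQ; move: (sphere_gradient Omega rho x) g0 => w w0.
have E : expR (rho x) * expR (- rho x) = 1 by rewrite -expRD subrr expR0.
have n1 : dot (- x) (- x) = dot x x by rewrite -scaleN1r dotZl dotZr; ring.
have n2 y : dot (- x) y = - dot x y by rewrite -scaleN1r dotZl; ring.
have n3 y : dot y (- x) = - dot x y by rewrite dotC n2.
split.
- by rewrite lorentzZl lorentzZr lorentz_vec x1; ring.
- rewrite lorentzZl lorentzZr !lorentzDl !lorentzDr !lorentzZl !lorentzZr !lorentz_vec.
  rewrite !dotDl !dotDr !n1 !n2 !n3 (dotC x w) w0 x1; ring.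
- rewrite lorentzZl lorentzZr mulrA E mul1r !lorentzDr !lorentzZr !lorentz_vec.
  rewrite !dotDr !n3 (dotC x w) w0 x1; ring.
- by rewrite timeZ time_vec mulr1 expR_gt0.
Qed.

Lemma direction_horo x : direction (horoP x) = x.
Proof.
by rewrite /horoP direction_scale ?gt_eqF ?expR_gt0// /direction time_vec space_vec invr1 scale1r.
Qed.

Lemma horo_injective : direction_injective Omega horoP.
Proof.
move=> x y l _ _ l0 /(congr1 direction).
by rewrite direction_scale ?gt_eqF// !direction_horo.
Qed.

Section Chart.
Variable e : R.
Hypothesis e2 : e * e = 1.
Local Notation W := (sdom e U).
Local Notation r := (srep e rho).

Definition cfactor u := expR (r u) * lam u.
(** The logarithmic derivative of [cfactor]: that of [lam] is - lam u. *)
Definition cform u : 'rV[R]_n := sgrad e rho u + (- lam u) *: u.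

Let oW : open W. Proof. exact: sdom_open. Qed.

Lemma cfactor_gt0 u : 0 < cfactor u.
Proof. by rewrite mulr_gt0 ?expR_gt0 ?lam_gt0. Qed.

Lemma is_derive_cfactor u v : W u -> is_derive u v cfactor (cfactor u * dot (cform u) v).
Proof.
move=> Wu; have dr := is_derive_srep e2 oU OmegaE srho v Wu.
have de : differentiable (@expR R) (r u) by exact/derivable1_diffP/derivable_expR.
have [dr1 dr2] := dr; have := is_derive_comp de dr1; rewrite dr2 => h.
have E : 'd (@expR R) (r u) (dot (sgrad e rho u) v) = expR (r u) * dot (sgrad e rho u) v.
  rewrite -[X in 'd _ _ X = _]mulr1 [LHS]linearZ /= -deriveE//.
  by rewrite derive_val mulrC.
rewrite E in h.
apply: is_derive_eq (is_derive_prod h (is_derive_lam u v)) _.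
rewrite /cfactor /cform dotDl dotZl /=; ring.
Qed.

Lemma Ck_cfactor k : Ck k W cfactor.
Proof.
by apply: (Ck_mul oW (Ck_expR oW (smooth_srep e2 oU OmegaE srho k)) (Ck_lam k oW)).
Qed.

Lemma Ck_cform k : Ck k W cform.
Proof.
have hl : Ck k W (fun u => - lam u).
  have h := Ck_scale (-1) oW (Ck_lam k oW).
  by apply: (Ck_ext oW _ h) => u _; rewrite /GRing.scale /= mulN1r.
exact: (Ck_add oW (Ck_sgrad e2 oU OmegaE srho k) (Ck_scalev oW hl (Ck_id k W))).
Qed.

Lemma horoP_sgm u : horoP (sgm e u) = frameP e cfactor u.
Proof.
rewrite /horoP /frameP /cfactor -scalerA; congr (_ *: _).
rewrite /horo !vecZ /sgm; move: (lamE u) (lam_gt0 u).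
move: (lam u) (dot u u) => l s h l0.
rewrite (_ : s = 2 / l - 1); last by rewrite -h; field; rewrite gt_eqF.
by congr (vec _ (vec _ _)); field; rewrite gt_eqF.
Qed.

Lemma sgradient_norm u : dot (sgradient e rho u) (sgradient e rho u) =
  (lam u)^-1 ^+ 2 * dot (sgrad e rho u) (sgrad e rho u).
Proof.
rewrite /sgradient dot_vec !dotDl !dotDr !dotZl !dotZr (dotC u (sgrad e rho u)).
move: (lamE u) (lam_gt0 u) (dot (sgrad e rho u) (sgrad e rho u)) (dot (sgrad e rho u) u).
move: (lam u) (dot u u) => l s h l0 q p.
rewrite (_ : - (e * p) * - (e * p) = (e * e) * (p * p)); last by ring.
rewrite e2.
rewrite (_ : s = 2 / l - 1); last by rewrite -h; field; rewrite gt_eqF.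
by field; rewrite gt_eqF.
Qed.

Lemma horoQ_sgm u : W u -> horoQ (sgm e u) = frameQ e cfactor cform u.
Proof.
move=> Wu; rewrite /horoQ (sphere_gradient_sgm e2 oU OmegaE srho Wu) sgradient_norm.
rewrite /frameQ /cfactor [in RHS]invfM -expRN -[RHS]scalerA; congr (_ *: _).
rewrite /sgradient /cform /cohoro /dhoro /horo /sgm -[- vec _ _]scaleN1r.
rewrite !(vecZ, vecD) !dotDl !dotDr !dotZl !dotZr (dotC u (sgrad e rho u)).
move: (lamE u) (lam_gt0 u) (dot (sgrad e rho u) (sgrad e rho u)) (dot (sgrad e rho u) u).
move: (sgrad e rho u) (lam u) (dot u u) => g l s h l0 q p.
have -> : s = 2 / l - 1 by rewrite -h; field; rewrite gt_eqF.
congr (vec _ (vec _ _)); try by field; rewrite gt_eqF.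
by apply/rowP => i; rewrite !mxE; field; rewrite gt_eqF.
Qed.

Lemma Ck_horoP k : Ck k W (horoP \o sgm e).
Proof.
have h1 := Ck_expR oW (smooth_srep e2 oU OmegaE srho k).
have h2 := Ck_vec oW (Ck_cst k W (1 : R)) (@smooth_sgm R n e W oW k).
exact: (Ck_scalev oW h1 h2).
Qed.

Lemma Ck_horoQ k : Ck k W (horoQ \o sgm e).
Proof.
have ho := Ck_cform k; have hi := Ck_id k W.
have hs := Ck_dot oW hi hi; have hd := Ck_dot oW hi ho.
have c1 : Ck k W (fun u : 'rV[R]_n => (1 + dot u u) / 2).
  exact: (Ck_mul oW (Ck_add oW (Ck_cst k W (1 : R)) hs) (Ck_cst k W (2^-1 : R))).
have c2 : Ck k W (fun u : 'rV[R]_n => e * ((1 - dot u u) / 2)).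
  have h := Ck_mul oW (Ck_cst k W (e : R)) (Ck_add oW (Ck_cst k W (1 : R)) (Ck_mul oW (Ck_cst k W (-1 : R)) c1)).
  by apply: (Ck_ext oW _ h) => u _; field.
have ch : Ck k W (horo e) by exact: (Ck_vec oW c1 (Ck_vec oW c2 hi)).
have c3 : Ck k W (fun u => - (e * dot u (cform u))).
  have h := Ck_mul oW (Ck_cst k W (- e : R)) hd.
  by apply: (Ck_ext oW _ h) => u _; rewrite mulNr.
have cd : Ck k W (fun u => dhoro e u (cform u)) by exact: (Ck_vec oW hd (Ck_vec oW c3 ho)).
have cV : Ck k W (fun u => (cfactor u)^-1).
  by apply: (Ck_inv oW _ (Ck_cfactor k)) => u _; rewrite gt_eqF// cfactor_gt0.
have hQ : Ck k W (frameQ e cfactor cform).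
  apply: (Ck_scalev oW cV (Ck_add oW (Ck_add oW (Ck_cst k W (2 *: cohoro e)) _) (Ck_scale 2 oW cd))).
  exact: (Ck_scalev oW (Ck_dot oW ho ho) ch).
by apply: (Ck_ext oW _ hQ) => u Wu; rewrite /= horoQ_sgm.
Qed.

Variable C : R.
Hypotheses (hn : (3 <= n)%N) (C0 : 0 <= C)
  (bC : forall c u, sphere_charts Omega c -> cdom c u ->
    let N := Defs.gnorm (conformal_metric rho c) u in
    forall a b d f, `|riemann_form (conformal_metric rho c) u a b d f|
                    <= C * (N a * N b * N d * N f)).

Lemma metric_sgm u : W u ->
  conformal_metric rho (Chart W (sgm e)) u = (cfactor u ^+ 2)%:M.
Proof.
move=> Wu; apply/matrixP => i j; rewrite !mxE /=.
have [_ ->] := is_derive_sgm e u (delta_mx 0 i).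
have [_ ->] := is_derive_sgm e u (delta_mx 0 j).
rewrite (dsgm_dot e2) dot_deltar delta_rowE -[RHS]mulr_natr /cfactor.
by rewrite (_ : 2 * _ = r u + r u) ?expRD; [ring|rewrite /srep; ring].
Qed.

Let derP u v : W u -> 'D_v (horoP \o sgm e) u =
  cfactor u *: (dhoro e u v + dot (cform u) v *: horo e u).
Proof.
move=> Wu; have N : \near u, frameP e cfactor u = (horoP \o sgm e) u.
  by apply: open_near_eq oW _ Wu => w _; rewrite /= horoP_sgm.
by have [_ ->] := near_eq_is_derive N (is_derive_frameP e (is_derive_cfactor v Wu)).
Qed.

Let derQ u v : W u -> exists k, 'D_v (horoQ \o sgm e) u =
  (cfactor u)^-1 *: (dhoro e u (schouten cform u v ('D_v cform u)) + k *: horo e u).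
Proof.
move=> Wu; have N : \near u, frameQ e cfactor cform u = (horoQ \o sgm e) u.
  by apply: open_near_eq oW _ Wu => w Ww; rewrite /= horoQ_sgm.
have dom : is_derive u v cform ('D_v cform u).
  by apply: derivableP; exact: (Ck_derivable v (Ck_cform 1) Wu).
have e0 : cfactor u != 0 by rewrite gt_eqF// cfactor_gt0.
have [_ ->] := near_eq_is_derive N (is_derive_frameQ e e0 (is_derive_cfactor v Wu) dom).
by exists (dot (cform u) (schouten cform u v ('D_v cform u))).
Qed.

Let spP u v : W u -> lorentz ('D_v (horoP \o sgm e) u) ('D_v (horoP \o sgm e) u) =
  cfactor u ^+ 2 * dot v v.
Proof. by move=> Wu; rewrite derP// lorentzZl lorentzZr (lorentz_horo e2) mulrA -expr2. Qed.

(** The norm of dQ is E^-1 times that of the Schouten vector, at most E^-1 (3 n C E^2) |v| = 3 n C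
    (E |v|), and E |v| is the norm of dP. *)
Let spQ u v : W u -> lorentz ('D_v (horoQ \o sgm e) u) ('D_v (horoQ \o sgm e) u) <=
  (n%:R * (3 * C)) ^+ 2 * (cfactor u ^+ 2 * dot v v).
Proof.
move=> Wu; have [k] := derQ v Wu; move: ('D_v (horoQ \o sgm e) u) => X ->.
rewrite lorentzZl lorentzZr (lorentz_horo e2).
have f0 w : W w -> 0 < cfactor w by move=> _; exact: cfactor_gt0.
have dom w : W w -> differentiable cform w.
  by move=> Ww; exact: (C1_differentiable_row oW Ww (Ck_cform 1)).
have gC w a b c d : W w -> `|riemann_form (conformal_metric rho (Chart W (sgm e))) w a b c d| <=
   C * (Defs.gnorm (conformal_metric rho (Chart W (sgm e))) w a *
        Defs.gnorm (conformal_metric rho (Chart W (sgm e))) w b *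
        Defs.gnorm (conformal_metric rho (Chart W (sgm e))) w c *
        Defs.gnorm (conformal_metric rho (Chart W (sgm e))) w d).
  by move=> Ww; exact: (bC (sgm_chart e2 oU OmegaE) Ww).
have dE w y (Ww : W w) := is_derive_cfactor y Ww.
have := schouten_bound hn oW f0 metric_sgm dE dom C0 gC v Wu.
have := cfactor_gt0 u; move: (cfactor u) => x x0.
move: (dot (schouten _ _ _ _) _) => s h.
have ci : 0 <= x^-1 ^+ 2 by rewrite sqr_ge0.
rewrite mulrA -expr2; apply: (le_trans (ler_wpM2l ci h)).
by rewrite le_eqVlt; apply/orP; left; apply/eqP; field; rewrite gt_eqF.
Qed.

Let normalQ u v : W u -> lorentz ('D_v (horoQ \o sgm e) u) (horoP (sgm e u)) = 0.
Proof.
move=> Wu; rewrite horoP_sgm /frameP.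
have [k] := derQ v Wu; move: ('D_v (horoQ \o sgm e) u) => X ->.
(* [horo u] itself is the case b = 0, l = 1. *)
have h := lorentz_horo e2 u (schouten cform u v ('D_v cform u)) 0 k 1.
have d0 : dhoro e u 0 = 0 by rewrite -(scale0r (0 : 'rV[R]_n)) dhoroZ scale0r.
rewrite d0 add0r scale1r in h.
have z (x : 'rV[R]_n) : dot x 0 = 0 by rewrite /dot big1// => i _; rewrite mxE mulr0.
by rewrite lorentzZl lorentzZr h z !mulr0.
Qed.

Lemma horo_chart : regular_chart Omega horoP horoQ (n%:R * (3 * C)) W (sgm e).
Proof.
have [_ si ss _ _] := sgm_chart e2 oU OmegaE.
split.
- exact: oW.
- by move=> u; exact: sdom_Omega.
- by move=> u u' Wu Wu'; apply: si; rewrite inE.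
- by move=> u _; exact: sgm_continuous.
- by move=> u Wu; exact: (C1_differentiable_row oW Wu (Ck_horoP 1)).
- by move=> u Wu; exact: (C1_differentiable_row oW Wu (Ck_horoQ 1)).
- move=> u v Wu /(etrans (esym (spP v Wu)))/eqP.
  by rewrite mulf_eq0 sqrf_eq0 gt_eqF ?cfactor_gt0//= => /eqP /dot_eq0.
- exact: normalQ.
- move=> u v Wu; have := spQ v Wu; rewrite -(spP v Wu); exact.
Qed.

End Chart.
End HorosphericalFrame.

(** * Limits of lifts from completeness *)

Section Completeness.
Context {R : realType} {n : nat}.
Local Notation V := 'rV[R]_(1 + n.+1).

(** The comparison is read off the definition of the integral of a nonnegative function as a
    supremum over simple functions below it, which spares a measurability proof for the speed. *)
Lemma integral_le_cst (f : R -> R) (K : R) :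
  (forall t, 0 <= t <= 1 -> 0 <= f t <= K) ->
  (\int[lebesgue_measure]_(t in `[0%R, 1%R]) (f t)%:E <= K%:E)%E.
Proof.
move=> h.
have hf t : [set` `[0%R, 1%R]] t -> 0 <= f t <= K by rewrite /= in_itv /=; exact: h.
have K0 : 0 <= K by have := h 0; rewrite lexx ler01 => /(_ isT) /andP[]; exact: le_trans.
have -> : (K%:E = \int[lebesgue_measure]_(t in `[0%R, 1%R]) (cst K%:E) t)%E.
  by rewrite integral_cst//= lebesgue_measure_itv /= lte_fin ltr01 oppr0 adde0 mule1.
rewrite integral_mkcond [leRHS]integral_mkcond !ge0_integralTE.
- apply: ereal_sup_le => _ [g hg <-]; exists g => // t; apply: (le_trans (hg t)).
  rewrite !patchE; case: ifPn => // /set_mem /hf /andP [_]; by rewrite lee_fin.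
- by move=> t; rewrite patchE; case: ifPn => // _; rewrite lee_fin.
- by move=> t; rewrite patchE; case: ifPn => // /set_mem /hf /andP []; rewrite lee_fin.
Qed.

Lemma curve_dist_le (Omega : set 'rV[R]_n.+1) (rho : 'rV[R]_n.+1 -> R)
    (g : R -> 'rV[R]_n.+1) (K : R) : domain_curve Omega g ->
  (forall t, 0 <= t <= 1 -> conformal_speed rho g t <= K) ->
  (curve_dist (domain_curve Omega) (conformal_speed rho) (g 0%R) (g 1%R) <= K%:E)%E.
Proof.
move=> dg hK; apply: le_trans (integral_le_cst (f := conformal_speed rho g) _).
  by apply: ereal_inf_lbound; exists g.
move=> t /hK ->; rewrite andbT /conformal_speed.
by rewrite mulr_ge0 ?expR_ge0// sqrtr_ge0.
Qed.

Lemma Ck_conic (W' : normedModType R) k (O : set W') (A W E : V) (f : W' -> R) :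
  open O -> Ck k O f -> Ck k O (fun t => conic A W E (f t)).
Proof.
move=> oO hf; apply: (Ck_add oO (Ck_add oO (Ck_cst k O A) _)).
  exact: (Ck_scalev oO hf (Ck_cst k O W)).
have h := Ck_scalev oO (Ck_mul oO hf hf) (Ck_cst k O E).
by apply: (Ck_ext oO _ h) => t _; rewrite expr2.
Qed.

Lemma Ck_direction (W' : normedModType R) k (O : set W') (F : W' -> V) : open O ->
  (forall t, O t -> time (F t) != 0) -> Ck k O F -> Ck k O (fun t => direction (F t)).
Proof.
move=> oO F0 hF; apply: Ck_row => // j.
have h := Ck_mul oO (Ck_inv oO F0 (Ck_coord 0 oO hF)) (Ck_coord (rshift 1 j) oO hF).
by apply: (Ck_ext oO _ h) => t _; rewrite /direction !mxE.
Qed.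

(* C^1 on the whole line with values in [0, 1], as needed to reparametrize a path
   on [0, 1] by a domain_curve *)
Definition hump (t : R) : R := (2 * t / (1 + t * t)) ^+ 2.

Lemma hump_ge0 t : 0 <= hump t <= 1.
Proof.
have d0 : 0 < 1 + t * t by rewrite ltr_pwDl// -expr2 sqr_ge0.
rewrite /hump sqr_ge0/= expr_div_n ler_pdivrMr ?exprn_gt0// mul1r -subr_ge0.
by rewrite (_ : _ - _ = (1 - t * t) ^+ 2) ?sqr_ge0//; ring.
Qed.

Lemma hump0 : hump 0 = 0. Proof. by rewrite /hump mulr0 mul0r expr0n. Qed.
Lemma hump1 : hump 1 = 1. Proof. by rewrite /hump; field. Qed.

Lemma Ck_hump k : Ck k setT (hump : R^o -> R).
Proof.
have oT : open (setT : set R^o) by exact: openT.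
have hi : Ck k setT (fun t : R^o => t : R) by exact: (Ck_id k (setT : set R^o)).
have hd : Ck k setT (fun t : R^o => 1 + (t : R) * t).
  exact: (Ck_add oT (Ck_cst k setT (1 : R)) (Ck_mul oT hi hi)).
have hV : Ck k setT (fun t : R^o => (1 + (t : R) * t)^-1).
  by apply: (Ck_inv oT _ hd) => t _; rewrite gt_eqF// ltr_pwDl// -expr2 sqr_ge0.
have h := Ck_mul oT (Ck_mul oT (Ck_cst k setT (2 : R)) hi) hV.
by apply: (Ck_ext oT _ (Ck_mul oT h h)) => t _; rewrite /hump expr2.
Qed.

Lemma bounded_on_segment (f : R -> R) : (forall t, 0 <= t <= 1 -> {for t, continuous f}) ->
  exists2 B, 0 <= B & forall t, 0 <= t <= 1 -> f t <= B.
Proof.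
move=> cf; have [|c hc H] := @EVT_max R f 0 1 ler01.
  by apply: continuous_in_subspaceT => t; rewrite inE /= in_itv /=; exact: cf.
exists (Num.max 0 (f c)); first by rewrite le_max lexx.
by move=> t ht; rewrite le_max H ?orbT// in_itv.
Qed.

Lemma is_derive_reparam (g : R -> 'rV[R]_n.+1) (h : R -> R) t :
  derivable (g : R^o -> 'rV[R]_n.+1) (h t) 1 -> derivable (h : R^o -> R) t 1 ->
  is_derive (t : R^o) 1 (fun s : R^o => g (h s)) ('D_1 h t *: 'D_1 g (h t)).
Proof.
move=> dg dh; have df : differentiable (g : R^o -> 'rV[R]_n.+1) (h t) by exact/derivable1_diffP.
have D := is_derive_comp df dh; apply: (is_derive_eq D).
rewrite -[X in 'd _ _ X = _]mulr1 [LHS]linearZ /=; congr (_ *: _).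
by rewrite (deriveE _ df).
Qed.

End Completeness.

Section LiftClosed.
Context {R : realType} {n : nat}.
Local Notation V := 'rV[R]_(1 + n.+1).
Variables (Omega : set 'rV[R]_n.+1) (rho : 'rV[R]_n.+1 -> R).

Section Path.
Variables (A W E : V) (s0 b : R).
Hypotheses (s01 : 0 < s0 <= 1)
  (tN : forall s : R, 0 <= s <= 1 -> 0 < time (conic A W E s)).
Let ga (s : R) := direction (conic A W E s).
Hypotheses (gaO : forall s, 0 <= s < s0 -> Omega (ga s))
  (gab : forall s, 0 <= s < s0 -> expR (rho (ga s)) <= b).

Let T : set R^o := [set s | 0 < time (conic A W E s)].

Let Ck_N k : Ck k (setT : set R^o) (conic A W E).
Proof. exact: (Ck_conic A W E openT (Ck_id k (setT : set R^o))). Qed.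

Let oT : open T.
Proof.
have c (s : R^o) : {for s, continuous (fun s : R^o => time (conic A W E s))}.
  by apply: time_continuous; exact: (Ck_continuous (Ck_N 0) (I : setT s)).
rewrite openE => s Ts; exact: (cvgr_gt _ (c s) _ Ts).
Qed.

Let T01 s : 0 <= s <= 1 -> T s. Proof. exact: tN. Qed.

Let Ck_ga k : Ck k T (ga : R^o -> 'rV[R]_n.+1).
Proof.
apply: (Ck_direction oT) => [t Tt|]; first by rewrite gt_eqF.
exact: (Ck_subset (@subsetT _ T) (Ck_N k)).
Qed.

Let s0T : T s0.
Proof. by apply: T01; move: s01 => /andP [/ltW -> ->]. Qed.

(** The directions of the conic are Lipschitz in the conformal distance: [b] bounds the conformal
    factor, and compactness of [0, 1] bounds the Euclidean speed. *)
Lemma segment_curve : exists2 K : R, 0 <= K & forall a c, 0 <= a < s0 -> 0 <= c < s0 ->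
  (curve_dist (domain_curve Omega) (conformal_speed rho) (ga a) (ga c)
    <= (K * `|c - a|)%:E)%E.
Proof.
have [B B0 hB] : exists2 B, 0 <= B & forall t, 0 <= t <= 1 ->
    dot ('D_1 (ga : R^o -> 'rV[R]_n.+1) t) ('D_1 (ga : R^o -> 'rV[R]_n.+1) t) <= B.
  apply: (bounded_on_segment (f := fun t => dot ('D_1 (ga : R^o -> 'rV[R]_n.+1) t) ('D_1 (ga : R^o -> 'rV[R]_n.+1) t))).
  move=> t ht; have c := Ck_continuous (Ck_derive (1 : R^o) (Ck_ga 1)) (T01 ht).
  exact: (dot_continuous c c).
have [X X0 hX] : exists2 X, 0 <= X & forall t, 0 <= t <= 1 ->
    'D_1 (hump : R^o -> R) t * 'D_1 (hump : R^o -> R) t <= X.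
  apply: (bounded_on_segment (f := fun t => 'D_1 (hump : R^o -> R) t * 'D_1 (hump : R^o -> R) t)).
  move=> t ht; have c := Ck_continuous (Ck_derive (1 : R^o) (Ck_hump 1)) (I : setT (t : R^o)).
  exact: (continuousM c c).
have b0 : 0 <= b.
  by apply: le_trans (gab (s := 0) _); [exact: expR_ge0|move: s01 => /andP [-> _]; rewrite lexx].
exists (b * Num.sqrt (X * B)); first by rewrite mulr_ge0// sqrtr_ge0.
move=> a c /andP [a0 a1] /andP [c0 c1].
(* A [domain_curve] must stay in the domain for all real t; [h] goes from a to c on [0, 1] and never
   leaves the segment between them. *)
pose h (t : R) := a + (c - a) * hump t.
have hin t : 0 <= h t < s0.
  have /andP [k0 k1] := hump_ge0 t; rewrite /h; move: (hump t) k0 k1 => k k0 k1.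
  rewrite (_ : a + _ = (1 - k) * a + k * c); last by ring.
  apply/andP; split; first by rewrite addr_ge0// mulr_ge0// subr_ge0.
  have [->|kp] := eqVneq k 0; first by rewrite subr0 mul1r mul0r addr0.
  have -> : s0 = (1 - k) * s0 + k * s0 by ring.
  apply: ler_ltD; first by rewrite ler_wpM2l ?subr_ge0// ltW.
  by rewrite ltr_pM2l// lt_neqAle eq_sym kp.
have h01 t : 0 <= h t <= 1.
  have /andP [-> u] := hin t; move: s01 => /andP [_ s1] /=; exact: (ltW (lt_le_trans u s1)).
have oR : open (setT : set R^o) by exact: openT.
have Ck_h k : Ck k (setT : set R^o) (h : R^o -> R).
  exact: (Ck_add oR (Ck_cst k setT (a : R)) (Ck_mul oR (Ck_cst k setT (c - a : R)) (Ck_hump k))).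
have dc : domain_curve Omega (fun t => ga (h t)).
  split; last by move=> t; apply: gaO; exact: hin.
  apply: (Ck_direction oR) => [t _|]; first by rewrite gt_eqF// tN.
  exact: (Ck_conic A W E oR (Ck_h 1)).
have := @curve_dist_le R n Omega rho (fun t => ga (h t)) (b * Num.sqrt (X * B) * `|c - a|) dc.
have -> : h 0 = a by rewrite /h hump0 mulr0 addr0.
have -> : h 1 = c by rewrite /h hump1 mulr1 addrC subrK.
apply=> t t01; rewrite /conformal_speed derive1E.
have dh : derivable (h : R^o -> R) t 1 by exact: (Ck_derivable (1 : R^o) (Ck_h 1%N) (I : setT (t : R^o))).
have dg : derivable (ga : R^o -> 'rV[R]_n.+1) (h t) 1.
  exact: (Ck_derivable (1 : R^o) (Ck_ga 1%N) (T01 (h01 t))).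
have hE : 'D_1 (h : R^o -> R) t = (c - a) * 'D_1 (hump : R^o -> R) t.
  have db := derivableP (Ck_derivable (1 : R^o) (Ck_hump 1) (I : setT (t : R^o))).
  have D := is_deriveD (is_derive_cst (a : R) (t : R^o) 1)
    (is_derive_prod (is_derive_cst (c - a : R) (t : R^o) 1) db).
  by have [_ D2] := D; apply: (etrans D2); rewrite /cst mul0r !add0r.
have [_ dE] := is_derive_reparam dg dh.
rewrite dE hE dotZl dotZr.
have := hB _ (h01 t); have := hX _ t01; have := gab (hin t).
have := dot_ge0 ('D_1 (ga : R^o -> 'rV[R]_n.+1) (h t)).
move: (dot _ _) ('D_1 _ t) (expR _) (expR_ge0 (rho (ga (h t)))) => d y z z0 d0 zb yX dB.
rewrite (_ : _ * (_ * d) = (c - a) ^+ 2 * (y * y * d)); last by ring.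
rewrite sqrtrM ?sqr_ge0// sqrtr_sqr mulrA mulrAC; apply: ler_wpM2r => //.
apply: ler_pM; [exact: z0|exact: sqrtr_ge0|exact: zb|].
by rewrite ler_wsqrtr//; apply: ler_pM => //; rewrite -expr2 sqr_ge0.
Qed.

Lemma segment_limit : complete_conformal Omega rho -> Omega (ga s0).
Proof.
move=> comp; have [K K0 hK] := segment_curve.
have /andP [sp s1] := s01.
pose u k : R := s0 - s0 * harmonic k.
have uin k : 0 <= u k < s0.
  rewrite /u /harmonic /= gtrBl mulr_gt0 ?invr_gt0 ?ltr0n// andbT subr_ge0.
  by rewrite ler_piMr ?invf_le1 ?ler1n ?ltr0n// ltW.
have uc : u @ \oo --> s0.
  have h : (fun k => s0 - s0 * harmonic k) @ \oo --> s0 - s0 * 0.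
    apply: cvgB; first exact: cvg_cst.
    by apply: cvgM; [exact: cvg_cst|exact: cvg_harmonic].
  by move: h; rewrite mulr0 subr0.
have [|e e0|q Oq hq] := comp (fun k => ga (u k)).
- by move=> k; exact: gaO.
(* Then K * 2 d = e K / (K + 1), which is strictly below [e] even for K = 0. *)
- pose d := e / (2 * (K + 1)).
  have K1 : 0 < K + 1 by rewrite ltr_wpDl.
  have d0 : 0 < d by rewrite divr_gt0// mulr_gt0.
  have [N _ hN] := (cvgrPdist_lt _ _).1 uc d d0.
  exists N => k l Nk Nl; apply: (le_lt_trans (hK _ _ (uin k) (uin l))); rewrite lte_fin.
  have dd : `|u l - u k| <= d + d.
    rewrite -(subrKA s0) (le_trans (ler_normD _ _))//; apply: lerD; apply: ltW.
      by rewrite distrC; exact: (hN l Nl).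
    exact: (hN k Nk).
  apply: (le_lt_trans (ler_wpM2l K0 dd)).
  rewrite (_ : _ * _ = e * (K / (K + 1))); last first.
    by rewrite /d; field; rewrite gt_eqF.
  by rewrite gtr_pMr// ltr_pdivrMr// mul1r ltrDl.
- have gc : (fun k => ga (u k)) @ \oo --> ga s0.
    have c : ga x @[x --> s0] --> ga s0 by exact: (Ck_continuous (Ck_ga 0) s0T).
    exact: (cvg_comp _ _ uc c).
  by rewrite -(cvg_unique (@norm_hausdorff _ _) hq gc).
Qed.

End Path.

(** The Gauss map is the identity here, so the lift is the curve of directions itself, and the bound
    on the time of P is a bound on exp rho along it. *)
Lemma horo_lift_closed : complete_conformal Omega rho ->
  lift_closed Omega (horoP rho) (horoQ Omega rho).
Proof.
move=> comp A W E s0 b s01 _ tN h.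
have hc s : 0 <= s < s0 -> Omega (direction (conic A W E s)) /\
    expR (rho (direction (conic A W E s))) <= b.
  move=> hs; have [p [l [[Op l0 Pp] tb _]]] := h s hs.
  have pE : p = direction (conic A W E s).
    by rewrite -(direction_horo rho p) Pp direction_scale// gt_eqF.
  by rewrite -pE; split=> //; move: tb; rewrite /horoP timeZ time_vec mulr1.
have O0 : Omega (direction (conic A W E s0)).
  by apply: (segment_limit (b := b) s01 tN _ _ comp) => s /hc [].
have t0 : 0 < time (conic A W E s0) by apply: tN; move: s01 => /andP [/ltW -> ->].
exists (direction (conic A W E s0)),
  (expR (rho (direction (conic A W E s0))) / time (conic A W E s0)).
split=> //; first by rewrite divr_gt0// expR_gt0.
rewrite {4}(direction_vec (lt0r_neq0 t0)) scalerA divfK ?gt_eqF//.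
Qed.

End LiftClosed.

Section SphericalUnfolding.
Context {R : realType} {n : nat}.
Local Notation V := 'rV[R]_(1 + n.+1).
Variables (Omega U : set 'rV[R]_n.+1) (rho : 'rV[R]_n.+1 -> R).
Hypotheses (oU : open U) (OmegaE : Omega = U `&` @sphere R n)
  (srho : smooth_map (sphere_charts Omega) (rho : 'rV[R]_n.+1 -> R^o)).

Lemma Ck_leaf_sgm e k t : e * e = 1 ->
  Ck k (sdom e U) (leaf (horoP rho) (horoQ Omega rho) t \o sgm e).
Proof.
move=> e2; have oW := @sdom_open R n e U oU.
have hP := Ck_scale (expR t) oW (Ck_horoP oU OmegaE srho e2 k).
have hQ := Ck_scale (expR (- t)) oW (Ck_horoQ oU OmegaE srho e2 k).
exact: (Ck_scale 2^-1 oW (Ck_add oW hP hQ)).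
Qed.

Lemma tdom_cover (c : chart R n 'rV[R]_n.+1) :
  cdom c `<=` tdom 1 c `|` tdom (-1) c.
Proof.
move=> u cu; have [h|h] := leP 0 (time (c u : 'rV[R]_(1 + n))).
  by left; split=> //=; rewrite mul1r gt_eqF//; move: h; lra.
by right; split=> //=; rewrite gt_eqF//; move: h; lra.
Qed.

Lemma smooth_horospherical t :
  smooth_map (sphere_charts Omega) (leaf (horoP rho) (horoQ Omega rho) t).
Proof.
move=> c cS k; apply: (Ck_subset (@tdom_cover c)).
have e1 : (1 : R) * 1 = 1 by ring.
have em : (-1 : R) * -1 = 1 by ring.
have piece e : e * e = 1 -> Ck k (tdom e c) (leaf (horoP rho) (horoQ Omega rho) t \o c).
  move=> e2.
  have h := Ck_comp_row (tdom_open (e := e) cS) (sdom_open (e := e) oU)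
    (fun u (tu : tdom e c u) => tdom_sdom e2 OmegaE cS tu) (Ck_leaf_sgm k t e2) (Ck_transition e cS k).
  apply: (Ck_ext (tdom_open (e := e) cS) _ h) => u tu.
  by have /= := tdomK e2 cS tu => ->.
by apply: Ck_union; exact: piece.
Qed.

Variable C : R.
Hypotheses (hn : (3 <= n)%N) (C0 : 0 <= C)
  (bC : forall c u, sphere_charts Omega c -> cdom c u ->
    let N := Defs.gnorm (conformal_metric rho c) u in
    forall a b d f, `|riemann_form (conformal_metric rho c) u a b d f|
                    <= C * (N a * N b * N d * N f)).

(** By [leaf_immersed] in a stereographic chart, the coordinate change [spr e \o c] kills [v]; then
    so does [c], which is regular. *)
Lemma immersed_horospherical t (c : chart R n 'rV[R]_n.+1) u v :
  100 * (100 * (n%:R * (3 * C) * expR (- t) ^+ 2)) <= 1 ->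
  sphere_charts Omega c -> cdom c u ->
  'D_v (leaf (horoP rho) (horoQ Omega rho) t \o c) u = 0 -> v = 0.
Proof.
move=> ht cS cu D0.
have [e [e2 tu]] : exists e : R, e * e = 1 /\ tdom e c u.
  by have [tu|tu] := tdom_cover cu; [exists 1|exists (-1)]; split=> //; ring.
have Wu : sdom e U ((spr e \o c) u) := tdom_sdom e2 OmegaE cS tu.
have [_ dc] := (transition_derive e2 oU OmegaE srho cS v tu).1.
have dt : derivable (spr e \o c) u v by exact: (Ck_derivable v (Ck_transition e cS 1) tu).
have dl : differentiable (leaf (horoP rho) (horoQ Omega rho) t \o sgm e) ((spr e \o c) u).
  exact: (C1_differentiable_row (sdom_open (e := e) oU) Wu (Ck_leaf_sgm 1 t e2)).
have D := is_derive_comp dl dt.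
have N : \near u, ((leaf (horoP rho) (horoQ Omega rho) t \o sgm e) \o (spr e \o c)) u =
    (leaf (horoP rho) (horoQ Omega rho) t \o c) u.
  by apply: open_near_eq (tdom_open (e := e) cS) _ tu => w tw; have /= := tdomK e2 cS tw => ->.
have [_ D2] := near_eq_is_derive N D.
have rc := horo_chart oU OmegaE srho e2 hn C0 bC.
have nf := horo_null_frame oU OmegaE srho.
have C1 : 0 <= n%:R * (3 * C) by rewrite !mulr_ge0.
have a0 : 'D_v (spr e \o c) u = 0.
  apply: (leaf_immersed nf rc Wu ht C1).
  exact: (etrans (deriveE _ dl) (etrans (esym D2) D0)).
have [_ _ _ ci _] := cS; apply: (ci u v cu); rewrite dc a0.
have z (x : 'rV[R]_n) : dot x 0 = 0 by rewrite /dot big1// => i _; rewrite mxE mulr0.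
rewrite /dsgm z !mulr0 !oppr0 scaler0 scale0r addr0.
by rewrite -(scale0r (vec 0 0 : 'rV[R]_n.+1)) vecZ mul0r scaler0.
Qed.

Lemma horospherical_unfolding : complete_conformal Omega rho ->
  exists t0 : R, forall t, t0 <= t ->
      (forall x, Omega x -> hyperboloid (horospherical_hypersurface Omega rho t x)) /\
      embedding Omega (sphere_charts Omega) (horospherical_hypersurface Omega rho t).
Proof.
move=> comp; have C1 : 0 <= n%:R * (3 * C) by rewrite !mulr_ge0.
exists (100 * (100 * (n%:R * (3 * C))) + 1) => t /(small_at_large_time C1) ht.
have nf := horo_null_frame oU OmegaE srho.
have di := @horo_injective R n Omega rho.
have at' p : Omega p -> exists W c u,
    [/\ regular_chart Omega (horoP rho) (horoQ Omega rho) (n%:R * (3 * C)) W c, W u & c u = p].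
  move=> /(omega_sgm OmegaE) [e [u [e2 Wu up]]]; exists (sdom e U), (sgm e), u; split=> //.
  exact: (horo_chart oU OmegaE srho e2 hn C0 bC).
have lo := atlas_lift_open nf di at'.
have dn := atlas_direction_near nf di at'.
have lc := horo_lift_closed comp.
have E : horospherical_hypersurface Omega rho t = leaf (horoP rho) (horoQ Omega rho) t.
  by apply/funext => x; exact: horospherical_leaf.
rewrite E; split; first by move=> x Ox; exact: (leaf_hyperboloid nf t Ox).
split.
- split; first exact: smooth_horospherical.
  by move=> c u v cS cu; exact: (immersed_horospherical ht cS cu).
- exact: (leaf_injective nf di lo lc C1 hn ht).
- move=> x B Ox xB; exact: (leaf_near nf di lo lc C1 dn hn ht Ox xB).
Qed.

End SphericalUnfolding.

Theorem theorem1p3 (R : realType) (n : nat) (hn : (3 <= n)%N) :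
  (forall (M : topologicalType) (A : set (chart R n M))
      (phi eta : M -> 'rV[R]_(1 + n.+1)) (G : M -> 'rV[R]_n.+1),
    smooth_manifold A ->
    immersed_hypersurface A phi ->
    unit_normal A phi eta ->
    proper_map phi ->
    complete_hypersurface A phi ->
    uniformly_horospherically_convex A phi eta ->
    gauss_map phi eta G ->
    injective G ->
    union_of_closed_submanifolds (boundary_at_infinity phi) ->
    exists2 t0 : R, 0 < t0 & forall t, t0 <= t ->
      (forall p, hyperboloid (normal_flow phi eta t p)) /\
      embedding [set: M] A (normal_flow phi eta t))
  /\
  (forall (Omega : set 'rV[R]_n.+1) (rho : 'rV[R]_n.+1 -> R),
    spherical_domain Omega ->
    smooth_map (sphere_charts Omega) (rho : 'rV[R]_n.+1 -> R^o) ->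
    complete_conformal Omega rho ->
    bounded_curvature Omega rho ->
    union_of_closed_submanifolds (closure Omega `\` Omega) ->
    exists t0 : R, forall t, t0 <= t ->
      (forall x, Omega x ->
         hyperboloid (horospherical_hypersurface Omega rho t x)) /\
      embedding Omega (sphere_charts Omega)
        (horospherical_hypersurface Omega rho t)).
Proof.
split.
- move=> M A phi eta G [_ _ _ mA] imm nor prop _ [k0 k01 hk] gm Ginj _.
  exact: (unfolding mA imm nor prop gm Ginj k01 hk hn).
- move=> Omega rho [[U oU OmegaE] _ _] srho comp [C bC] _.
  (* The constant of [bounded_curvature] carries no sign, so its absolute value is used. *)
  apply: (@horospherical_unfolding R n Omega U rho oU OmegaE srho `|C| hn) => // c u cS cu.
  move=> N a b d f; apply: (le_trans (bC c u cS cu a b d f)).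
  by apply: ler_wpM2r; [rewrite !mulr_ge0// sqrtr_ge0|exact: ler_norm].
Qed.
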